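(* Let $n\ge2$ and let $(p_1,p_2):(\mathbb{C}^n,0)\to(\mathbb{C}^{2n},0)$ be a divergent diagram of $\underline{k}$-folds, $\underline{k}=(k_1,k_2)$, associated with a pair $(\alpha_1,\alpha_2)$ of transversal linear reflections on $(\mathbb{C}^n,0)$ of orders $k_1,k_2\ge2$ and eigenvalues $\lambda_1,\lambda_2\neq1$, respectively. Let $\Lambda=\langle\alpha_1,\alpha_2\rangle$ be the group generated by $\alpha_1,\alpha_2$. (i) If $\Lambda$ is Abelian, then $(p_1,p_2)$ is equivalent to $(f_1,f_2)$, where $f_1(x)=(x_1^{k_1},x_2,\dots,x_n)$ and $f_2(x)=(x_1,x_2^{k_2},x_3,\dots,x_n)$. (ii) Suppose that $\Lambda$ is non-Abelian and $\mathrm{tr}(\alpha_1\circ\alpha_2)\ne\lambda_1\lambda_2+(n-1)$. If $E_{\lambda_2}^{\alpha_2}\subseteq\mathrm{Fix}(\alpha_1)$, then $(p_1,p_2)$ is equivalent to $(g_1,g_2)$, where $$g_1(x)=\Bigl(x_1^{k_1},\ \tfrac{1}{1-\lambda_1}x_1+x_2,\ x_3,\dots,x_n\Bigr),\qquad g_2(x)=(x_1,x_2^{k_2},x_3,\dots,x_n).$$ If $E_{\lambda_2}^{\alpha_2}\not\subseteq\mathrm{Fix}(\alpha_1)$, then $(p_1,p_2)$ is equivalent to $(g_1,g_2)$, where $$g_1(x)=\Bigl(x_1^{k_1},\ \tfrac{\mathrm{tr}(\alpha_1\circ\alpha_2)-\lambda_1-\lambda_2+(2-n)}{1-\lambda_1}x_1+x_2,\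 x_3,\dots,x_n\Bigr),\qquad g_2(x)=\Bigl(x_1+\tfrac{1}{1-\lambda_2}x_2,\ x_2^{k_2},\ x_3,\dots,x_n\Bigr).$$ (iii) For $n\ge3$, suppose that $\Lambda$ is non-Abelian and $\mathrm{tr}(\alpha_1\circ\alpha_2)=\lambda_1\lambda_2+(n-1)$. If $E_{\lambda_1}^{\alpha_1}=E_{\lambda_2}^{\alpha_2}$, then $(p_1,p_2)$ is equivalent to $(g_1,g_2)$, where $$g_1(x)=\bigl(x_1^{k_1},\ (1-\lambda_2)x_1+x_2,\ x_3,\dots,x_n\bigr),\qquad g_2(x)=\Bigl(x_1+\tfrac{1}{1-\lambda_2}x_2,\ x_2^{k_2},\ x_3,\dots,x_n\Bigr).$$ If $E_{\lambda_1}^{\alpha_1}\ne E_{\lambda_2}^{\alpha_2}$, then $(p_1,p_2)$ is equivalent to $(g_1,g_2)$, where $$g_1(x)=\bigl(x_1^{k_1},\ (1-\lambda_2)x_1+x_2,\ x_3,\dots,x_n\bigr),\qquad g_2(x)=\Bigl(x_1+\tfrac{1}{1-\lambda_2}x_2,\ x_2^{k_2},\ \tfrac{1}{1-\lambda_2}x_2+x_3,\ x_4,\dots,x_n\Bigr).$$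
   Context: Here $x=(x_1,\dots,x_n)$ and all maps are germs at $0$ of holomorphic maps fixing $0$. A (complex) reflection is a germ of biholomorphism $\varphi$ of $(\mathbb{C}^n,0)$ of finite order $\ge2$ whose fixed-point set $\mathrm{Fix}(\varphi)$ is a submanifold of codimension $1$; a linear reflection of order $k$ has exactly one eigenvalue different from $1$ (a primitive $k$-th root of unity, of multiplicity one), and $\lambda_i$ denotes this eigenvalue for $\alpha_i$. $E_{\lambda_i}^{\alpha_i}$ denotes the eigenspace of $\alpha_i$ for the eigenvalue $\lambda_i$, and $\mathrm{tr}$ is the trace. Two reflections are transversal if their fixed-point sets are transversal at $0$ (so that their tangent spaces at $0$ intersect in codimension $2$). For $k\ge2$, a $k$-fold is a holomorphic germ $f:(\mathbb{C}^n,0)\to(\mathbb{C}^n,0)$ of the form $l\circ F\circ h^{-1}$, where $F(x)=(x_1^k,x_2,\dots,x_n)$ and $h,l$ are germs of biholomorphisms of $(\mathbb{C}^n,0)$. A divergent diagram of $(k_1,k_2)$-folds is a pair $(p_1,p_2)$ with $p_i$ a $k_i$-fold on $(\mathbb{C}^n,0)$; it is associated with the pair of reflections $(\alpha_1,\alpha_2)$ if $p_i\circ\alpha_i=p_i$ for $i=1,2$. Two divergent diagrams $(p_1,p_2)$ and $(g_1,g_2)$ are equivalent if there are germs of biholomorphisms $l_1,l_2,h$ of $(\mathbb{C}^n,0)$ with $g_i=l_i\circ p_i\circ h^{-1}$ for $i=1,2$. *)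

(* Defs.v *)
(* C is R[i] with R : realType.  The definitions are stated over
   a numFieldType K: R[i] has a canonical numFieldType structure but no
   topology of its own, and 'rV[K]_n gets its topology and norm from K.
   A germ at 0 is represented by a total function, every clause about it being
   required only near 0. *)
From HB Require Import structures.
From mathcomp Require Export all_boot all_order all_algebra.
From mathcomp Require Export complex.
From mathcomp Require Export all_classical all_reals all_analysis.
Export numFieldNormedType.Exports.
Export Order.TTheory GRing.Theory Num.Theory.
Set Implicit Arguments.
Unset Strict Implicit.
Unset Printing Implicit Defensive.
Global Open Scope classical_set_scope.
Global Open Scope ring_scope.

Section Germs.
Variables (K : numFieldType) (n : nat).
Local Notation V := 'rV[K]_n.
Implicit Types (f g h l p a : V -> V) (S : set V) (k c : nat).

Definition germ_eq f g := \forall x \near (0 : V), f x = g x.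

(* For K = R[i], differentiability is complex differentiability. *)
Definition holo_germ f :=
  f 0 = 0 /\ \forall x \near (0 : V), differentiable f x.

Definition germ_inverse h g :=
  [/\ holo_germ h, holo_germ g, germ_eq (g \o h) id & germ_eq (h \o g) id].

Definition biholo_germ h := exists g, germ_inverse h g.

Definition Fix f : set V := [set x | f x = x].

(* Germ at 0 of a submanifold of codimension c through 0: in suitable
   holomorphic coordinates h it is the vanishing locus of the first c ones. *)
Definition submanifold_germ c S :=
  (c <= n)%N /\
  exists2 h, biholo_germ h &
    \forall x \near (0 : V),
      S x <-> forall i : 'I_n, (i < c)%N -> h x ord0 i = 0.

Definition germ_order f k :=
  [/\ (0 < k)%N, germ_eq (iter k f) id
    & forall j, (0 < j < k)%N -> ~ germ_eq (iter j f) id].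

Definition reflection f k :=
  [/\ biholo_germ f, (2 <= k)%N, germ_order f k & submanifold_germ 1 (Fix f)].

(* Tangent vectors at 0, as velocities of holomorphic curves; K^o is K as a
   normed module over itself. *)
Definition tangent S : set V := [set v |
  exists y : K^o -> V,
    [/\ y 0 = 0, \forall t \near (0 : K^o), differentiable y t,
        \forall t \near (0 : K^o), S (y t)
      & is_derive (0 : K^o) (1 : K^o) y v]].

Definition transversal S1 S2 := forall w : V, exists v1 v2,
  [/\ tangent S1 v1, tangent S2 v2 & w = v1 + v2].

Definition transversal_reflections a1 a2 := transversal (Fix a1) (Fix a2).

(* Coordinates are numbered from 0, and crd x j = 0 when n <= j. *)
Definition crd (x : V) (j : nat) : K := oapp (x ord0) 0 (insub j).

(* x with its first coordinates replaced by the entries of s. *)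
Definition with_head (x : V) (s : seq K) : V :=
  \row_i nth (x ord0 i) s i.

Definition std_fold k (x : V) : V := with_head x [:: crd x 0 ^+ k].

Definition is_fold k f :=
  (2 <= k)%N /\
  exists l h h',
    [/\ biholo_germ l, germ_inverse h h' & germ_eq f (l \o std_fold k \o h')].

Definition divergent_diagram k1 k2 p1 p2 := is_fold k1 p1 /\ is_fold k2 p2.

Definition associated p1 p2 a1 a2 :=
  germ_eq (p1 \o a1) p1 /\ germ_eq (p2 \o a2) p2.

Definition equivalent_diagrams p1 p2 g1 g2 :=
  exists l1 l2 h h',
    [/\ biholo_germ l1, biholo_germ l2, germ_inverse h h',
        germ_eq g1 (l1 \o p1 \o h') & germ_eq g2 (l2 \o p2 \o h')].

Inductive generated a1 a2 : (V -> V) -> Prop :=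
| gen_id : generated a1 a2 id
| gen_l : generated a1 a2 a1
| gen_r : generated a1 a2 a2
| gen_comp f g :
    generated a1 a2 f -> generated a1 a2 g -> generated a1 a2 (f \o g)
| gen_inv f g :
    generated a1 a2 f -> cancel f g -> cancel g f -> generated a1 a2 g.

Definition generated_abelian a1 a2 := forall f g,
  generated a1 a2 f -> generated a1 a2 g -> f \o g = g \o f.

(* lin1_mx f is the matrix M with f v = v *m M for linear f; eigenspaces in
   mxalgebra are likewise those of right multiplication on row vectors. *)
Definition tr_map f : K := \tr (lin1_mx f).

Definition eigenvalue_map f (c : K) := eigenvalue (lin1_mx f) c.

Definition eigenspace_map f (c : K) : set V :=
  [set v | (v <= eigenspace (lin1_mx f) c)%MS].

End Germs.

(* Main.v *)
(* Write a_i = 1 + phi_i u_i with a functional phi_i and an eigenvector u_i; the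
   rank is one because Fix a_i is a hypersurface, and l_i = 1 + phi_i(u_i) is then
   a primitive k_i-th root of unity.

   A k-fold p with p o a = p is determined by a up to a biholomorphism on the left.
   Indeed, in linear coordinates diagonalising a, a holomorphic germ invariant under
   the rotation x_1 -> l x_1 factors holomorphically through the standard fold F.
   The factor is continuous, and differentiable off x_1 = 0; on x_1 = 0 it is
   differentiable by Riemann's removable singularity theorem, applied to the slices
   in x_1 with uniform bounds (Cauchy's formula on squares, from Goursat's lemma).
   If p = l o F o g, then F o g factors through F, and so does F o g^-1: counting the
   points of a generic fibre of F shows that g conjugates the rotations into each
   other. The two factors are inverse to each other.

   So it suffices to find linear coordinates in which each g_i is invariant under
   a_i. The invariants are alpha = phi_2(u_1) and beta = phi_1(u_2): the group is
   Abelian iff alpha = beta = 0, and the trace condition says that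
   alpha beta = (1 - l_1) (1 - l_2), i.e. that the matrix (phi_j(u_i)) is singular.
   The first two coordinates are multiples of phi_1 and phi_2, and the values of
   the coordinates on u_1 and u_2 are prescribed by g_1 and g_2. *)
Require Import Defs.
From mathcomp Require Import perm ring lra.

Set Implicit Arguments.
Unset Strict Implicit.
Unset Printing Implicit Defensive.

(** * Complex line integrals *)

(** An equivalence of diagrams has one source change [h] shared by both folds but independent target
    changes [l1], [l2]. Since the reflections are linear, [h] can be taken linear, and everything
    nonlinear in a fold is absorbed on its own target side. This is why the two folds never have to
    be straightened simultaneously.

    The analytic obstacle is regularity of the descended map on the branch hyperplane. There it is
    defined through a discontinuous choice of roots, and holomorphy on each slice in the first
    coordinate does not by itself give a joint derivative. What is needed is a second-order
    remainder with a constant common to all slices, together with continuity of the slice derivative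
    in the remaining coordinates.

    The value of the contour integral of dz / (z - a) is never computed. Cauchy's formula is kept as
    f(a) W(a) = I(a), where W is the same integral for the constant function 1; it suffices that W
    stays away from 0, and Taylor data of f come from dividing the expansions of I and W. *)

Section Modulus.
Variable R : realType.
Implicit Types z w : R[i].

(* The library norm of R[i] takes its values in R[i]; md, and nv below for
   vectors, are the real-valued versions. *)
Definition md z : R := complex.Re `|z|.

Lemma mdE z : `|z| = (md z)%:C%C.
Proof. by rewrite /md RRe_real // normr_real. Qed.

Lemma md_ge0 z : 0 <= md z.
Proof. by rewrite -lecR -mdE normr_ge0. Qed.

Lemma mdM z w : md (z * w) = md z * md w.
Proof. by apply: complexI; rewrite rmorphM /= -!mdE normrM. Qed.

Lemma mdD z w : md (z + w) <= md z + md w.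
Proof. by rewrite -lecR rmorphD /= -!mdE ler_normD. Qed.

Lemma mdN z : md (- z) = md z.
Proof. by rewrite /md normrN. Qed.

Lemma mdB z w : md (z - w) <= md z + md w.
Proof. by rewrite -[md w]mdN; exact: mdD. Qed.

Lemma md_distC z w : md (z - w) = md (w - z).
Proof. by rewrite /md distrC. Qed.

Lemma md0 : md 0 = 0. Proof. by rewrite /md normr0. Qed.
Lemma md1 : md 1 = 1. Proof. by rewrite /md normr1. Qed.

Lemma md_eq0 z : (md z == 0) = (z == 0).
Proof. by rewrite -[z == 0]normr_eq0 mdE -(inj_eq (@complexI R)). Qed.

Lemma md_gt0 z : (0 < md z) = (z != 0).
Proof. by rewrite lt0r md_eq0 md_ge0 andbT. Qed.

Lemma mdV z : md z^-1 = (md z)^-1.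
Proof. by apply: complexI; rewrite fmorphV /= -!mdE normfV. Qed.

Lemma mdX z n : md (z ^+ n) = md z ^+ n.
Proof. by elim: n => [|n IHn]; rewrite ?expr0 ?md1 // !exprS mdM IHn. Qed.

Lemma md_real (x : R) : md x%:C%C = `|x|.
Proof. by rewrite /md normc_def /= expr0n /= addr0 sqrtr_sqr. Qed.

Lemma mdi : md ('i%C : R[i]) = 1.
Proof. by rewrite /md normc_def /= expr0n /= add0r expr1n sqrtr1. Qed.

Lemma Re_le_md z : `|complex.Re z| <= md z.
Proof.
rewrite /md normc_def /= -sqrtr_sqr ler_wsqrtr // lerDl sqr_ge0 //.
Qed.

Lemma Im_le_md z : `|complex.Im z| <= md z.
Proof.
rewrite /md normc_def /= -sqrtr_sqr ler_wsqrtr // lerDr sqr_ge0 //.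
Qed.

Lemma md_le_ReIm z : md z <= `|complex.Re z| + `|complex.Im z|.
Proof.
rewrite {1}[z]complexE (le_trans (mdD _ _)) // mdM mdi mul1r !md_real //.
Qed.

Lemma sub_md_le z w : md z - md w <= md (z - w).
Proof. by rewrite lerBlDr -{1}(subrK w z) mdD. Qed.

End Modulus.

Section RealIntegral.
Variable R : realType.
Implicit Types (f g : R -> R) (a b c : R).
Local Notation mu := (@lebesgue_measure R).

Definition rcont f (t : R) := forall e, 0 < e -> exists2 d, 0 < d &
  forall s, `|s - t| < d -> `|f s - f t| < e.

Definition rseg a b f := forall t, a <= t <= b -> rcont f t.

Definition rint a b f : R := \int[mu]_(x in `[a, b]) f x.

Lemma rcont_continuous f t : rcont f t -> {for t, continuous f}.
Proof.
move=> h; apply/cvgrPdist_lt => /= e e0.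
have [d d0 hd] := h e e0.
apply/nbhs_ballP; exists d => //= s; rewrite /ball /= => hs.
by rewrite distrC hd // distrC.
Qed.

Lemma rseg_integrable a b f : rseg a b f -> mu.-integrable `[a, b] (EFin \o f).
Proof.
move=> h; apply: continuous_compact_integrable; first exact: segment_compact.
apply: continuous_in_subspaceT => t /[1!inE] /= ht; apply: rcont_continuous.
by apply: h; move: ht; rewrite in_itv.
Qed.

Lemma rint_eq a b f g : (forall t, a <= t <= b -> f t = g t) -> rint a b f = rint a b g.
Proof.
by move=> h; apply: eq_Rintegral => t /[1!inE] /=; rewrite in_itv /= => /h.
Qed.

Lemma rintD a b f g : rseg a b f -> rseg a b g ->
  rint a b (fun t => f t + g t) = rint a b f + rint a b g.
Proof. by move=> hf hg; rewrite /rint RintegralD //; exact: rseg_integrable. Qed.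

Lemma rintB a b f g : rseg a b f -> rseg a b g ->
  rint a b (fun t => f t - g t) = rint a b f - rint a b g.
Proof. by move=> hf hg; rewrite /rint RintegralB //; exact: rseg_integrable. Qed.

Lemma rintZ a b c f : rseg a b f -> rint a b (fun t => c * f t) = c * rint a b f.
Proof. by move=> hf; rewrite /rint RintegralZl //; exact: rseg_integrable. Qed.

Lemma rint_cst a b c : a <= b -> rint a b (fun=> c) = c * (b - a).
Proof.
move=> ab; rewrite /rint Rintegral_cst //= lebesgue_measure_itv /= lte_fin.
case: ltP => // ba; have -> : b = a by apply/eqP; rewrite eq_le ab ba.
by rewrite subrr.
Qed.

Lemma rint_le a b f g : rseg a b f -> rseg a b g ->
  (forall t, a <= t <= b -> f t <= g t) -> rint a b f <= rint a b g.
Proof.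
move=> hf hg h; apply: le_Rintegral => //; exact: rseg_integrable.
Qed.

Lemma rcont_cst c t : rcont (fun=> c) t.
Proof. by move=> e e0; exists 1 => // s _; rewrite subrr normr0. Qed.

Lemma rint_norm a b f M : a <= b -> rseg a b f ->
  (forall t, a <= t <= b -> `|f t| <= M) -> `|rint a b f| <= M * (b - a).
Proof.
move=> ab hf h; rewrite ler_norml -mulNr -!rint_cst //.
have hc c : rseg a b (fun=> c) by move=> t _; exact: rcont_cst.
have hb t : a <= t <= b -> - M <= f t <= M by move=> /h; rewrite ler_norml.
by apply/andP; split; apply: rint_le => // t /hb /andP[].
Qed.

Lemma rint_split a b c f : a <= b <= c -> rseg a c f ->
  rint a c f = rint a b f + rint b c f.
Proof.
move=> /andP[ab bc] hf; have hi := rseg_integrable hf.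
have := Rintegral_itvB (x := b) hi; rewrite !bnd_simp => /(_ ab bc).
rewrite Rintegral_itv_obnd_cbnd; last first.
  by apply: integrableS hi => //; apply: subset_itv; rewrite bnd_simp.
by rewrite /rint => <-; rewrite addrC subrK.
Qed.

End RealIntegral.

Section ComplexIntegral.
Variable R : realType.
Local Notation C := R[i].
Local Notation Re := (@complex.Re R).
Local Notation Im := (@complex.Im R).
Implicit Types (g : R -> C) (f : C -> C) (a b x y d t : R) (z w c : C).

Definition ccurve g t := forall e, 0 < e -> exists2 d, 0 < d &
  forall s, `|s - t| < d -> md (g s - g t) < e.

Definition cseg a b g := forall t, a <= t <= b -> ccurve g t.

Definition cint a b g : C :=
  Complex (rint a b (fun t => Re (g t))) (rint a b (fun t => Im (g t))).

Lemma ReD z w : Re (z + w) = Re z + Re w. Proof. by case: z; case: w. Qed.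
Lemma ImD z w : Im (z + w) = Im z + Im w. Proof. by case: z; case: w. Qed.
Lemma ReN z : Re (- z) = - Re z. Proof. by case: z. Qed.
Lemma ImN z : Im (- z) = - Im z. Proof. by case: z. Qed.
Lemma ReM z w : Re (z * w) = Re z * Re w - Im z * Im w.
Proof. by case: z; case: w. Qed.
Lemma ImM z w : Im (z * w) = Re z * Im w + Im z * Re w.
Proof. by case: z => p q; case: w. Qed.

Lemma complex_ext z w : Re z = Re w -> Im z = Im w -> z = w.
Proof. by case: z => ? ?; case: w => ? ? /= -> ->. Qed.

Lemma ccurve_Re g t : ccurve g t -> rcont (fun s => Re (g s)) t.
Proof.
move=> h e /h[d d0 hd]; exists d => // s /hd; apply: le_lt_trans.
by rewrite -ReN -ReD Re_le_md.
Qed.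

Lemma ccurve_Im g t : ccurve g t -> rcont (fun s => Im (g s)) t.
Proof.
move=> h e /h[d d0 hd]; exists d => // s /hd; apply: le_lt_trans.
by rewrite -ImN -ImD Im_le_md.
Qed.

Lemma cseg_Re a b g : cseg a b g -> rseg a b (fun s => Re (g s)).
Proof. by move=> h t /h /ccurve_Re. Qed.

Lemma cseg_Im a b g : cseg a b g -> rseg a b (fun s => Im (g s)).
Proof. by move=> h t /h /ccurve_Im. Qed.

Lemma ccurveD g g' t : ccurve g t -> ccurve g' t -> ccurve (fun s => g s + g' s) t.
Proof.
move=> h h' e e0; have [d d0 hd] := h _ (divr_gt0 e0 (ltr0Sn _ 1)).
have [d' d0' hd'] := h' _ (divr_gt0 e0 (ltr0Sn _ 1)).
exists (Num.min d d') => [|s]; first by rewrite lt_min d0.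
rewrite lt_min => /andP[/hd a1 /hd' a2]; rewrite opprD addrACA.
by rewrite (le_lt_trans (mdD _ _)) // [e]splitr ltrD.
Qed.

Lemma ccurveZ c g t : ccurve g t -> ccurve (fun s => c * g s) t.
Proof.
move=> h e e0; have c0 : 0 < md c + 1 by rewrite ltr_wpDl ?md_ge0.
have [d d0 hd] := h _ (divr_gt0 e0 c0); exists d => // s /hd.
rewrite ltr_pdivlMr // -mulrBr mdM; apply: le_lt_trans.
by rewrite mulrC ler_wpM2l ?md_ge0 // lerDl.
Qed.

Lemma ccurveB g g' t : ccurve g t -> ccurve g' t -> ccurve (fun s => g s - g' s) t.
Proof.
move=> h h'; have -> : (fun s => g s - g' s) = (fun s => g s + (-1) * g' s).
  by apply/funext => s; rewrite mulN1r.
by apply: ccurveD => //; exact: ccurveZ.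
Qed.

Lemma cint_eq a b g g' : (forall t, a <= t <= b -> g t = g' t) ->
  cint a b g = cint a b g'.
Proof. by move=> h; congr Complex; apply: rint_eq => t /h ->. Qed.

Lemma cintD a b g g' : cseg a b g -> cseg a b g' ->
  cint a b (fun t => g t + g' t) = cint a b g + cint a b g'.
Proof.
move=> h h'; apply: complex_ext => /=.
  rewrite -rintD; [|exact: cseg_Re|exact: cseg_Re].
  by apply: rint_eq => t _; rewrite ReD.
rewrite -rintD; [|exact: cseg_Im|exact: cseg_Im].
by apply: rint_eq => t _; rewrite ImD.
Qed.

Lemma rcontZ (c : R) (f : R -> R) t : rcont f t -> rcont (fun s => c * f s) t.
Proof.
move=> h e e0; have c0 : 0 < `|c| + 1 by rewrite ltr_wpDl.
have [d d0 hd] := h _ (divr_gt0 e0 c0); exists d => // s /hd.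
rewrite ltr_pdivlMr // -mulrBr normrM; apply: le_lt_trans.
by rewrite mulrC ler_wpM2l // lerDl.
Qed.

Lemma cintZ a b c g : cseg a b g ->
  cint a b (fun t => c * g t) = c * cint a b g.
Proof.
move=> h; have hR := cseg_Re h; have hI := cseg_Im h.
have hZ (f : R -> R) k : rseg a b f -> rseg a b (fun s => k * f s).
  by move=> hf t /hf; exact: rcontZ.
apply: complex_ext; rewrite /= ?ReM ?ImM /=.
  rewrite -!rintZ // -rintB; [|exact: hZ|exact: hZ].
  by apply: rint_eq => t _; rewrite ReM.
rewrite -!rintZ // -rintD; [|exact: hZ|exact: hZ].
by apply: rint_eq => t _; rewrite ImM.
Qed.

Lemma cintB a b g g' : cseg a b g -> cseg a b g' ->
  cint a b (fun t => g t - g' t) = cint a b g - cint a b g'.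
Proof.
move=> h h'; rewrite -[in RHS](mulN1r (cint _ _ g')) -cintZ //.
rewrite -cintD //; last by move=> t /h'; exact: ccurveZ.
by apply: cint_eq => t _; rewrite mulN1r.
Qed.

Lemma cint_cst a b c : a <= b -> cint a b (fun=> c) = c * ((b - a)%:C)%C.
Proof.
by move=> ab; apply: complex_ext; rewrite /= ?ReM ?ImM /= rint_cst //; ring.
Qed.

(** The factor 2 comes from estimating real and imaginary parts separately. Such constants never
    matter below, so the sharp inequality is not sought. *)
Lemma cint_norm a b g M : a <= b -> cseg a b g ->
  (forall t, a <= t <= b -> md (g t) <= M) -> md (cint a b g) <= 2 * M * (b - a).
Proof.
move=> ab h hM; rewrite (le_trans (md_le_ReIm _)) //=.
have -> : 2 * M * (b - a) = M * (b - a) + M * (b - a) by ring.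
apply: lerD; apply: rint_norm => //.
- exact: cseg_Re.
- by move=> t /hM; apply: le_trans; exact: Re_le_md.
- exact: cseg_Im.
- by move=> t /hM; apply: le_trans; exact: Im_le_md.
Qed.

Lemma cint_split a b d g : a <= b <= d -> cseg a d g ->
  cint a d g = cint a b g + cint b d g.
Proof.
by move=> abd h; apply: complex_ext; rewrite /= (rint_split abd) //;
  [exact: cseg_Re|exact: cseg_Im].
Qed.

(* Epsilon-delta forms, since R[i] carries no topology. *)
Definition ccont f z := forall e, 0 < e -> exists2 d, 0 < d &
  forall w, md (w - z) < d -> md (f w - f z) < e.

Definition cdiff f z c := forall e, 0 < e -> exists2 d, 0 < d &
  forall w, md (w - z) < d -> md (f w - f z - c * (w - z)) <= e * md (w - z).

Lemma cdiff_cont f z c : cdiff f z c -> ccont f z.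
Proof.
move=> h e e0; have [d d0 hd] := h _ (ltr01 : 0 < 1).
have c0 : 0 < md c + 1 by rewrite ltr_wpDl ?md_ge0.
exists (Num.min d (e / (md c + 1))) => [|w]; first by rewrite lt_min d0 divr_gt0.
rewrite lt_min ltr_pdivlMr // => /andP[/hd hw]; apply: le_lt_trans.
rewrite -(subrK (c * (w - z)) (f w - f z)) (le_trans (mdD _ _)) // mdM.
by move: hw; lra.
Qed.

Definition pt x y : C := Complex x y.

Lemma ccurve_h f x y : ccont f (pt x y) -> ccurve (fun t => f (pt t y)) x.
Proof.
move=> h e /h[d d0 hd]; exists d => // s hs; apply: hd; apply: le_lt_trans hs.
by rewrite (le_trans (md_le_ReIm _)) //= subrr normr0 addr0.
Qed.

Lemma ccurve_v f x y : ccont f (pt x y) -> ccurve (fun t => f (pt x t)) y.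
Proof.
move=> h e /h[d d0 hd]; exists d => // s hs; apply: hd; apply: le_lt_trans hs.
by rewrite (le_trans (md_le_ReIm _)) //= subrr normr0 add0r.
Qed.

(* Counterclockwise along the boundary of [x, x + d] x [y, y + d], opposite sides
   being paired so that constants and linear terms visibly cancel. *)
Definition contour f x y d : C :=
  cint x (x + d) (fun t => f (pt t y) - f (pt t (y + d))) +
  'i%C * cint y (y + d) (fun t => f (pt (x + d) t) - f (pt x t)).

Definition insq x y d z := x <= Re z <= x + d /\ y <= Im z <= y + d.

Definition bdsq x y d z := insq x y d z /\
  [\/ Re z = x, Re z = x + d, Im z = y | Im z = y + d].

Definition bdcont f x y d := forall z, bdsq x y d z -> ccont f z.

Section Contour.
Variables (x y d : R) (d0 : 0 <= d).

Lemma bdsq_b t : x <= t <= x + d -> bdsq x y d (pt t y).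
Proof. by move=> h; split; [split=> //=; rewrite lexx lerDl|constructor 3]. Qed.
Lemma bdsq_t t : x <= t <= x + d -> bdsq x y d (pt t (y + d)).
Proof. by move=> h; split; [split=> //=; rewrite lexx lerDl d0|constructor 4]. Qed.
Lemma bdsq_l t : y <= t <= y + d -> bdsq x y d (pt x t).
Proof. by move=> h; split; [split=> //=; rewrite lexx lerDl|constructor 1]. Qed.
Lemma bdsq_r t : y <= t <= y + d -> bdsq x y d (pt (x + d) t).
Proof. by move=> h; split; [split=> //=; rewrite lexx lerDl d0|constructor 2]. Qed.

Lemma cseg_b f : bdcont f x y d -> cseg x (x + d) (fun t => f (pt t y)).
Proof. by move=> h t /bdsq_b /h /ccurve_h. Qed.
Lemma cseg_t f : bdcont f x y d -> cseg x (x + d) (fun t => f (pt t (y + d))).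
Proof. by move=> h t /bdsq_t /h /ccurve_h. Qed.
Lemma cseg_l f : bdcont f x y d -> cseg y (y + d) (fun t => f (pt x t)).
Proof. by move=> h t /bdsq_l /h /ccurve_v. Qed.
Lemma cseg_r f : bdcont f x y d -> cseg y (y + d) (fun t => f (pt (x + d) t)).
Proof. by move=> h t /bdsq_r /h /ccurve_v. Qed.

Lemma cseg_bt f : bdcont f x y d ->
  cseg x (x + d) (fun t => f (pt t y) - f (pt t (y + d))).
Proof. by move=> h t ht; apply: ccurveB; [exact: cseg_b ht|exact: cseg_t ht]. Qed.

Lemma cseg_rl f : bdcont f x y d ->
  cseg y (y + d) (fun t => f (pt (x + d) t) - f (pt x t)).
Proof. by move=> h t ht; apply: ccurveB; [exact: cseg_r ht|exact: cseg_l ht]. Qed.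

Lemma contourE f : bdcont f x y d ->
  contour f x y d =
  cint x (x + d) (fun t => f (pt t y)) - cint x (x + d) (fun t => f (pt t (y + d)))
  + 'i%C * (cint y (y + d) (fun t => f (pt (x + d) t))
            - cint y (y + d) (fun t => f (pt x t))).
Proof.
move=> h; rewrite /contour !cintB //; first exact: cseg_r.
- exact: cseg_l.
- exact: cseg_b.
- exact: cseg_t.
Qed.

Lemma contour_eq f (g : C -> C) : (forall z, bdsq x y d z -> f z = g z) ->
  contour f x y d = contour g x y d.
Proof.
move=> h; rewrite /contour; congr (_ + _ * _); apply: cint_eq => t ht.
  by rewrite !h //; [exact: bdsq_t|exact: bdsq_b].
by rewrite !h //; [exact: bdsq_l|exact: bdsq_r].
Qed.

Lemma contour_norm f M : bdcont f x y d ->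
  (forall z, bdsq x y d z -> md (f z) <= M) -> md (contour f x y d) <= 8 * M * d.
Proof.
move=> h hM.
have le2 z w : md z <= M -> md w <= M -> md (z - w) <= 2 * M.
  by move=> hz hw; rewrite (le_trans (mdB _ _)) // mulr2n mulrDl mul1r lerD.
have hx : x <= x + d by rewrite lerDl.
have hy : y <= y + d by rewrite lerDl.
have -> : 8 * M * d = 2 * (2 * M) * (x + d - x) + 2 * (2 * M) * (y + d - y) by ring.
rewrite /contour (le_trans (mdD _ _)) // mdM mdi mul1r; apply: lerD; apply: cint_norm => //.
- exact: cseg_bt.
- by move=> t ht; apply: le2; apply: hM; [exact: bdsq_b|exact: bdsq_t].
- exact: cseg_rl.
- by move=> t ht; apply: le2; apply: hM; [exact: bdsq_r|exact: bdsq_l].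
Qed.

Lemma contourD f (g : C -> C) : bdcont f x y d -> bdcont g x y d ->
  contour (fun z => f z + g z) x y d = contour f x y d + contour g x y d.
Proof.
move=> hf hg; rewrite /contour.
under cint_eq do rewrite opprD addrACA.
under [cint y _ _]cint_eq do rewrite opprD addrACA.
have [h1 h2 h3 h4] := And4 (cseg_bt hf) (cseg_bt hg) (cseg_rl hf) (cseg_rl hg).
by rewrite (cintD h1 h2) (cintD h3 h4); ring.
Qed.

Lemma contourZ c f : bdcont f x y d ->
  contour (fun z => c * f z) x y d = c * contour f x y d.
Proof.
move=> hf; rewrite /contour.
under cint_eq do rewrite -mulrBr.
under [cint y _ _]cint_eq do rewrite -mulrBr.
by rewrite (cintZ c (cseg_bt hf)) (cintZ c (cseg_rl hf)); ring.
Qed.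

(** After pairing opposite sides the integrands are the constants -i c d and c d, and the second
    integral is multiplied by i. *)
Lemma contour_affine p c : contour (fun z => p + c * z) x y d = 0.
Proof.
rewrite /contour (@cint_eq _ _ _ (fun=> c * pt 0 (- d))); last first.
  by move=> t _; apply: complex_ext; case: p => p1 p2; case: c => c1 c2 /=; ring.
rewrite [cint y _ _](@cint_eq _ _ _ (fun=> c * pt d 0)); last first.
  by move=> t _; apply: complex_ext; case: p => p1 p2; case: c => c1 c2 /=; ring.
rewrite !cint_cst ?lerDl //.
by apply: complex_ext; case: c => c1 c2 /=; ring.
Qed.

End Contour.

(** Every inner edge is traversed once in each direction. Continuity on the whole closed square is
    used to split the integrals at the midpoints. *)
Lemma contour_quarters f x y d : 0 <= d ->
  (forall z, insq x y (d + d) z -> ccont f z) ->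
  contour f x y (d + d) = contour f x y d + contour f (x + d) y d
    + contour f x (y + d) d + contour f (x + d) (y + d) d.
Proof.
move=> d0 hf.
have cut s g : cseg s (s + (d + d)) g ->
    cint s (s + (d + d)) g = cint s (s + d) g + cint (s + d) (s + d + d) g.
  by move=> h; rewrite -[s + d + d]addrA; apply: cint_split => //; lra.
have hh t : y <= t <= y + (d + d) -> cseg x (x + (d + d)) (fun s => f (pt s t)).
  by move=> ht s0 hs; apply: ccurve_h; apply: hf; split.
have hv t : x <= t <= x + (d + d) -> cseg y (y + (d + d)) (fun s => f (pt t s)).
  by move=> ht s0 hs; apply: ccurve_v; apply: hf; split.
have sub x' y' : (x' = x \/ x' = x + d) -> (y' = y \/ y' = y + d) ->
    bdcont f x' y' d.
  move=> hx hy z [[]]; move: hx hy => [] -> [] -> /andP[u1 u2] /andP[v1 v2] _;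
    by apply: hf; split; lra.
have bx : x <= x <= x + (d + d) by lra.
have bx2 : x <= x + (d + d) <= x + (d + d) by lra.
have by0 : y <= y <= y + (d + d) by lra.
have by2 : y <= y + (d + d) <= y + (d + d) by lra.
have hb : bdcont f x y (d + d) by move=> z [hz _]; apply: hf.
have l (p : R) : p = p \/ p = p + d by left.
have r (p : R) : p + d = p \/ p + d = p + d by right.
rewrite (contourE (addr_ge0 d0 d0) hb) (contourE d0 (sub _ _ (l _) (l _))).
rewrite (contourE d0 (sub _ _ (r _) (l _))) (contourE d0 (sub _ _ (l _) (r _))).
rewrite (contourE d0 (sub _ _ (r _) (r _))).
rewrite (cut _ _ (hh _ by0)) (cut _ _ (hh _ by2)) (cut _ _ (hv _ bx)) (cut _ _ (hv _ bx2)).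
rewrite -!addrA; ring.
Qed.

End ComplexIntegral.

(** * Cauchy theory on squares *)

Section Bisection.
Variable R : realType.
Implicit Types (x y d e : R).

Lemma nested_intervals (u l : nat -> R) :
  (forall n, 0 <= l n) -> (forall n, u n <= u n.+1) ->
  (forall n, u n.+1 + l n.+1 <= u n + l n) ->
  exists X, forall n, u n <= X <= u n + l n.
Proof.
move=> l0 hu hv.
have mu n k : u n <= u (k + n)%N.
  by elim: k => [|k IH]; rewrite ?add0n // addSn (le_trans IH).
have mv n k : u (k + n)%N + l (k + n)%N <= u n + l n.
  by elim: k => [|k IH]; rewrite ?add0n // addSn (le_trans (hv _)).
have ub m n : u m <= u n + l n.
  by rewrite (le_trans (mu m n)) // (le_trans _ (mv n m)) // addnC lerDl.
have hub n : ubound (range u) (u n + l n) by move=> _ [m _ <-].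
exists (sup (range u)) => n; apply/andP; split.
  by apply: ub_le_sup; [exists (u 0%N + l 0%N)|exists n].
by apply: ge_sup => //; exists (u 0%N), 0%N.
Qed.

Lemma halving_lt d e : 0 < e -> exists n, d / 2 ^+ n < e.
Proof.
move=> e0; have [d0|d0] := leP d 0.
  by exists 0%N; rewrite expr0 divr1 (le_lt_trans d0).
have := archi_boundP (ltW (divr_gt0 d0 e0)); set n := Num.bound _ => hn.
exists n; rewrite ltr_pdivrMr ?exprn_gt0 // mulrC -ltr_pdivrMr //.
by rewrite (lt_trans hn) // -natrX ltr_nat ltn_expl.
Qed.

(** Iterating the choice of a subsquare gives nested squares of sides d / 2^n; their projections to
    the axes are nested intervals, which supply X and Y. *)
Lemma bisection (P : R -> R -> R -> Prop) x y d : 0 < d -> P x y d ->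
  (forall x y d, 0 < d -> P x y (d + d) ->
    exists x' y', [/\ P x' y' d, x <= x' <= x + d & y <= y' <= y + d]) ->
  exists X Y, [/\ x <= X <= x + d, y <= Y <= y + d &
    forall e, 0 < e -> exists x' y' d', [/\ 0 < d' < e, P x' y' d',
      x' <= X <= x' + d' & y' <= Y <= y' + d']].
Proof.
move=> d0 hP hstep.
have /choice[F hF] (s : R * R * R) : exists q : R * R,
    0 < s.2 -> P s.1.1 s.1.2 s.2 ->
    [/\ P q.1 q.2 (s.2 / 2), s.1.1 <= q.1 <= s.1.1 + s.2 / 2
      & s.1.2 <= q.2 <= s.1.2 + s.2 / 2].
  have [[s0 hs]|h] := pselect (0 < s.2 /\ P s.1.1 s.1.2 s.2); last first.
    (* A dummy corner for squares where [P] fails; the iteration starting at a square with [P] never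
       meets it. *)
    by exists (0, 0) => ? ?; case: h.
  have [|x' [y' h']] := hstep s.1.1 s.1.2 (s.2 / 2) (divr_gt0 s0 (ltr0Sn _ 1)).
    by rewrite -splitr.
  by exists (x', y').
pose S n := iter n (fun s => (F s, s.2 / 2)) (x, y, d).
have inv n : 0 < (S n).2 /\ P (S n).1.1 (S n).1.2 (S n).2.
  elim: n => [//|n [s0 hs]]; rewrite /S iterS -/(S n) /=; split.
    exact: divr_gt0.
  by case: (hF _ s0 hs).
have rec n : [/\ (S n).1.1 <= (S n.+1).1.1 <= (S n).1.1 + (S n).2 / 2,
    (S n).1.2 <= (S n.+1).1.2 <= (S n).1.2 + (S n).2 / 2
    & (S n.+1).2 = (S n).2 / 2].
  by have [s0 hs] := inv n; case: (hF _ s0 hs).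
have hS n : (S n).2 = d / 2 ^+ n.
  elim: n => [|n IH]; first by rewrite expr0 divr1.
  by have [_ _ ->] := rec n; rewrite IH exprS invfM mulrA mulrAC.
have s0 n : 0 <= (S n).2 by apply: ltW; case: (inv n).
have [X hX] : exists X, forall n, (S n).1.1 <= X <= (S n).1.1 + (S n).2.
  by apply: nested_intervals => // n; have [h1 h2 h3] := rec n; lra.
have [Y hY] : exists Y, forall n, (S n).1.2 <= Y <= (S n).1.2 + (S n).2.
  by apply: nested_intervals => // n; have [h1 h2 h3] := rec n; lra.
exists X, Y; split; [exact: (hX 0%N)|exact: (hY 0%N)|move=> e e0].
have [n hn] := halving_lt d e0.
exists (S n).1.1, (S n).1.2, (S n).2; have [h1 h2] := inv n; split => //.
by rewrite h1 hS.
Qed.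

End Bisection.

(** * Continuity, difference quotients and Goursat's lemma *)

Section Goursat.
Variable R : realType.
Local Notation C := R[i].
Local Notation Re := (@complex.Re R).
Local Notation Im := (@complex.Im R).
Implicit Types (f g : C -> C) (a b x y d t : R) (z w c : C).

Lemma ccont_near f g z d : 0 < d -> (forall w, md (w - z) < d -> f w = g w) ->
  ccont f z -> ccont g z.
Proof.
move=> d0 h hf e e0; have [d' d0' hd] := hf e e0.
exists (Num.min d d') => [|w]; first by rewrite lt_min d0.
rewrite lt_min => /andP[h1 h2]; rewrite -!h ?hd // subrr md0 //.
Qed.

Lemma cdiff_near f g z c d : 0 < d -> (forall w, md (w - z) < d -> f w = g w) ->
  cdiff f z c -> cdiff g z c.
Proof.
move=> d0 h hf e e0; have [d' d0' hd] := hf e e0.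
exists (Num.min d d') => [|w]; first by rewrite lt_min d0.
rewrite lt_min => /andP[h1 h2]; rewrite -!h ?hd // subrr md0 //.
Qed.

Lemma ccont_cst c z : ccont (fun=> c) z.
Proof. by move=> e e0; exists 1 => // w _; rewrite subrr md0. Qed.

Lemma ccont_id z : ccont id z.
Proof. by move=> e e0; exists e. Qed.

Lemma ccontD f g z : ccont f z -> ccont g z -> ccont (fun w => f w + g w) z.
Proof.
move=> h h' e e0; have [d d0 hd] := h _ (divr_gt0 e0 (ltr0Sn _ 1)).
have [d' d0' hd'] := h' _ (divr_gt0 e0 (ltr0Sn _ 1)).
exists (Num.min d d') => [|s]; first by rewrite lt_min d0.
rewrite lt_min => /andP[/hd a1 /hd' a2]; rewrite opprD addrACA.
by rewrite (le_lt_trans (mdD _ _)) // [e]splitr ltrD.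
Qed.

Lemma ccontM f g z : ccont f z -> ccont g z -> ccont (fun w => f w * g w) z.
Proof.
move=> h h' e e0.
(* [k <= 1] absorbs the product of the two increments, so the total error is at most k (F + G + 1),
   which is less than e. *)
set F := md (f z); set G := md (g z).
have F0 : 0 <= F by exact: md_ge0.
have G0 : 0 <= G by exact: md_ge0.
pose k := e / (F + G + 1 + e).
have q0 : 0 < F + G + 1 + e by lra.
have k0 : 0 < k by exact: divr_gt0.
have k1 : k <= 1 by rewrite ler_pdivrMr //; lra.
have ke : k * (F + G + 1 + e) = e by rewrite divfK // gt_eqF.
have [d d0 hd] := h _ k0; have [d' d0' hd'] := h' _ k0.
exists (Num.min d d') => [|s]; first by rewrite lt_min d0.
rewrite lt_min => /andP[/hd a1 /hd' a2].
have -> : f s * g s - f z * g z =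
  (f s - f z) * (g s - g z) + f z * (g s - g z) + (f s - f z) * g z by ring.
rewrite (le_lt_trans (mdD _ _)) // (le_lt_trans (lerD (mdD _ _) (lexx _))) //.
rewrite !mdM -/F -/G; set p := md _ in a1 *; set q := md _ in a2 *.
have p0 : 0 <= p by exact: md_ge0.
have q0' : 0 <= q by exact: md_ge0.
have t1 : p * q <= k * 1 by apply: ler_pM => //; lra.
have t2 : F * q <= F * k by apply: ler_wpM2l => //; lra.
have t3 : p * G <= k * G by apply: ler_wpM2r => //; lra.
have t4 : 0 < k * e by exact: mulr_gt0.
by rewrite -ke !mulrDr; lra.
Qed.

Lemma ccontV f z : f z != 0 -> ccont f z -> ccont (fun w => (f w)^-1) z.
Proof.
move=> fz0 h e e0; have F0 : 0 < md (f z) by rewrite md_gt0.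
set F := md (f z) in F0.
have k0 : 0 < Num.min (F / 2) (e * F ^+ 2 / 2).
  by rewrite lt_min !divr_gt0 // mulr_gt0 // exprn_gt0.
have [d d0 hd] := h _ k0; exists d => // w /hd; rewrite lt_min => /andP[h1 h2].
have hw : F / 2 < md (f w).
  have := sub_md_le (f z) (f w); rewrite md_distC -/F; lra.
have w0 : 0 < md (f w) by apply: lt_trans hw; exact: divr_gt0.
have fw0 : f w != 0 by rewrite -md_gt0.
have -> : (f w)^-1 - (f z)^-1 = (f z - f w) * ((f w)^-1 * (f z)^-1).
  by field; rewrite fw0 fz0.
rewrite !mdM !mdV -/F md_distC -invfM ltr_pdivrMr ?mulr_gt0 //.
apply: (lt_trans h2).
have -> : e * F ^+ 2 / 2 = e * (F / 2 * F) by ring.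
by rewrite ltr_pM2l // ltr_pM2r.
Qed.

Lemma ccont_div f c z : ccont f z -> z != c -> ccont (fun w => f w * (w - c)^-1) z.
Proof.
move=> hf zc; apply: ccontM => //; apply: ccontV; first by rewrite subr_eq0.
by apply: ccontD; [exact: ccont_id|exact: ccont_cst].
Qed.

(** The derivative g' of the quotient g is read off from g (w - a) = f - k: differentiating gives g'
    (z - a) + g = c. *)
Lemma cdiff_div f (k a : C) z c : cdiff f z c -> z != a ->
  cdiff (fun w => (f w - k) / (w - a)) z ((c - (f z - k) / (z - a)) / (z - a)).
Proof.
move=> hf za e e0; set g := (f z - k) / (z - a); set c' := (c - g) / (z - a).
have za0 : z - a != 0 by rewrite subr_eq0.
have A0 : 0 < md (z - a) by rewrite md_gt0.
set A := md (z - a) in A0.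
have eA : 0 < e * A / 4 by rewrite divr_gt0 // mulr_gt0.
have [d d0 hd] := hf _ eA.
have c0 : 0 < md c' + 1 by rewrite ltr_wpDl ?md_ge0.
exists (Num.min d (Num.min (A / 2) ((e * A / 4) / (md c' + 1)))) => [|w].
  by rewrite !lt_min d0 (divr_gt0 eA c0) divr_gt0.
rewrite !lt_min => /and3P[/hd h1 h2]; rewrite ltr_pdivlMr // => h3.
set m := md (w - z) in h1 h2 h3 *.
have m0 : 0 <= m by exact: md_ge0.
have hw : A / 2 < md (w - a).
  have := sub_md_le (z - a) (w - a).
  have -> : z - a - (w - a) = z - w by ring.
  by rewrite (md_distC z w) -/m -/A; lra.
have wa0 : w - a != 0 by rewrite -md_gt0; lra.
have -> : (f w - k) / (w - a) - g - c' * (w - z) =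
   ((f w - f z - c * (w - z)) - c' * (w - z) ^+ 2) / (w - a).
  by rewrite /c' /g; field; rewrite ?za0 ?wa0.
rewrite mdM mdV ler_pdivrMr; last lra.
rewrite (le_trans (mdB _ _)) // mdM mdX -/m.
have t1 : e * m * (A / 2) <= e * m * md (w - a).
  by apply: ler_wpM2l; [rewrite mulr_ge0 // ltW|exact: ltW].
have t2 : m * (m * (md c' + 1)) <= m * (e * A / 4) by apply: ler_wpM2l => //; exact: ltW.
have t3 : 0 <= m * m by exact: mulr_ge0.
rewrite expr2; lra.
Qed.

(* An increasing function whose increments over intervals around s are at least
   the square root of their length. *)
Definition spike s t : R := Num.sqrt (t - s) - Num.sqrt (s - t).

Lemma spike_le s a b : a <= b -> spike s a <= spike s b.
Proof. by move=> ab; apply: lerB; apply: ler_wsqrtr; lra. Qed.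

Lemma sqrt_le_spike s a b : a <= s <= b -> Num.sqrt (b - a) <= spike s b - spike s a.
Proof.
move=> /andP[h1 h2]; rewrite /spike (ler0_sqrtr (a := s - b)); last lra.
rewrite (ler0_sqrtr (a := a - s)); last lra.
set p := Num.sqrt (b - s); set q := Num.sqrt (s - a).
have p0 : 0 <= p by exact: sqrtr_ge0.
have q0 : 0 <= q by exact: sqrtr_ge0.
have -> : p - 0 - (0 - q) = `|p + q| by rewrite ger0_norm ?addr_ge0 //; ring.
rewrite -sqrtr_sqr ler_wsqrtr // sqrrD !sqr_sqrtr; last 2 first.
- lra.
- lra.
have : 0 <= p * q *+ 2 by rewrite mulrn_wge0 // mulr_ge0.
lra.
Qed.

End Goursat.

Section Goursat.
Variable R : realType.
Local Notation C := R[i].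
Local Notation Re := (@complex.Re R).
Local Notation Im := (@complex.Im R).
Implicit Types (f g : C -> C) (a b x y d t : R) (z w c : C).

(** Two exceptional points are allowed because the quotient used in [cauchy_formula] is only known
    to be continuous at the singularity 0 and at the point a. A nonzero integral would dominate a
    fixed multiple of the additive [mu] on arbitrarily small squares around one point, which
    contradicts the local estimate there. *)
Lemma goursat f s1 s2 x y d : 0 < d ->
  (forall z, insq x y d z -> ccont f z) ->
  (forall z, insq x y d z -> z != s1 -> z != s2 -> exists c, cdiff f z c) ->
  contour f x y d = 0.
Proof.
have sum4 (m m1 m2 m3 m4 t2 t3 q q1 q2 q3 q4 : R) :
    q < m -> m <= t3 + m4 -> t3 <= t2 + m3 -> t2 <= m1 + m2 -> m1 <= q1 ->
    m2 <= q2 -> m3 <= q3 -> m4 <= q4 -> q = q1 + q2 + q3 + q4 -> False by lra.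
move=> d0 hcont hdiff; apply/eqP; rewrite -md_eq0; apply/negP => /negP h0.
have {}h0 : 0 < md (contour f x y d) by rewrite lt0r h0 md_ge0.
(* An additive set function dominating area everywhere and side length at s1, s2:
   this compensates for f being merely continuous there. *)
pose H1 t := t + spike (Re s1) t + spike (Re s2) t.
pose H2 t := t + spike (Im s1) t + spike (Im s2) t.
pose mu x y d := (H1 (x + d) - H1 x) * (H2 (y + d) - H2 y).
have H1d u e : 0 <= e -> e <= H1 (u + e) - H1 u.
  move=> e0; have ue : u <= u + e by lra.
  by have := spike_le (Re s1) ue; have := spike_le (Re s2) ue; rewrite /H1; lra.
have H2d u e : 0 <= e -> e <= H2 (u + e) - H2 u.
  move=> e0; have ue : u <= u + e by lra.
  by have := spike_le (Im s1) ue; have := spike_le (Im s2) ue; rewrite /H2; lra.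
have mu_ge u v e : 0 <= e -> e * e <= mu u v e.
  by move=> e0; apply: ler_pM => //; [exact: H1d|exact: H2d].
have mu_spike u v e s : 0 <= e -> s = s1 \/ s = s2 -> insq u v e s -> e <= mu u v e.
  move=> e0 hs [hu hv].
  rewrite -[X in X <= _](sqr_sqrtr e0) expr2.
  have eE p : e = p + e - p by ring.
  have ue : u <= u + e by lra.
  have ve : v <= v + e by lra.
  have g1 := spike_le (Re s1) ue; have g2 := spike_le (Re s2) ue.
  have g3 := spike_le (Im s1) ve; have g4 := spike_le (Im s2) ve.
  have k1 := sqrt_le_spike hu; have k2 := sqrt_le_spike hv.
  rewrite -eE in k1; rewrite -eE in k2.
  apply: ler_pM; rewrite ?sqrtr_ge0 //.
    by rewrite /H1; case: hs => hs; rewrite hs in k1; lra.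
  by rewrite /H2; case: hs => hs; rewrite hs in k2; lra.
have mu0 : 0 < mu x y d by apply: lt_le_trans (mu_ge _ _ _ (ltW d0)); exact: mulr_gt0.
(* On the initial square [eps * mu] is half the modulus of the integral, so [P] holds there with
   strict inequality. *)
pose eps := md (contour f x y d) / (2 * mu x y d).
have eps0 : 0 < eps by rewrite divr_gt0 // mulr_gt0.
pose P x' y' d' := [/\ x <= x' /\ x' + d' <= x + d, y <= y' /\ y' + d' <= y + d
   & eps * mu x' y' d' < md (contour f x' y' d')].
have P0 : P x y d.
  split=> //; have -> : eps * mu x y d = md (contour f x y d) / 2.
    by rewrite /eps; field; rewrite gt_eqF.
  lra.
have [|X [Y [hX hY hlim]]] := bisection d0 P0.
  (* If no quarter satisfied [P], the triangle inequality and the additivity of [mu] would refute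
     [P] for the whole square. *)
  move=> u v e e0 [hu hv hP]; apply: contrapT => hn.
  have hf : forall z, insq u v (e + e) z -> ccont f z.
    by move=> z [/andP[? ?] /andP[? ?]]; apply: hcont; split; lra.
  have no u' v' : u <= u' <= u + e -> v <= v' <= v + e ->
      md (contour f u' v' e) <= eps * mu u' v' e.
    move=> hu' hv'; rewrite leNgt; apply/negP => hlt; apply: hn.
    by exists u', v'; split => //; split => //; lra.
  have b1 : u <= u <= u + e by lra.
  have b2 : u <= u + e <= u + e by lra.
  have b3 : v <= v <= v + e by lra.
  have b4 : v <= v + e <= v + e by lra.
  have n1 := no _ _ b1 b3; have n2 := no _ _ b2 b3.
  have n3 := no _ _ b1 b4; have n4 := no _ _ b2 b4.
  have : eps * mu u v (e + e) = eps * mu u v e + eps * mu (u + e) v e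
      + eps * mu u (v + e) e + eps * mu (u + e) (v + e) e.
    by rewrite /mu !addrA; ring.
  move: hP; rewrite (contour_quarters (ltW e0) hf).
  have t1 := mdD (contour f u v e + contour f (u + e) v e + contour f u (v + e) e)
    (contour f (u + e) (v + e) e).
  have t2 := mdD (contour f u v e + contour f (u + e) v e) (contour f u (v + e) e).
  have t3 := mdD (contour f u v e) (contour f (u + e) v e).
  by move=> h1 h2; exact: (sum4 _ _ _ _ _ _ _ _ _ _ _ _ h1 t1 t2 t3 n1 n2 n3 n4 h2).
pose Z := pt X Y.
have hZ : insq x y d Z by [].
(* The contour integral of the affine part vanishes, so only the error counts. *)
have key p c k e B : 0 < k -> 0 < e ->
    (forall w, md (w - Z) < k -> md (f w - (p + c * w)) <= e * B (md (w - Z))) ->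
    (forall m m', 0 <= m -> m <= m' -> B m <= B m') ->
    exists u v e', [/\ 0 < e' , insq u v e' Z, P u v e'
      & md (contour f u v e') <= 8 * (e * B (2 * e')) * e'].
  move=> k0 e0 hw hB.
  have [u [v [e' [/andP[e0' ek] hP hu hv]]]] := hlim (k / 2) (divr_gt0 k0 (ltr0Sn _ 1)).
  exists u, v, e'; split => //.
  have hin w : bdsq u v e' w -> insq x y d w.
    by case: hP => ? ? _ [[/andP[? ?] /andP[? ?]] _]; split; lra.
  have hcf : bdcont f u v e' by move=> w /hin /hcont.
  have haff : bdcont (fun w => p + c * w) u v e'.
    move=> w _; apply: ccontD; first exact: ccont_cst.
    by apply: ccontM; [exact: ccont_cst|exact: ccont_id].
  have hg : bdcont (fun w => f w - (p + c * w)) u v e'.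
    move=> w hw'; apply: ccontD; first exact: hcf.
    apply: (@ccont_near _ (fun w => (-1) * (p + c * w)) _ _ 1) => //.
      by move=> *; rewrite mulN1r.
    by apply: ccontM; [exact: ccont_cst|exact: haff].
  have -> : contour f u v e' = contour (fun w => (f w - (p + c * w)) + (p + c * w)) u v e'.
    by apply: contour_eq => [|w _]; [exact: ltW|rewrite subrK].
  rewrite contourD ?contour_affine ?addr0 //; try exact: ltW.
  apply: contour_norm => //; first exact: ltW.
  move=> w [[hw1 hw2] _].
  have hm : md (w - Z) <= 2 * e'.
    rewrite (le_trans (md_le_ReIm _)) // ReD ReN ImD ImN /=.
    have : `|Re w - X| <= e' by rewrite ler_norml; lra.
    have : `|Im w - Y| <= e' by rewrite ler_norml; lra.
    lra.
  have hlt : md (w - Z) < k by lra.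
  apply: (le_trans (hw w hlt)).
  by rewrite ler_wpM2l ?hB ?md_ge0 // ltW.
(* At an exceptional point continuity gives [key] with B = 1 and the bound 8 (eps / 16) e = (eps /
   2) e. Elsewhere differentiability gives B = id and the bound 8 (eps / 32) (2 e) e = (eps / 2)
   e^2. Both are less than [eps * mu]. *)
have [hs|hs] := pselect (Z = s1 \/ Z = s2).
  have e0 : 0 < eps / 16 by exact: divr_gt0.
  have [k k0 hk] := hcont Z hZ _ e0.
  have [||u [v [e [e0' hin [_ _ hP] hc]]]] := key (f Z) 0 k (eps / 16) (fun=> 1) k0 e0.
  - by move=> w /hk /ltW; rewrite mul0r addr0 mulr1.
  - by [].
  have := mu_spike u v e Z (ltW e0') hs hin; rewrite -(ler_pM2l eps0) => hm.
  have : 0 < eps * e by exact: mulr_gt0.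
  by lra.
have [c hc] := hdiff Z hZ (introN eqP (fun h => hs (or_introl h)))
  (introN eqP (fun h => hs (or_intror h))).
have e0 : 0 < eps / 32 by exact: divr_gt0.
have [k k0 hk] := hc _ e0.
have [||u [v [e [e0' hin [_ _ hP] hcc]]]] :=
  key (f Z - c * Z) c k (eps / 32) id k0 e0.
- move=> w /hk; congr (md _ <= _); ring.
- by [].
have := mu_ge u v e (ltW e0'); rewrite -(ler_pM2l eps0) => hm.
have : 0 < eps * (e * e) by do 2 apply: mulr_gt0 => //.
by lra.
Qed.

End Goursat.

(** * Cauchy's formula and removable singularities *)

Section Cauchy.
Variable R : realType.
Local Notation C := R[i].
Local Notation Re := (@complex.Re R).
Local Notation Im := (@complex.Im R).
Implicit Types (f g : C -> C) (x y d t : R) (a z w c : C).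

Lemma ReV z : Re z^-1 = Re z / (Re z ^+ 2 + Im z ^+ 2).
Proof. by case: z. Qed.

Lemma ImV z : Im z^-1 = - (Im z / (Re z ^+ 2 + Im z ^+ 2)).
Proof. by case: z. Qed.

Section Square.
Variables (r : R) (r0 : 0 < r).
Local Notation csq f := (contour f (- r) (- r) (r + r)).
Local Notation bd := (bdsq (- r) (- r) (r + r)).
Local Notation bc f := (bdcont f (- r) (- r) (r + r)).

Lemma rr_ge0 : 0 <= r + r. Proof. by rewrite addr_ge0 // ltW. Qed.

Lemma bd_ge z : bd z -> r <= md z.
Proof.
have hr := Re_le_md z; have hi := Im_le_md z.
move: hr hi; rewrite !ler_norml => /andP[h1 h2] /andP[h3 h4].
by move=> [_ [] h]; lra.
Qed.

Lemma bd_sub_ge a z : md a <= r / 2 -> bd z -> r / 2 <= md (z - a).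
Proof. by move=> ha /bd_ge hz; have := sub_md_le z a; lra. Qed.

Lemma bd_neq a z : md a <= r / 2 -> bd z -> z != a.
Proof.
move=> ha hz; rewrite -subr_eq0 -md_gt0; apply: lt_le_trans (bd_sub_ge ha hz).
exact: divr_gt0.
Qed.

Lemma bc_div f a : md a <= r / 2 -> bc f -> bc (fun z => f z * (z - a)^-1).
Proof. by move=> ha hf z hz; apply: ccont_div; [exact: hf|exact: bd_neq hz]. Qed.

Lemma bc_cst c : bc (fun=> c).
Proof. by move=> z _; exact: ccont_cst. Qed.

(** Goursat's lemma is applied to (f z - f a) / (z - a), completed by the derivative of f at a. As f
    is merely continuous at 0, the point a has to differ from 0. *)
Lemma cauchy_formula f a : md a <= r / 2 -> a != 0 ->
  (forall z, insq (- r) (- r) (r + r) z -> ccont f z) ->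
  (forall z, insq (- r) (- r) (r + r) z -> z != 0 -> exists c, cdiff f z c) ->
  csq (fun z => f z * (z - a)^-1) = f a * csq (fun z => 1 * (z - a)^-1).
Proof.
move=> ha a0 hc hd.
have hbf : bc f by move=> z [hz _]; exact: hc.
have hia : insq (- r) (- r) (r + r) a.
  have := Re_le_md a; have := Im_le_md a; rewrite !ler_norml => /andP[? ?] /andP[? ?].
  by split; lra.
have [k hk] := hd a hia a0.
pose g z := if z == a then k else (f z - f a) / (z - a).
have gE z w : z != a -> md (w - z) < md (z - a) -> (f w - f a) / (w - a) = g w.
  move=> za hw; rewrite /g ifN //; apply/negP => /eqP wa.
  by move: hw; rewrite wa md_distC ltxx.
have : csq g = 0.
  apply: (@goursat _ _ 0 a) => [||z hz z0 za].
  - by rewrite addr_gt0.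
  - move=> z hz; have [->|za] := eqVneq z a.
      move=> e e0; have e20 : 0 < e / 2 by exact: divr_gt0.
      have [d d0 hdd] := hk _ e20; exists d => // w /hdd.
      rewrite /g eqxx; have [->|wa] := eqVneq w a; first by move=> _; rewrite /= subrr md0.
      rewrite /=; have -> : f w - f a - k * (w - a) = ((f w - f a) / (w - a) - k) * (w - a).
        by field; rewrite subr_eq0.
      rewrite mdM ler_pM2r ?md_gt0 ?subr_eq0 //; lra.
    apply: (@ccont_near _ (fun w => (f w - f a) / (w - a)) _ _ (md (z - a))).
    + by rewrite md_gt0 subr_eq0.
    + by move=> w; exact: gE.
    + by apply: ccont_div => //; apply: ccontD; [exact: hc|exact: ccont_cst].
  - have [c hcc] := hd z hz z0; eexists.
    apply: (@cdiff_near _ (fun w => (f w - f a) / (w - a)) _ _ _ (md (z - a))).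
    + by rewrite md_gt0 subr_eq0.
    + by move=> w; exact: gE.
    + exact: cdiff_div hcc za.
have hr := rr_ge0.
have -> : csq g = csq (fun z => f z * (z - a)^-1 + - f a * (1 * (z - a)^-1)).
  apply: contour_eq => // z hz.
  by rewrite /g (negbTE (bd_neq ha hz)) mul1r mulrBl mulNr.
rewrite contourD //; last 2 first.
- exact: bc_div.
- move=> z hz; apply: ccontM; first exact: ccont_cst.
  by apply: ccont_div; [exact: ccont_cst|exact: bd_neq hz].
rewrite contourZ //; last by apply: bc_div => //; exact: bc_cst.
by move/eqP; rewrite mulNr subr_eq0 => /eqP.
Qed.

(* The imaginary part of dz / (z - a) is positive along each side. *)
Lemma winding_ge a : md a <= r / 2 -> 1 / 2 <= md (csq (fun z => 1 * (z - a)^-1)).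
Proof.
move=> ha; apply: le_trans (Im_le_md _); apply: le_trans (ler_norm _).
have hr := rr_ge0; have rp := r0.
have hb : bc (fun z => 1 * (z - a)^-1) by apply: bc_div => //; exact: bc_cst.
rewrite /contour ImD ImM /= mul0r add0r mul1r.
(* A lower bound for the sum of the contributions of two opposite sides. Over length 2 r each pair
   then contributes at least 2 / 5, and 4 / 5 exceeds 1 / 2. *)
have [r5 hr5] : exists k, k = 1 / (5 * r) by eexists.
have bound u v : `|u| <= 3 / 2 * r -> r / 2 <= v <= 3 / 2 * r ->
    r5 / 2 <= v / (u ^+ 2 + v ^+ 2).
  move=> hu /andP[hv1 hv2].
  have v0 : 0 < v by lra.
  have q0 : 0 < u ^+ 2 + v ^+ 2 by rewrite ltr_wpDl ?sqr_ge0 ?exprn_gt0.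
  rewrite ler_pdivlMr //.
  have -> : r5 / 2 * (u ^+ 2 + v ^+ 2) = (u ^+ 2 + v ^+ 2) / (10 * r).
    by rewrite hr5; field; rewrite gt_eqF.
  rewrite ler_pdivrMr ?mulr_gt0 //.
  have hu2 : u ^+ 2 <= (3 / 2 * r) ^+ 2.
    by rewrite -real_normK ?num_real // ler_pXn2r ?nnegrE //; lra.
  rewrite expr2 in hu2 *.
  nra.
have [hra hia] : `|Re a| <= r / 2 /\ `|Im a| <= r / 2.
  by split; apply: le_trans ha; [exact: Re_le_md|exact: Im_le_md].
move: hra hia; rewrite !ler_norml => /andP[ra1 ra2] /andP[ia1 ia2].
have lenE : - r + (r + r) - - r = r + r by ring.
have cst_le (g : R -> R) : rseg (- r) (- r + (r + r)) g ->
    (forall t, - r <= t <= - r + (r + r) -> r5 <= g t) ->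
    2 / 5 <= rint (- r) (- r + (r + r)) g.
  move=> hg h; have -> : 2 / 5 = rint (- r) (- r + (r + r)) (fun=> r5).
    by rewrite rint_cst ?lenE ?hr5; [field; rewrite gt_eqF|lra].
  by apply: rint_le => // t _; exact: rcont_cst.
have h1 : 2 / 5 <= rint (- r) (- r + (r + r)) (fun t =>
   Im (1 * (pt t (- r) - a)^-1 - 1 * (pt t (- r + (r + r)) - a)^-1)).
  apply: cst_le; first by apply: cseg_Im; apply: (cseg_bt hr hb).
  move=> t ht; rewrite !mul1r ImD ImN !ImV !ReD !ReN !ImD !ImN /=.
  have := bound (t - Re a) (r + Im a); have := bound (t - Re a) (r - Im a).
  have -> : - r - Im a = - (r + Im a) by ring.
  have -> : - r + (r + r) - Im a = r - Im a by ring.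
  rewrite sqrrN mulNr !ler_norml => b1 b2.
  have {}b1 : r5 / 2 <= (r - Im a) / ((t - Re a) ^+ 2 + (r - Im a) ^+ 2).
    by apply: b1; lra.
  have {}b2 : r5 / 2 <= (r + Im a) / ((t - Re a) ^+ 2 + (r + Im a) ^+ 2).
    by apply: b2; lra.
  by clear -b1 b2; lra.
have h2 : 2 / 5 <= rint (- r) (- r + (r + r)) (fun t =>
   Re (1 * (pt (- r + (r + r)) t - a)^-1 - 1 * (pt (- r) t - a)^-1)).
  apply: cst_le; first by apply: cseg_Re; apply: (cseg_rl hr hb).
  move=> t ht; rewrite !mul1r ReD ReN !ReV !ReD !ReN !ImD !ImN /=.
  have := bound (t - Im a) (r + Re a); have := bound (t - Im a) (r - Re a).
  have -> : - r - Re a = - (r + Re a) by ring.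
  have -> : - r + (r + r) - Re a = r - Re a by ring.
  rewrite sqrrN mulNr !ler_norml ![_ + (t - Im a) ^+ 2]addrC => b1 b2.
  have {}b1 : r5 / 2 <= (r - Re a) / ((t - Im a) ^+ 2 + (r - Re a) ^+ 2).
    by apply: b1; lra.
  have {}b2 : r5 / 2 <= (r + Re a) / ((t - Im a) ^+ 2 + (r + Re a) ^+ 2).
    by apply: b2; lra.
  by clear -b1 b2; lra.
by move: h1 h2; clear; lra.
Qed.

(** This integrates 1 / (z - a) = 1 / z + a / z^2 + a^2 / (z^2 (z - a)) against f. It will be
    applied both to the given function and to the constant 1. *)
Lemma cauchy_kernel_expansion f N : 0 <= N -> bc f -> (forall z, bd z -> md (f z) <= N) ->
  exists J1 J2 (E : C -> C), [/\ md J1 <= 16 * N, md J2 <= 16 * N / r &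
    forall a, md a <= r / 2 ->
      csq (fun z => f z * (z - a)^-1) = J1 + a * J2 + a ^+ 2 * E a /\
      md (E a) <= 32 * N / r ^+ 2].
Proof.
move=> N0 hf hN; have hr := rr_ge0; have rp := r0.
have b0 : md (0 : C) <= r / 2 by rewrite md0; lra.
have hf1 := bc_div b0 hf; have hf2 := bc_div b0 hf1.
have est z : bd z -> md (z - 0)^-1 <= r^-1.
  by move=> hz; rewrite subr0 mdV lef_pV2 ?posrE ?bd_ge // (lt_le_trans r0) // bd_ge.
have n1 z : bd z -> md (f z * (z - 0)^-1) <= N / r.
  by move=> hz; rewrite mdM ler_pM ?md_ge0 ?est ?hN.
have n2 z : bd z -> md (f z * (z - 0)^-1 * (z - 0)^-1) <= N / r / r.
  by move=> hz; rewrite mdM ler_pM ?md_ge0 ?est ?n1.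
exists (csq (fun z => f z * (z - 0)^-1)), (csq (fun z => f z * (z - 0)^-1 * (z - 0)^-1)).
exists (fun a => csq (fun z => f z * (z - 0)^-1 * (z - 0)^-1 * (z - a)^-1)); split.
- by rewrite (le_trans (contour_norm hr hf1 n1)) // le_eqVlt; apply/orP; left;
    apply/eqP; field; rewrite gt_eqF.
- by rewrite (le_trans (contour_norm hr hf2 n2)) // le_eqVlt; apply/orP; left;
    apply/eqP; field; rewrite gt_eqF.
move=> a ha; have hf3 := bc_div ha hf2.
have n3 z : bd z -> md (f z * (z - 0)^-1 * (z - 0)^-1 * (z - a)^-1) <= N / r / r * (2 / r).
  move=> hz; rewrite mdM ler_pM ?md_ge0 ?n2 //.
  have h2 : r / 2 <= md (z - a) by exact: bd_sub_ge.
  have p2 : 0 < r / 2 by exact: divr_gt0.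
  by rewrite -[2 / r]invf_div mdV lef_pV2 ?posrE // (lt_le_trans p2).
split; last first.
  rewrite (le_trans (contour_norm hr hf3 n3)) // le_eqVlt; apply/orP; left.
  by apply/eqP; field; rewrite gt_eqF.
have bZ k g : bc g -> bc (fun z => k * g z).
  by move=> hg z /hg hz; apply: ccontM => //; exact: ccont_cst.
rewrite -(contourZ hr a hf2) -(contourZ hr (a ^+ 2) hf3) -contourD //; last exact: bZ.
rewrite -contourD //; last 2 first.
- by move=> z hz; apply: ccontD; [exact: hf1|exact: bZ].
- exact: bZ.
apply: contour_eq => // z hz; have z0 := bd_neq b0 hz; have za := bd_neq ha hz.
by field; rewrite ?subr0 ?subr_eq0 ?z0 ?za.
Qed.

End Square.

(* Riemann's removable singularity theorem at 0; K does not depend on f, which is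
   what makes the slicewise estimate uniform in several variables. *)
Lemma removable_taylor (rho M : R) : 0 < rho -> 0 <= M -> exists2 K, 0 <= K &
  forall f, (forall z, md z < rho -> md (f z) <= M) -> ccont f 0 ->
    (forall z, md z < rho -> z != 0 -> exists c, cdiff f z c) ->
  exists c, forall z, md z < rho / 8 -> md (f z - f 0 - c * z) <= K * md z ^+ 2.
Proof.
(* The square of half-side r lies in md z < rho because md z is at most 2 r on it; the expansion is
   valid for md z at most r / 2 = rho / 8. *)
move=> rho0 M0; pose r := rho / 4; have r0 : 0 < r by exact: divr_gt0.
(* [A1], [C1] and [K] bound the constant term, the linear coefficient and the remainder of a
   quotient of two expansions. The factors 2 bound the inverse of the denominator by
   [winding_ge]. *)
pose A1 := 32 * M; pose C1 := 2 * (16 * M / r + A1 * (16 / r)).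
pose K := 2 * (32 * M / r ^+ 2 + C1 * (16 / r) + (A1 + C1 * r) * (32 / r ^+ 2)).
have A10 : 0 <= A1 by exact: mulr_ge0.
have r0' := ltW r0.
have C10 : 0 <= C1 by do ?[rewrite addr_ge0 // | rewrite mulr_ge0 // | rewrite invr_ge0 //].
have K0 : 0 <= K.
  by do ?[rewrite addr_ge0 // | rewrite mulr_ge0 // | rewrite invr_ge0 // | rewrite exprn_ge0 //].
exists K => // f hM hc0 hd.
have hin z : insq (- r) (- r) (r + r) z -> md z < rho.
  move=> [/andP[? ?] /andP[? ?]]; apply: (le_lt_trans (md_le_ReIm z)).
  have : `|Re z| <= r by rewrite ler_norml; lra.
  have : `|Im z| <= r by rewrite ler_norml; lra.
  by rewrite /r; lra.
have hcont z : insq (- r) (- r) (r + r) z -> ccont f z.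
  move=> /hin hz; have [->//|z0] := eqVneq z 0.
  by have [c /cdiff_cont] := hd z hz z0.
have hdiff z : insq (- r) (- r) (r + r) z -> z != 0 -> exists c, cdiff f z c.
  by move=> /hin hz; exact: hd.
have hbf : bdcont f (- r) (- r) (r + r) by move=> z [/hcont].
have hbM z : bdsq (- r) (- r) (r + r) z -> md (f z) <= M by move=> [/hin /hM].
have [I1 [I2 [E [hI1 hI2 hE]]]] := cauchy_kernel_expansion r0 M0 hbf hbM.
have hb1 : bdcont (fun=> 1 : C) (- r) (- r) (r + r) by move=> z _; exact: ccont_cst.
have hb1' z : bdsq (- r) (- r) (r + r) z -> md (1 : C) <= 1 by rewrite md1.
have [W0 [W1 [D [hW0 hW1 hD]]]] := cauchy_kernel_expansion r0 ler01 hb1 hb1'.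
pose W a := W0 + a * W1 + a ^+ 2 * D a.
have hW a : md a <= r / 2 -> 1 / 2 <= md (W a).
  by move=> ha; have := winding_ge r0 ha; have [-> _] := hD a ha.
have key a : md a <= r / 2 -> a != 0 -> f a * W a = I1 + a * I2 + a ^+ 2 * E a.
  move=> ha a0; have := cauchy_formula r0 ha a0 hcont hdiff.
  by have [-> _] := hD a ha; have [-> _] := hE a ha.
have W0g : 1 / 2 <= md W0.
  have b0 : md (0 : C) <= r / 2 by rewrite md0 divr_ge0.
  by have := hW 0 b0; rewrite /W expr0n !mul0r !addr0.
have W00 : W0 != 0 by rewrite -md_gt0; lra.
have half z w : 1 / 2 <= md w -> md (z / w) <= 2 * md z.
  move=> hw; rewrite mdM mdV ler_pdivrMr; last lra.
  have := md_ge0 z; nra.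
(* The first two coefficients of the quotient of I1 + a I2 + ... by W0 + a W1 + ... *)
pose A := I1 / W0; pose c := (I2 - A * W1) / W0.
have hA : md A <= A1 by rewrite (le_trans (half _ _ W0g)) // /A1; lra.
have hcc : md c <= C1.
  rewrite (le_trans (half _ _ W0g)) // /C1 ler_pM2l // (le_trans (mdB _ _)) //.
  rewrite lerD // mdM ler_pM ?md_ge0 //; move: hW1; rewrite mulr1; apply: le_trans.
  by rewrite lexx.
have est a : md a <= r / 2 -> a != 0 -> md (f a - A - c * a) <= K * md a ^+ 2.
  move=> ha a0; have Wa := hW a ha; have Wa0 : W a != 0 by rewrite -md_gt0; lra.
  have -> : f a - A - c * a = a ^+ 2 * (E a - c * W1 - (A + c * a) * D a) / W a.
    apply: (canRL (mulfK Wa0)); rewrite !mulrBl (key a ha a0) /c /A /W.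
    by field.
  rewrite (le_trans (half _ _ Wa)) // mdM mdX [K * _]mulrC.
  rewrite mulrCA ler_wpM2l ?exprn_ge0 ?md_ge0 // /K ler_pM2l //.
  have [_ hEa] := hE a ha; have [_ hDa] := hD a ha.
  rewrite (le_trans (mdB _ _)) // !mdM lerD //.
    rewrite (le_trans (mdB _ _)) // lerD // mdM ler_pM ?md_ge0 //.
    by move: hW1; rewrite mulr1.
  rewrite ler_pM ?md_ge0 //; last by move: hDa; rewrite mulr1.
  rewrite (le_trans (mdD _ _)) // lerD // mdM ler_pM ?md_ge0 //; lra.
(* The expansion is known only for a different from 0; continuity of f at 0, tested along small
   positive reals, identifies its constant term. *)
have f0A : f 0 = A.
  apply/eqP; rewrite -subr_eq0 -md_eq0 eq_le md_ge0 andbT.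
  apply/ler_addgt0Pr => e e0; rewrite add0r.
  have e20 : 0 < e / 2 by exact: divr_gt0.
  have [d d0 hdd] := hc0 _ e20.
  have Q0 : 0 < 2 * (K * r + C1 + 1).
    by rewrite mulr_gt0 // ltr_wpDl // addr_ge0 // mulr_ge0.
  pose t := Num.min (d / 2) (Num.min (r / 2) (e / (2 * (K * r + C1 + 1)))).
  have t0 : 0 < t by rewrite !lt_min !divr_gt0.
  have [t1 t2 t3] : [/\ t <= d / 2, t <= r / 2 & t <= e / (2 * (K * r + C1 + 1))].
    have : t <= t by []; rewrite {2}/t !le_min => /and3P[h1 h2 h3]; by split.
  have mt : md (t%:C)%C = t by rewrite md_real gtr0_norm.
  have tn0 : (t%:C)%C != 0 :> C by rewrite -md_gt0 mt.
  have hta : md ((t%:C)%C : C) <= r / 2 by rewrite mt.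
  have h1 := est _ hta tn0.
  have h2 : md (f (t%:C)%C - f 0) < e / 2 by apply: hdd; rewrite subr0 mt; lra.
  have -> : f 0 - A = (f (t%:C)%C - A - c * (t%:C)%C) + c * (t%:C)%C - (f (t%:C)%C - f 0).
    by ring.
  rewrite (le_trans (mdB _ _)) // [e]splitr; apply: lerD; last exact: ltW.
  rewrite mt in h1; rewrite (le_trans (mdD _ _)) // mdM mt.
  move: t3; rewrite ler_pdivlMr // => t3.
  have u1 : md c * t <= C1 * t by rewrite ler_pM2r.
  have u2 : K * t ^+ 2 <= K * r * t.
    by rewrite -mulrA ler_wpM2l // expr2 ler_pM2r //; lra.
  lra.
exists c => z hz; have [->|z0] := eqVneq z 0.
  by rewrite subrr mulr0 subr0 md0 mulr_ge0.
by rewrite f0A; apply: est => //; rewrite /r; lra.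
Qed.

End Cauchy.

(** * Germs of holomorphic maps *)

Lemma coord_le_mx_norm (K : numDomainType) n (x : 'rV[K]_n) i :
  `|x ord0 i| <= mx_norm x.
Proof. by rewrite mx_normE -[leLHS]nngE num_le; exact: (le_bigmax _ _ (ord0, i)). Qed.

Section FrechetNormedModule.
Variables (K : numFieldType) (V W : normedModType K).
Implicit Types (x w : V) (f : V -> W) (L : {linear V -> W}).

Lemma near_norm x (P : set V) : (\forall w \near x, P w) <->
  exists2 d : K, 0 < d & forall w, `|w - x| < d -> P w.
Proof.
split=> [/nbhs_normP[e /= e0 h]|[d d0 h]].
  by exists e => // w hw; apply: h; rewrite /ball_ /= distrC.
by apply/nbhs_normP; exists d => //= w; rewrite /ball_ /= distrC; exact: h.
Qed.

Definition linear_approx f x L := forall e : K, 0 < e ->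
  exists2 d : K, 0 < d & forall w, `|w - x| < d ->
    `|f w - f x - L (w - x)| <= e * `|w - x|.

Lemma linear_approxP f x L : linear_approx f x L <->
  f \o shift x = cst (f x) + L +o_ 0 id.
Proof.
split=> [h|/eqaddoP h e e0].
  apply/eqaddoP => e e0.
  have [d d0 hd] := h _ e0; apply/near_norm; exists d => // w; rewrite subr0 => hw.
  have := hd (w + x); rewrite addrK => /(_ hw).
  by rewrite -addrA -opprD.
have /near_norm[d d0 hd] := h _ e0; exists d => // w hw.
have := hd (w - x); rewrite subr0 => /(_ hw).
rewrite -addrA -opprD.
by rewrite -[X in `|X| <= _ -> _]/(f (w - x + x) - (f x + L (w - x))) subrK.
Qed.

Lemma differentiable_approxP f x : differentiable f x <->
  exists2 L : {linear V -> W}, continuous L & linear_approx f x L.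
Proof.
split=> [df|[L cL /linear_approxP hL]].
  exists ('d f x); first exact: diff_continuous.
  by apply/linear_approxP; exact: diff_locally.
apply/diff_locallyP; have dE := diff_unique cL hL.
by rewrite dE.
Qed.

End FrechetNormedModule.

Section FrechetGeneric.
Variables (K : numFieldType) (n : nat).
Local Notation V := 'rV[K]_n.
Implicit Types (x y v w : V) (f g : V -> V).

Lemma norm_le_coord x (c : K) : 0 <= c -> (forall i, `|x ord0 i| <= c) -> `|x| <= c.
Proof.
move=> c0 h; have [->|x0] := eqVneq x 0; first by rewrite normr0.
have /mx_norm_neq0[[i j] /= hij] : mx_norm x != 0.
  by apply: contra x0 => /eqP /mx_norm_eq0 ->.
by rewrite /Num.norm /= hij ord1.
Qed.

Lemma mulmx_normP (A : 'M[K]_n) :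
  exists2 c : K, 0 < c & forall h : V, `|h *m A| <= c * `|h|.
Proof.
pose S := \sum_i \sum_j `|A i j|.
have S0 : 0 <= S by do 2 apply: sumr_ge0 => ? _.
exists (S + 1) => [|h]; first by rewrite ltr_wpDl.
apply: norm_le_coord => [|j]; first by rewrite mulr_ge0 // addr_ge0.
rewrite mxE; apply: le_trans (ler_norm_sum _ _ _) _.
apply: (@le_trans _ _ (S * `|h|)); last by rewrite ler_wpM2r // lerDl.
rewrite mulr_suml; apply: ler_sum => i _; rewrite normrM mulrC.
apply: ler_pM => //; last exact: coord_le_mx_norm.
by rewrite (bigD1 j) //= lerDl; apply: sumr_ge0.
Qed.

Lemma mulmxr_continuous (A : 'M[K]_n) : continuous (mulmxr A : V -> V).
Proof.
have [c c0 hc] := mulmx_normP A.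
apply: bounded_linear_continuous; apply/linear_boundedP.
exists c; split => [|r cr x /=]; first exact: gtr0_real.
by apply: le_trans (hc x) _; rewrite ler_wpM2r // ltW.
Qed.

Lemma differentiable_normP f x : differentiable f x <-> exists A : 'M[K]_n,
  forall e : K, 0 < e -> exists2 d : K, 0 < d & forall w, `|w - x| < d ->
    `|f w - f x - (w - x) *m A| <= e * `|w - x|.
Proof.
split=> [/differentiable_approxP[L _ hL]|[A hA]].
  by exists (lin1_mx L) => e /hL[d d0 hd]; exists d => // w /hd; rewrite mul_rV_lin1.
apply/differentiable_approxP; exists (mulmxr A : {linear V -> V}) => //.
exact: mulmxr_continuous.
Qed.

End FrechetGeneric.

Section VectorNorm.
Variables (R : realType) (n : nat).
Local Notation C := R[i].
Local Notation V := 'rV[C]_n.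
Implicit Types (x y v w : V).

Definition nv x : R := complex.Re `|x|.

Lemma nvE x : `|x| = ((nv x)%:C)%C.
Proof. by rewrite /nv RRe_real // normr_real. Qed.

Lemma nv_ge0 x : 0 <= nv x.
Proof. by rewrite -lecR -nvE normr_ge0. Qed.

Lemma nvD x y : nv (x + y) <= nv x + nv y.
Proof. by rewrite -lecR rmorphD /= -!nvE ler_normD. Qed.

Lemma nvN x : nv (- x) = nv x.
Proof. by rewrite /nv normrN. Qed.

Lemma nvB x y : nv (x - y) <= nv x + nv y.
Proof. by rewrite -[nv y]nvN nvD. Qed.

Lemma nv0 : nv 0 = 0. Proof. by rewrite /nv normr0. Qed.

Lemma nvZ (a : C) x : nv (a *: x) = md a * nv x.
Proof. by apply: complexI; rewrite rmorphM /= -!nvE -mdE normrZ. Qed.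

Lemma sub_nv_le x y : nv x - nv y <= nv (x - y).
Proof. by rewrite lerBlDr -{1}(subrK y x) nvD. Qed.

Lemma nv_eq0 x : (nv x == 0) = (x == 0).
Proof. by rewrite -[x == 0]normr_eq0 nvE -(inj_eq (@complexI R)). Qed.

Lemma nv_le x c : 0 <= c -> (forall i, md (x ord0 i) <= c) -> nv x <= c.
Proof.
move=> c0 h; rewrite -lecR -nvE.
have [->|x0] := eqVneq x 0; first by rewrite normr0 lecR.
have /mx_norm_neq0[[i j] /= hij] : mx_norm x != 0.
  by apply: contra x0 => /eqP /mx_norm_eq0 ->.
by rewrite /Num.norm /= hij ord1 mdE lecR.
Qed.

Lemma coord_le_nv x i : md (x ord0 i) <= nv x.
Proof.
by rewrite -lecR -mdE -nvE; exact: coord_le_mx_norm.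
Qed.

End VectorNorm.

Section Frechet.
Variables (R : realType) (n : nat).
Local Notation C := R[i].
Local Notation V := 'rV[C]_n.
Implicit Types (x y v w : V) (f g : V -> V).

Lemma mulmx_bound m (A : 'M[C]_(n, m)) :
  exists2 K : R, 0 < K & forall h : V, nv (h *m A) <= K * nv h.
Proof.
pose S := \sum_i \sum_j md (A i j).
have S0 : 0 <= S by do 2 apply: sumr_ge0 => ? _; exact: md_ge0.
exists (S + 1) => [|h]; first by rewrite ltr_wpDl.
apply: nv_le => [|j]; first by rewrite mulr_ge0 ?nv_ge0 // addr_ge0.
rewrite mxE; apply: (@le_trans _ _ (\sum_i md (h ord0 i * A i j))).
  elim/big_ind2 : _ => [|a b c d h1 h2|//]; first by rewrite md0.
  by apply: le_trans (mdD _ _) _; exact: lerD.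
apply: (@le_trans _ _ (S * nv h)); last by rewrite ler_wpM2r ?nv_ge0 // lerDl.
rewrite mulr_suml; apply: ler_sum => i _; rewrite mdM mulrC.
apply: ler_pM; rewrite ?md_ge0 ?coord_le_nv //.
by rewrite (bigD1 j) //= lerDl; apply: sumr_ge0 => ? _; exact: md_ge0.
Qed.

Definition frechet f x (A : 'M[C]_n) := forall e : R, 0 < e ->
  exists2 d : R, 0 < d & forall w, nv (w - x) < d ->
    nv (f w - f x - (w - x) *m A) <= e * nv (w - x).

Lemma norm_ltE x (d : R) : (`|x| < ((d%:C)%C : C)) = (nv x < d).
Proof. by rewrite nvE ltcR. Qed.

Lemma real_of_pos (e : C) : 0 < e -> exists2 d : R, 0 < d & e = (d%:C)%C.
Proof.
move=> e0; have eE : e = ((complex.Re e)%:C)%C by rewrite RRe_real // gtr0_real.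
by exists (complex.Re e) => //; rewrite -ltcR -eE.
Qed.

Lemma frechetP f x A : frechet f x A <->
  forall e : C, 0 < e -> exists2 d : C, 0 < d & forall w, `|w - x| < d ->
    `|f w - f x - (w - x) *m A| <= e * `|w - x|.
Proof.
split=> h e.
  move=> /real_of_pos[e' e0' ->]; have [d d0 hd] := h _ e0'.
  exists ((d%:C)%C) => [|w]; first by rewrite ltcR.
  by rewrite norm_ltE !nvE -rmorphM lecR => /hd.
move=> e0; have [|d /real_of_pos[d' d0' ->] hd] := h ((e%:C)%C).
  by rewrite ltcR.
by exists d' => // w; rewrite -norm_ltE => /hd; rewrite !nvE -rmorphM lecR.
Qed.

Lemma germ_eqE f g : germ_eq f g <->
  exists2 r : R, 0 < r & forall x, nv x < r -> f x = g x.
Proof.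
split=> [/near_norm[d /real_of_pos[d' d0' ->] h]|[r r0 h]].
  by exists d' => // x hx; apply: h; rewrite subr0 norm_ltE.
apply/near_norm; exists ((r%:C)%C); first by rewrite ltcR.
by move=> w; rewrite subr0 norm_ltE; exact: h.
Qed.

Lemma holo_germE f : holo_germ f <-> f 0 = 0 /\
  exists2 r : R, 0 < r & forall x, nv x < r -> exists A, frechet f x A.
Proof.
split=> -[f0 h]; split => //.
  move: h => /near_norm[d /real_of_pos[d' d0' ->] h]; exists d' => // x hx.
  have := h x; rewrite subr0 norm_ltE => /(_ hx) /differentiable_normP[A hA].
  by exists A; apply/frechetP.
move: h => [r r0 h]; apply/near_norm; exists ((r%:C)%C); first by rewrite ltcR.
move=> w; rewrite subr0 norm_ltE => /h[A /frechetP hA].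
by apply/differentiable_normP; exists A.
Qed.

(** The scalar version, since the removable singularity theorem is applied to one coordinate
    function at a time. *)
Definition frechet1 (f : V -> C) x (A : 'cV[C]_n) := forall e : R, 0 < e ->
  exists2 d : R, 0 < d & forall w, nv (w - x) < d ->
    md (f w - f x - ((w - x) *m A) ord0 ord0) <= e * nv (w - x).

Lemma frechet_coord f x A j : frechet f x A ->
  frechet1 (fun w => f w ord0 j) x (col j A).
Proof.
move=> h e /h[d d0 hd]; exists d => // w /hd; apply: le_trans.
apply: le_trans (coord_le_nv _ j); rewrite !mxE le_eqVlt; apply/orP; left.
apply/eqP; congr (md (_ + - _)).
by apply: eq_bigr => i _; rewrite !mxE.
Qed.

End Frechet.

Section FrechetCoord.
Variables (R : realType) (n : nat).
Local Notation C := R[i].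
Local Notation V := 'rV[C]_n.
Implicit Types (x y v w : V).

Lemma min_family (I : finType) (d : I -> R) : (forall i, 0 < d i) ->
  exists2 e, 0 < e & forall i, e <= d i.
Proof.
move=> hd; exists (\big[Num.min/1]_i d i).
  by elim/big_ind : _ => // a b a0 b0; rewrite lt_min a0.
by move=> i; exact: bigmin_le_cond.
Qed.

Lemma frechet_from_coord (f : V -> V) x :
  (forall j, exists A, frechet1 (fun w => f w ord0 j) x A) -> exists A, frechet f x A.
Proof.
move=> /choice[A hA]; exists (\matrix_(i, j) A j i ord0).
move=> e e0.
have /choice[d hd] j : exists d, 0 < d /\ forall w, nv (w - x) < d ->
    md (f w ord0 j - f x ord0 j - ((w - x) *m A j) ord0 ord0) <= e * nv (w - x).
  by have [d d0 hd] := hA j e e0; exists d.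
have [k k0 hk] := min_family (fun j => (hd j).1).
exists k => // w hw; apply: nv_le => [|j]; first by rewrite mulr_ge0 ?nv_ge0 // ltW.
have := (hd j).2 w (lt_le_trans hw (hk j)); apply: le_trans.
rewrite !mxE le_eqVlt; apply/orP; left.
apply/eqP; congr (md (_ + - _)).
by apply: eq_bigr => i _; rewrite !mxE.
Qed.

Definition vcont (f : V -> V) x := forall e : R, 0 < e ->
  exists2 d : R, 0 < d & forall w, nv (w - x) < d -> nv (f w - f x) < e.

Lemma frechet_vcont (f : V -> V) x A : frechet f x A -> vcont f x.
Proof.
move=> h e e0; have [K K0 hK] := mulmx_bound A.
have [d d0 hd] := h _ ltr01; exists (Num.min d (e / (K + 1))) => [|w].
  by rewrite lt_min d0 divr_gt0 // addr_gt0.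
rewrite lt_min ltr_pdivlMr ?addr_gt0 // => /andP[/hd hw]; apply: le_lt_trans.
rewrite -[f w - f x](subrK ((w - x) *m A)) (le_trans (nvD _ _)) //.
by have := hK (w - x); move: hw; lra.
Qed.

End FrechetCoord.

(** * Local k-th roots *)

Section LocalRoot.
Variable R : realType.
Local Notation C := R[i].
Implicit Types (z w c : C).

Lemma ccont_sum (I : Type) (s : seq I) (F : I -> C -> C) z :
  (forall i, ccont (F i) z) -> ccont (fun w => \sum_(i <- s) F i w) z.
Proof.
move=> h; elim: s => [|i s IH].
  apply: (@ccont_near _ (fun=> 0) _ _ 1) => //; last exact: ccont_cst.
  by move=> w _; rewrite big_nil.
apply: (@ccont_near _ (fun w => F i w + \sum_(j <- s) F j w) _ _ 1) => //.
  by move=> w _; rewrite big_cons.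
exact: ccontD.
Qed.

Lemma ccontX k z : ccont (fun w => w ^+ k) z.
Proof.
elim: k => [|k IH]; first exact: ccont_cst.
apply: (@ccont_near _ (fun w => w * w ^+ k) _ _ 1) => //.
  by move=> w _; rewrite exprS.
by apply: ccontM => //; exact: ccont_id.
Qed.

(** The product of w0 - w over the k roots w of X^k - z is w0^k - z, so some factor has a k-th power
    of modulus at most that of the product. *)
Lemma exists_near_root k w0 z : (0 < k)%N ->
  exists2 w, w ^+ k = z & md (w - w0) ^+ k <= md (z - w0 ^+ k).
Proof.
move=> k0; have [r hr] := closed_field_poly_normal ('X^k - z%:P).
rewrite lead_coefXnsubC // scale1r in hr.
have sr : size r = k.
  by have := size_XnsubC z k0; rewrite hr size_prod_XsubC => -[].
have hE : w0 ^+ k - z = \prod_(w <- r) (w0 - w).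
  have := congr1 (fun p => p.[w0]) hr; rewrite !hornerE => ->.
  by rewrite horner_prod; apply: eq_bigr => i _; rewrite !hornerE.
have rootr w : w \in r -> w ^+ k = z.
  rewrite -root_prod_XsubC -hr /root !hornerE subr_eq0 => /eqP //.
have [|hn] := pselect (exists2 w, w \in r & md (w - w0) ^+ k <= md (z - w0 ^+ k)).
  by move=> [w /rootr wz hw]; exists w.
have {}hn w : w \in r -> md (z - w0 ^+ k) < md (w0 - w) ^+ k.
  by move=> wr; rewrite ltNge; apply/negP => h; apply: hn; exists w => //; rewrite md_distC.
pose p := md (z - w0 ^+ k).
have p0 : 0 <= p by exact: md_ge0.
suff : p ^+ k < md (w0 ^+ k - z) ^+ k by rewrite md_distC ltxx.
rewrite hE => {hE hr}.
have -> : md (\prod_(w <- r) (w0 - w)) ^+ k = \prod_(w <- r) md (w0 - w) ^+ k.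
  elim: (r) => [|i s IH]; first by rewrite !big_nil md1 expr1n.
  by rewrite !big_cons mdM exprMn IH.
have -> : p ^+ k = \prod_(w <- r) p.
  by rewrite big_const_seq count_predT sr -Monoid.iteropE.
have : (0 < size r)%N by rewrite sr.
elim: r {sr rootr} hn => [//|w r IH] hn _; rewrite !big_cons.
have hw : p < md (w0 - w) ^+ k by apply: hn; rewrite mem_head.
case: r IH hn => [|w' r] IH hn; first by rewrite !big_nil !mulr1.
apply: ltr_pM => //; first by apply: prodr_ge0.
by apply: IH => // v hv; apply: hn; rewrite in_cons hv orbT.
Qed.

(** Write w^k - w0^k = (w - w0) Q(w). Then w - w0 is (z - w0^k) / Q(w), where Q is continuous with
    Q(w0) = k w0^(k-1) nonzero. No branch is selected: a suitable root for each z is enough, because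
    the functions to be descended do not depend on the root. *)
Lemma local_root k w0 : (0 < k)%N -> w0 != 0 -> exists c, forall e : R, 0 < e ->
  exists2 d, 0 < d & forall z, md (z - w0 ^+ k) < d -> exists2 w, w ^+ k = z &
    md (w - w0 - c * (z - w0 ^+ k)) <= e * md (z - w0 ^+ k).
Proof.
move=> k0 w00.
pose Q w := \sum_(i < k) w ^+ (k.-1 - i) * w0 ^+ i.
have hQ : ccont Q w0.
  apply: ccont_sum => i; apply: ccontM; [exact: ccontX|exact: ccont_cst].
have Q0 : Q w0 != 0.
  rewrite /Q (eq_bigr (fun=> w0 ^+ k.-1)); last first.
    by move=> i _; rewrite -exprD subnK // -ltnS prednK.
  by rewrite sumr_const card_ord -mulr_natl mulf_neq0 ?expf_neq0 // pnatr_eq0 -lt0n.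
have hQV := ccontV Q0 hQ.
exists (Q w0)^-1 => e e0; have [d d0 hd] := hQV e e0.
have mQ0 : 0 < md (Q w0) by rewrite md_gt0.
have [d' d0' hd'] := hQ _ mQ0.
pose dm := Num.min d d'; have dm0 : 0 < dm by rewrite lt_min d0.
(* [exists_near_root] controls the k-th power of the distance, so this radius puts w within [dm] of
   w0. *)
exists (dm ^+ k) => [|z hz]; first exact: exprn_gt0.
have [w wz hw] := exists_near_root w0 z k0; exists w => //.
have {hw} : md (w - w0) < dm.
  rewrite -(ltr_pXn2r k0) ?nnegrE ?md_ge0 ?(ltW dm0) //.
  exact: le_lt_trans hw hz.
rewrite lt_min => /andP[/hd h1 /hd' h2].
have Qw : Q w != 0.
  by apply/eqP => Qw; move: h2; rewrite Qw sub0r mdN ltxx.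
have -> : w - w0 - (Q w0)^-1 * (z - w0 ^+ k) =
    ((Q w)^-1 - (Q w0)^-1) * (z - w0 ^+ k).
  rewrite mulrBl; congr (_ - _); apply: (canRL (mulKf Qw)).
  rewrite -wz -[k in w ^+ k](prednK k0) -[k in w0 ^+ k](prednK k0) subrXX prednK // mulrC.
  by congr (_ * _).
by rewrite mdM ler_wpM2r ?md_ge0 // ltW.
Qed.

End LocalRoot.

(** * Descent along a fold *)

Section Descent.
Variables (R : realType) (m : nat).
Local Notation C := R[i].
Local Notation V := 'rV[C]_m.+1.
Implicit Types (x y v w h : V) (z u c : C).

Definition upd x u : V := \row_i (if i == ord0 then u else x ord0 i).
Local Notation hd x := (x ord0 ord0).

Lemma hd_upd x u : hd (upd x u) = u.
Proof. by rewrite mxE eqxx. Qed.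

Lemma upd_upd x u u' : upd (upd x u) u' = upd x u'.
Proof. by apply/rowP => i; rewrite !mxE; case: eqP. Qed.

Lemma upd_id x : upd x (hd x) = x.
Proof. by apply/rowP => i; rewrite !mxE; case: eqP => // ->. Qed.

Lemma updB x y u u' : upd x u - upd y u' = upd (x - y) (u - u').
Proof. by apply/rowP => i; rewrite !mxE; case: eqP. Qed.

Lemma upd00 : upd 0 0 = 0.
Proof. by apply/rowP => i; rewrite !mxE if_same. Qed.

Lemma nv_upd_le x u (a : R) : nv x <= a -> md u <= a -> nv (upd x u) <= a.
Proof.
move=> hx hu; apply: nv_le => [|i]; first by rewrite (le_trans (md_ge0 u)).
by rewrite mxE; case: eqP => // _; apply: le_trans hx; exact: coord_le_nv.
Qed.

Lemma nv_upd_lt x u (a : R) : nv x < a -> md u < a -> nv (upd x u) < a.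
Proof.
move=> hx hu; apply: (@le_lt_trans _ _ (Num.max (nv x) (md u))).
  by apply: nv_upd_le; rewrite le_max lexx ?orbT.
by rewrite gt_max hx hu.
Qed.

Lemma hd_le_nv x : md (hd x) <= nv x.
Proof. exact: coord_le_nv. Qed.

Lemma nv_upd0 u : nv (upd 0 u) = md u.
Proof.
apply/eqP; rewrite eq_le; apply/andP; split.
  by apply: nv_upd_le; rewrite // nv0 md_ge0.
by have := hd_le_nv (upd 0 u); rewrite hd_upd.
Qed.

Lemma nv_upd_same x y u : nv (upd x u - upd y u) <= nv (x - y).
Proof. by rewrite updB subrr; apply: nv_upd_le; rewrite // md0 nv_ge0. Qed.

Lemma upd_mul h u (A : 'cV[C]_m.+1) :
  (upd h u *m A) ord0 ord0 = (h *m A) ord0 ord0 + (u - hd h) * A ord0 ord0.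
Proof.
rewrite !mxE (bigD1 ord0) //= [in RHS](bigD1 ord0) //= mxE eqxx.
under eq_bigr => i hi do rewrite mxE (negbTE hi).
ring.
Qed.

(** Descent replaces only the partial derivative in the first coordinate; the other partial
    derivatives are carried over. *)
Definition upd_head (A : 'cV[C]_m.+1) c : 'cV[C]_m.+1 :=
  \col_i (if i == ord0 then c else A i ord0).

Lemma mul_upd_head h A c :
  (h *m upd_head A c) ord0 ord0 = (h *m A) ord0 ord0 + hd h * (c - A ord0 ord0).
Proof.
rewrite !mxE (bigD1 ord0) //= [in RHS](bigD1 ord0) //= mxE eqxx.
under eq_bigr => i hi do rewrite mxE (negbTE hi).
ring.
Qed.

Definition vcont1 (f : V -> C) x := forall e : R, 0 < e ->
  exists2 d : R, 0 < d & forall w, nv (w - x) < d -> md (f w - f x) < e.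

Lemma frechet1_cont (f : V -> C) x A : frechet1 f x A -> vcont1 f x.
Proof.
move=> h e e0; have [K K0 hK] := mulmx_bound A.
have [d d0 hd] := h _ ltr01; exists (Num.min d (e / (K + 1))) => [|w].
  by rewrite lt_min d0 divr_gt0 // addr_gt0.
rewrite lt_min ltr_pdivlMr ?addr_gt0 // => /andP[/hd hw]; apply: le_lt_trans.
rewrite -[f w - f x](subrK (((w - x) *m A) ord0 ord0)) (le_trans (mdD _ _)) //.
have := coord_le_nv ((w - x) *m A) ord0.
by have := hK (w - x); move: hw; lra.
Qed.

Section Scalar.
Variables (k : nat) (k0 : (0 < k)%N) (phi : V -> C) (r B : R).
Hypotheses (r0 : 0 < r) (B0 : 0 <= B).
Hypothesis phi_diff : forall x, nv x < r -> exists A, frechet1 phi x A.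
Hypothesis phi_bound : forall x, nv x < r -> md (phi x) <= B.
Hypothesis phi_inv : forall x u, nv x < r -> u ^+ k = hd x ^+ k -> phi (upd x u) = phi x.

Local Notation rt := (k.-root : C -> C).

(* k.-root is a discontinuous choice of root, but by phi_inv any other choice
   gives the same value. *)
Definition descended y := phi (upd y (rt (hd y))).

(** Within this radius both y and y with its first coordinate replaced by a k-th root of it stay in
    the ball of radius r. *)
Let s := Num.min r (r ^+ k).

Lemma descent_radius_gt0 : 0 < s.
Proof. by rewrite lt_min r0 exprn_gt0. Qed.

Lemma root_lt u z : md z < s -> u ^+ k = z -> md u < r.
Proof.
move=> hz uz; rewrite -(ltr_pXn2r k0) ?nnegrE ?md_ge0 ?(ltW r0) // -mdX uz.
by apply: lt_le_trans hz _; rewrite ge_min lexx orbT.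
Qed.

Lemma descended_root y u : nv y < s -> u ^+ k = hd y -> descended y = phi (upd y u).
Proof.
move=> hy hu; rewrite /descended -[RHS](@phi_inv _ (rt (hd y))) ?upd_upd //.
  apply: nv_upd_lt; first by apply: lt_le_trans hy _; rewrite ge_min lexx.
  by apply: root_lt hu; exact: le_lt_trans (hd_le_nv y) hy.
by rewrite hd_upd hu rootCK.
Qed.

(** By [descended_root] the root near w0 given by [local_root] may be used at every nearby point,
    and the claim becomes the chain rule. *)
Lemma descended_diff_off y : nv y < s -> hd y != 0 -> exists A, frechet1 descended y A.
Proof.
move=> hy y0; have yr : nv y < r by apply: lt_le_trans hy _; rewrite ge_min lexx.
pose w0 := rt (hd y).
have w0k : w0 ^+ k = hd y by rewrite rootCK.
have w00 : w0 != 0 by rewrite rootC_eq0.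
have hx0 : nv (upd y w0) < r.
  apply: nv_upd_lt => //; apply: root_lt w0k.
  exact: le_lt_trans (hd_le_nv y) hy.
have [A hA] := phi_diff hx0.
have [c hc] := local_root k0 w00.
exists (upd_head A (c * A ord0 ord0)) => e e0.
set a := A ord0 ord0.
(* [L] bounds the increment of the root relative to that of y, and [Q] bounds the first partial
   derivative of phi. The error of phi and the error of the root each get half of e. *)
have [L LE] : exists L, L = md c + 1 by eexists.
have L0 : 0 < L by rewrite LE ltr_wpDl ?md_ge0.
have L1 : 0 < L + 1 by exact: addr_gt0.
have [Q QE] : exists Q, Q = md a + 1 by eexists.
have Q0 : 0 < Q by rewrite QE ltr_wpDl ?md_ge0.
have eL : 0 < e / (2 * (L + 1)) by rewrite divr_gt0 // mulr_gt0.
have [d1 d10 hd1] := hA _ eL.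
have eQ : 0 < Num.min 1 (e / (2 * Q)) by rewrite lt_min ltr01 divr_gt0 // mulr_gt0.
have [d2 d20 hd2] := hc _ eQ.
exists (Num.min (s - nv y) (Num.min d2 (d1 / (L + 1)))) => [|y'].
  by rewrite !lt_min subr_gt0 hy d20 divr_gt0.
rewrite !lt_min => /and3P[h1 h2]; rewrite ltr_pdivlMr // => h3.
have hy' : nv y' < s.
  have := sub_nv_le y' y; lra.
set N := nv (y' - y) in h1 h2 h3 *.
have N0 : 0 <= N by exact: nv_ge0.
have hN : md (hd y' - hd y) <= N by have := hd_le_nv (y' - y); rewrite !mxE.
have [|w wk hw] := hd2 (hd y').
  by rewrite w0k; exact: le_lt_trans h2.
rewrite w0k in hw.
set z := hd y' - hd y in hN hw.
have hw1 : md (w - w0 - c * z) <= md z.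
  apply: le_trans hw _; rewrite -[leRHS]mul1r ler_wpM2r ?md_ge0 //.
  by rewrite ge_min lexx.
have hw2 : md (w - w0 - c * z) <= e / (2 * Q) * N.
  apply: le_trans hw _; apply: ler_pM; rewrite ?md_ge0 ?(ltW eQ) //.
  by rewrite ge_min lexx orbT.
have hww : md (w - w0) <= L * N.
  rewrite -[w - w0](subrK (c * z)) (le_trans (mdD _ _)) // mdM LE.
  have := md_ge0 c; have := ler_wpM2l (md_ge0 c) hN; lra.
have hx : nv (upd y' w - upd y w0) <= (L + 1) * N.
  rewrite updB; apply: nv_upd_le; first by rewrite -/N mulrDl mul1r lerDr mulr_ge0 // ltW.
  by apply: le_trans hww _; rewrite mulrDl mul1r lerDl.
have := hd1 (upd y' w); rewrite (le_lt_trans hx) => [/(_ isT)|]; last by rewrite mulrC.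
rewrite (descended_root hy' wk) (descended_root hy w0k) mul_upd_head updB upd_mul -/a.
move=> hmain.
have -> : phi (upd y' w) - phi (upd y w0)
     - (((y' - y) *m A) ord0 ord0 + hd (y' - y) * (c * a - a)) =
  (phi (upd y' w) - phi (upd y w0)
     - (((y' - y) *m A) ord0 ord0 + (w - w0 - hd (y' - y)) * a)) + (w - w0 - c * z) * a.
  by rewrite /z !mxE; ring.
have -> : e * N = e / 2 * N + e / 2 * N by lra.
rewrite (le_trans (mdD _ _)) // mdM; apply: lerD.
  apply: le_trans hmain _; rewrite -updB.
  apply: le_trans (ler_wpM2l (ltW eL) hx) _.
  by rewrite le_eqVlt; apply/orP; left; apply/eqP; field; rewrite gt_eqF.
apply: (@le_trans _ _ (e / (2 * Q) * N * Q)).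
  by apply: ler_pM; rewrite ?md_ge0 // QE lerDl.
by rewrite le_eqVlt; apply/orP; left; apply/eqP; field; rewrite gt_eqF.
Qed.

(** The increment splits into three: along the slice through y', with a quadratic error whose
    constant K is fixed before the slice; along the hyperplane, where [descended] equals phi; and
    the change of the slice derivative c from y to y', times the first coordinate. *)
Lemma descended_diff_on y : nv y < s -> hd y = 0 -> exists A, frechet1 descended y A.
Proof.
move=> hy y0; have s0 := descent_radius_gt0.
have yr : nv y < r by apply: lt_le_trans hy _; rewrite ge_min lexx.
have rt0 : rt 0 = 0 :> C by apply/eqP; rewrite rootC_eq0.
have sr (q : R) : q < s -> q < r by move=> h; apply: lt_le_trans h _; rewrite ge_min lexx.
have rts z : md z < s -> md (rt z) < r by move=> hz; apply: root_lt hz _; rewrite rootCK.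
have [K K0 hK] := removable_taylor s0 B0.
have desc0 v : descended (upd v 0) = phi (upd v 0).
  by rewrite /descended hd_upd rt0 upd_upd.
have slice v : nv v < s -> exists c, forall z, md z < s / 8 ->
    md (descended (upd v z) - phi (upd v 0) - c * z) <= K * md z ^+ 2.
  move=> hv; have [|||c hc] := hK (fun z => descended (upd v z)).
  - move=> z hz; rewrite /descended hd_upd upd_upd; apply: phi_bound.
    by apply: nv_upd_lt; [exact: sr|exact: rts].
  - have hv0 : nv (upd v 0) < r by apply: nv_upd_lt; rewrite ?md0 //; exact: sr.
    have [A /frechet1_cont hA] := phi_diff hv0.
    move=> e e0; have [d d0 hd] := hA e e0; exists (d ^+ k); first exact: exprn_gt0.
    move=> z; rewrite subr0 => hz; rewrite desc0 /descended hd_upd upd_upd.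
    apply: hd; rewrite updB subrr subr0 nv_upd0.
    by rewrite -(ltr_pXn2r k0) ?nnegrE ?md_ge0 ?(ltW d0) // -mdX rootCK.
  - move=> z hz z0; have hvz : nv (upd v z) < s by exact: nv_upd_lt.
    have [|A hA] := descended_diff_off hvz; first by rewrite hd_upd.
    exists (A ord0 ord0) => e e0; have [d d0 hdd] := hA e e0; exists d => // z' hz'.
    have := hdd (upd v z'); rewrite updB subrr nv_upd0 => /(_ hz').
    by rewrite upd_mul mul0mx !mxE subr0 add0r mulrC.
  by exists c => z hz; rewrite -desc0; exact: hc.
have /choice[c hc] v : exists c, nv v < s -> forall z, md z < s / 8 ->
    md (descended (upd v z) - phi (upd v 0) - c * z) <= K * md z ^+ 2.
  have [/slice[c hc]|hn] := pselect (nv v < s); first by exists c.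
  by exists 0.
have yE : upd y 0 = y by rewrite -{2}(upd_id y) y0.
have [A hA] := phi_diff yr.
(* c v is the derivative at 0 of z |-> descended (upd v z). *)
have c_cont : forall e : R, 0 < e -> exists2 d : R, 0 < d &
    forall y', nv (y' - y) < d -> md (c y' - c y) <= e.
  move=> e e0.
  (* At the one point z = t, every slice quotient is within K t of its derivative c, and 2 K t is at
     most e / 2. The other half of e pays for the continuity in y' of phi at the two points entering
     the quotient. *)
  pose t := Num.min (s / 16) (e / (4 * (K + 1))).
  have t0 : 0 < t by rewrite lt_min !divr_gt0 // mulr_gt0 // ltr_wpDl.
  have ts : t < s / 8.
    by apply: (@le_lt_trans _ _ (s / 16)); [rewrite ge_min lexx|lra].
  have tK : 2 * (K * t) <= e / 2.
    have : t <= e / (4 * (K + 1)) by rewrite ge_min lexx orbT.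
    rewrite ler_pdivlMr; last by rewrite mulr_gt0 // ltr_wpDl.
    by move=> ?; lra.
  pose z := (t%:C)%C : C.
  have mz : md z = t by rewrite md_real gtr0_norm.
  have z0 : z != 0 by rewrite -md_gt0 mz.
  have zs : md z < s by rewrite mz; lra.
  have hyz : nv (upd y (rt z)) < r by apply: nv_upd_lt => //; exact: rts.
  have [A1 /frechet1_cont hA1] := phi_diff hyz.
  have e1 : 0 < e * t / 4 by rewrite divr_gt0 // mulr_gt0.
  have [d1 d10 hd1] := hA1 _ e1; have [d2 d20 hd2] := frechet1_cont hA e1.
  exists (Num.min (s - nv y) (Num.min d1 d2)) => [|y'].
    by rewrite !lt_min subr_gt0 hy d10.
  rewrite !lt_min => /and3P[h1 h2 h3].
  have hy' : nv y' < s by have := sub_nv_le y' y; lra.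
  have g1 := hc y' hy' z; have g2 := hc y hy z.
  rewrite mz in g1 g2; move: (g1 ts) (g2 ts) => {}g1 {}g2.
  have g3 := hd1 (upd y' (rt z)) (le_lt_trans (nv_upd_same _ _ _) h2).
  have hv : nv (upd y' 0 - y) < d2.
    by rewrite -[y]yE; exact: le_lt_trans (nv_upd_same _ _ _) h3.
  have g4 := hd2 _ hv.
  rewrite /descended !hd_upd !upd_upd in g1 g2.
  rewrite -(ler_pM2r t0) -{1}mz -mdM mulrBl.
  have -> : c y' * z - c y * z =
    (phi (upd y (rt z)) - phi (upd y 0) - c y * z)
    - (phi (upd y' (rt z)) - phi (upd y' 0) - c y' * z)
    + ((phi (upd y' (rt z)) - phi (upd y (rt z))) - (phi (upd y' 0) - phi (upd y 0))) by ring.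
  rewrite yE in g2 *.
  rewrite (le_trans (mdD _ _)) // (le_trans (lerD (mdB _ _) (mdB _ _))) //.
  have : 2 * (K * t) * t <= e / 2 * t by rewrite ler_pM2r.
  rewrite expr2 in g1 g2; lra.
exists (upd_head A (c y)) => e e0.
have e4 : 0 < e / 4 by exact: divr_gt0.
have [d1 d10 hd1] := hA _ e4; have [d2 d20 hd2] := c_cont _ e4.
exists (Num.min (s - nv y) (Num.min d1 (Num.min d2 (Num.min (s / 8) (e / (4 * (K + 1))))))).
  by rewrite !lt_min subr_gt0 hy d10 d20 !divr_gt0 // mulr_gt0 // ltr_wpDl.
move=> y'; rewrite !lt_min => /and5P[h1 h2 h3 h4].
rewrite ltr_pdivlMr; last by rewrite mulr_gt0 // ltr_wpDl.
move=> h5.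
have hy' : nv y' < s by have := sub_nv_le y' y; lra.
set N := nv (y' - y) in h1 h2 h3 h4 h5 *.
have N0 : 0 <= N by exact: nv_ge0.
pose z := hd y'.
have hz : md z <= N by have := hd_le_nv (y' - y); rewrite !mxE y0 subr0.
have g1 := hc y' hy' z (le_lt_trans hz h4).
rewrite upd_id in g1.
have hv : nv (upd y' 0 - y) <= N by rewrite -{1}yE; exact: nv_upd_same.
have g2 := hd1 _ (le_lt_trans hv h2).
have g3 := hd2 _ h3.
have dy : descended y = phi y by rewrite -{1}yE desc0 yE.
rewrite dy mul_upd_head.
have E : ((upd y' 0 - y) *m A) ord0 ord0 = ((y' - y) *m A) ord0 ord0 - z * A ord0 ord0.
  rewrite -[y in LHS]yE updB subrr upd_mul !mxE y0 /z; ring.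
have -> : descended y' - phi y - (((y' - y) *m A) ord0 ord0
      + hd (y' - y) * (c y - A ord0 ord0)) =
   (descended y' - phi (upd y' 0) - c y' * z)
   + (phi (upd y' 0) - phi y - ((upd y' 0 - y) *m A) ord0 ord0) + (c y' - c y) * z.
  rewrite E [hd (y' - y)]mxE [hd (- y)]mxE y0 /z; ring.
rewrite (le_trans (mdD _ _)) // (le_trans (lerD (mdD _ _) (lexx _))) // mdM.
have k1 : K * md z ^+ 2 <= K * N * N.
  by rewrite expr2 -mulrA ler_wpM2l // ler_pM ?md_ge0.
have k2 : K * N * N <= e / 4 * N by apply: ler_wpM2r => //; lra.
have k3 : e / 4 * nv (upd y' 0 - y) <= e / 4 * N by rewrite ler_wpM2l // ltW.
have k4 : md (c y' - c y) * md z <= e / 4 * N by rewrite ler_pM ?md_ge0.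
have k5 : 0 <= e * N by rewrite mulr_ge0 // ltW.
lra.
Qed.

Lemma descended_diff y : nv y < s -> exists A, frechet1 descended y A.
Proof.
move=> hy; have [y0|y0] := eqVneq (hd y) 0.
  exact: descended_diff_on.
exact: descended_diff_off.
Qed.

End Scalar.
End Descent.

(** * Composition and inversion of germs *)

Section GermCalculus.
Variables (K : numFieldType) (n : nat).
Local Notation V := 'rV[K]_n.
Implicit Types (f g h l : V -> V).

Lemma germ_eq_sym f g : germ_eq f g -> germ_eq g f.
Proof. by apply: filterS => x ->. Qed.

Lemma germ_eq_trans f g h : germ_eq f g -> germ_eq g h -> germ_eq f h.
Proof. by move=> fg gh; near=> x; rewrite (near fg x) // (near gh x).
Unshelve. all: by end_near. Qed.

Lemma germ_eq_compl f g h : germ_eq f g -> germ_eq (h \o f) (h \o g).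
Proof. by apply: filterS => x /= ->. Qed.

Lemma holo_germ_cvg f : holo_germ f -> f @ (0 : V) --> (0 : V).
Proof.
move=> [f0 df]; have := nbhs_singleton df => /differentiable_continuous.
by rewrite /prop_for /continuous_at f0.
Qed.

Lemma germ_eq_compr f g h : holo_germ f -> germ_eq g h -> germ_eq (g \o f) (h \o f).
Proof. by move=> /holo_germ_cvg cf gh; exact: (cf _ gh). Qed.

Lemma holo_germ_comp f g : holo_germ f -> holo_germ g -> holo_germ (g \o f).
Proof.
move=> hf hg; split; first by rewrite /= hf.1 hg.1.
have h : \forall x \near (0 : V), differentiable g (f x).
  exact: (holo_germ_cvg hf) hg.2.
near=> x; apply: differentiable_comp; first by near: x; exact: hf.2.
by near: x.
Unshelve. all: by end_near. Qed.

Lemma germ_inverse_sym f g : germ_inverse f g -> germ_inverse g f.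
Proof. by case. Qed.

Lemma germ_inverse_comp f f' g g' : germ_inverse f f' -> germ_inverse g g' ->
  germ_inverse (g \o f) (f' \o g').
Proof.
move=> [hf hf' f'f ff'] [hg hg' g'g gg']; split; try exact: holo_germ_comp.
- have := germ_eq_compl f' (germ_eq_compr hf g'g).
  by move=> /germ_eq_trans; apply.
- have := germ_eq_compl g (germ_eq_compr hg' ff').
  by move=> /germ_eq_trans; apply.
Qed.

Lemma biholo_germ_comp f g : biholo_germ f -> biholo_germ g -> biholo_germ (g \o f).
Proof.
by move=> [f' hf] [g' hg]; exists (f' \o g'); exact: germ_inverse_comp.
Qed.

Lemma holo_germ_mulmxr (A : 'M[K]_n) : holo_germ (mulmxr A : V -> V).
Proof.
split; first by rewrite /= mul0mx.
by near=> x; apply: linear_differentiable; exact: mulmxr_continuous.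
Unshelve. all: by end_near. Qed.

Lemma germ_inverse_mulmxr (A : 'M[K]_n) : A \in unitmx ->
  germ_inverse (mulmxr A : V -> V) (mulmxr (invmx A)).
Proof.
move=> uA; split; try exact: holo_germ_mulmxr.
- by near=> x; rewrite /= mulmxK.
- by near=> x; rewrite /= mulmxKV.
Unshelve. all: by end_near. Qed.

End GermCalculus.

(** * Factorisation through the standard fold *)

Section Fold.
Variables (R : realType) (m : nat).
Local Notation C := R[i].
Local Notation V := 'rV[C]_m.+1.
Local Notation co x := (x ord0 ord0).
Implicit Types (x y v w z : V) (f g h l : V -> V).

Lemma crd0 (K : numFieldType) (x : 'rV[K]_m.+1) : crd x 0 = co x.
Proof. by rewrite /crd; case: insubP => [i _ i0|//] /=; congr (x _ _); exact: val_inj. Qed.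

Lemma std_foldE k x : std_fold k x = upd x (co x ^+ k).
Proof.
rewrite /std_fold crd0; apply/rowP => i; rewrite !mxE.
by case: i => [[|i] hi] //=; rewrite nth_default.
Qed.

Lemma vcont_comp f g x : vcont f x -> vcont g (f x) -> vcont (g \o f) x.
Proof.
move=> hf hg e /hg[d d0 hd]; have [d' d0' hd'] := hf _ d0.
by exists d' => // w /hd' /hd.
Qed.

Lemma vcont_unique f g x : vcont f x -> vcont g x ->
  (forall e : R, 0 < e -> exists2 w, nv (w - x) < e & f w = g w) -> f x = g x.
Proof.
move=> hf hg h; apply/eqP; rewrite -subr_eq0 -nv_eq0 eq_le nv_ge0 andbT.
apply/ler_addgt0Pr => e e0; rewrite add0r.
have e20 : 0 < e / 2 by exact: divr_gt0.
have [d d0 hd] := hf _ e20; have [d' d0' hd'] := hg _ e20.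
have [|w] := h (Num.min d d'); first by rewrite lt_min d0.
rewrite lt_min => /andP[/hd h1 /hd' h2] fg.
have -> : f x - g x = (g w - g x) - (f w - f x) by rewrite fg; apply/rowP => i; rewrite !mxE; ring.
by apply: le_trans (nvB _ _) _; lra.
Qed.

Lemma cdiffX k (z : C) : exists c, cdiff (fun w : C => w ^+ k) z c.
Proof.
pose Q (w : C) := \sum_(i < k) w ^+ (k.-1 - i) * z ^+ i.
exists (Q z) => e e0.
have [|d d0 hd] := (_ : ccont Q z) e e0.
  by apply: ccont_sum => i; apply: ccontM; [exact: ccontX|exact: ccont_cst].
exists d => // w /hd h.
have -> : w ^+ k - z ^+ k = (w - z) * Q w.
  case: (k) @Q {hd} h => [|k'] Q h; last by rewrite subrXX.
  by rewrite !expr0 subrr /Q big_ord0 mulr0.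
rewrite mulrC -mulrBl mdM ler_wpM2r ?md_ge0 // ltW //.
Qed.

Lemma std_fold_diff k x : exists A, frechet (std_fold k) x A.
Proof.
apply: frechet_from_coord => j; have [->|j0] := eqVneq j ord0.
  have [c hc] := cdiffX k (co x).
  exists (upd_head 0 c) => e e0; have [d d0 hd] := hc e e0; exists d => // w hw.
  have hl := hd_le_nv (w - x).
  have wx : (w - x) ord0 ord0 = co w - co x by rewrite !mxE.
  have -> : ((w - x) *m upd_head 0 c) ord0 ord0 = c * (co w - co x).
    by rewrite mul_upd_head mulmx0 wx !mxE; ring.
  rewrite wx in hl; rewrite !std_foldE !hd_upd.
  apply: le_trans (hd _ (le_lt_trans hl hw)) _.
  by rewrite ler_wpM2l // ltW.
exists (delta_mx j ord0) => e e0; exists 1 => // w _.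
rewrite !std_foldE -colE !mxE (negbTE j0) subrr md0 mulr_ge0 ?nv_ge0 // ltW //.
Qed.

Lemma std_fold_holo k : (0 < k)%N -> holo_germ (std_fold k : V -> V).
Proof.
move=> k0; apply/holo_germE; split.
  by rewrite std_foldE mxE expr0n eqn0Ngt k0 upd00.
by exists 1 => // x _; exact: std_fold_diff.
Qed.

Definition rot_head (c : C) x : V := upd x (c * co x).

Lemma prim_root_md k (c : C) : k.-primitive_root c -> md c = 1.
Proof.
move=> hc; apply/eqP; rewrite -(@pexpr_eq1 _ _ k) ?md_ge0 ?(prim_order_gt0 hc) //.
by rewrite -mdX (prim_expr_order hc) md1.
Qed.

Lemma prim_root_power k (c u v : C) : k.-primitive_root c -> u ^+ k = v ^+ k ->
  exists2 i, (i < k)%N & u = c ^+ i * v.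
Proof.
move=> hc huv; have k0 := prim_order_gt0 hc.
have [v0|v0] := eqVneq v 0.
  exists 0%N => //; move: huv; rewrite v0 mulr0 expr0n eqn0Ngt k0 /= => /eqP.
  by rewrite expf_eq0 k0 /= => /eqP.
have [|i hi] := prim_rootP hc (x := u / v); last first.
  by exists i => //; rewrite -hi divfK.
by rewrite expr_div_n huv divff // expf_neq0.
Qed.

Lemma rot_invariant_power k c f (r : R) x i : k.-primitive_root c ->
  (forall x, nv x < r -> f (rot_head c x) = f x) -> nv x < r ->
  nv (upd x (c ^+ i * co x)) < r /\ f (upd x (c ^+ i * co x)) = f x.
Proof.
move=> hc hf hx; elim: i => [|i [IHr IH]]; first by rewrite expr0 mul1r upd_id.
split.
  apply: nv_upd_lt => //; rewrite mdM mdX (prim_root_md hc) expr1n mul1r.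
  exact: le_lt_trans (hd_le_nv x) hx.
by have := hf _ IHr; rewrite /rot_head hd_upd upd_upd mulrA -exprS IH.
Qed.

Lemma rot_vcont c x : md c = 1 -> vcont (rot_head c) x.
Proof.
move=> c1 e e0; exists e => // w; apply: le_lt_trans.
rewrite /rot_head updB; apply: nv_upd_le => //.
by rewrite -mulrBr mdM c1 mul1r; have := hd_le_nv (w - x); rewrite !mxE.
Qed.

Lemma nv_rot_lt c x (r : R) : md c = 1 -> nv x < r -> nv (rot_head c x) < r.
Proof.
move=> c1 hx; apply: nv_upd_lt => //; rewrite mdM c1 mul1r.
exact: le_lt_trans (hd_le_nv x) hx.
Qed.

Lemma holo_germ_small f : holo_germ f -> forall e : R, 0 < e ->
  exists2 d : R, 0 < d & forall x, nv x < d -> nv (f x) < e.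
Proof.
move=> /holo_germE[f0 [r r0 h]] e e0.
have [|A /frechet_vcont hA] := h 0; first by rewrite nv0.
by have [d d0 hd] := hA e e0; exists d => // x hx; have := hd x; rewrite f0 !subr0; exact.
Qed.

(** Points of one fibre of the fold differ by a power of the primitive root c, so invariance under
    one rotation gives independence of the chosen root. Each coordinate then descends, with the
    bound 1 near 0. *)
Lemma fold_descent k c f (r0 : R) : k.-primitive_root c -> holo_germ f -> 0 < r0 ->
  (forall x, nv x < r0 -> f (rot_head c x) = f x) ->
  exists2 g, holo_germ g & germ_eq f (g \o std_fold k).
Proof.
move=> hc hf r00 hinv; have k0 := prim_order_gt0 hc.
have [d d0 hd] := holo_germ_small hf (@ltr01 R).
have /holo_germE[f0 [r1 r10 hdf]] := hf.
pose r := Num.min r0 (Num.min d r1).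
have rp : 0 < r by rewrite !lt_min r00 d0.
have hr x : nv x < r -> [/\ nv x < r0, nv x < d & nv x < r1].
  by rewrite !lt_min => /and3P[].
have inv x (u : C) : nv x < r -> u ^+ k = co x ^+ k -> f (upd x u) = f x.
  move=> /hr[hx _ _] hu; have [i ik ->] := prim_root_power hc hu.
  by have [_ ->] := rot_invariant_power i hc hinv hx.
pose g y := f (upd y (k.-root (co y))).
have g0 : g 0 = 0.
  rewrite /g mxE; have -> : k.-root 0 = 0 :> C by apply/eqP; rewrite rootC_eq0.
  by rewrite upd00.
exists g.
  apply/holo_germE; split => //.
  exists (Num.min r (r ^+ k)) => [|y hy]; first exact: descent_radius_gt0.
  apply: frechet_from_coord => j.
  apply: (@descended_diff _ _ k k0 (fun x => f x ord0 j) r 1) => //.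
  - move=> x /hr[_ _ hx]; have [A hA] := hdf x hx.
    by exists (col j A); exact: frechet_coord.
  - move=> x /hr[_ hx _]; apply: le_trans (coord_le_nv _ _) _.
    by apply: ltW; exact: hd.
  - by move=> x u hx hu; rewrite inv.
apply/germ_eqE; exists r => // x hx.
by rewrite /g /= std_foldE hd_upd upd_upd inv // rootCK.
Qed.

(* std_fold k is open at 0, so it can be cancelled on the right *)
Lemma std_fold_epi k f : (0 < k)%N -> germ_eq (f \o std_fold k) (std_fold k : V -> V) ->
  germ_eq f id.
Proof.
move=> k0 /germ_eqE[r r0 h]; apply/germ_eqE.
exists (Num.min r (r ^+ k)) => [|y]; first by rewrite lt_min r0 exprn_gt0.
rewrite lt_min => /andP[h1 h2].
have := h (upd y (k.-root (co y))).
rewrite /= std_foldE hd_upd upd_upd rootCK // upd_id; apply.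
apply: nv_upd_lt => //; rewrite -(ltr_pXn2r k0) ?nnegrE ?md_ge0 ?(ltW r0) //.
by rewrite -mdX rootCK // (le_lt_trans (hd_le_nv y)).
Qed.

Section Lift.
Variables (k : nat) (c : C) (g h : V -> V).
Hypotheses (k2 : (2 <= k)%N) (hc : k.-primitive_root c) (gh : germ_inverse g h).
Local Notation F := (std_fold k : V -> V).

Lemma std_fold_rot_inverse :
  germ_eq (F \o g \o rot_head c) (F \o g) ->
  exists2 r : R, 0 < r & forall z, nv z < r -> F (h (rot_head c z)) = F (h z).
Proof.
have k0 : (0 < k)%N by apply: leq_trans k2.
have c1 := prim_root_md hc.
move: gh => [hg hh /germ_eqE[ra ra0 hgK] /germ_eqE[rb rb0 ghK]].
move=> /germ_eqE[rc rc0 hinv].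
have /holo_germE[g0 [rd rd0 hdg]] := hg; have /holo_germE[h0 [re re0 hdh]] := hh.
pose r1 := Num.min ra (Num.min rc rd).
have r1p : 0 < r1 by rewrite !lt_min ra0 rc0.
have hr1 x : nv x < r1 -> [/\ nv x < ra, nv x < rc & nv x < rd].
  by rewrite !lt_min => /and3P[].
have [d d0 hd] := holo_germ_small hh r1p.
pose r3 := Num.min d (Num.min rb re).
have r3p : 0 < r3 by rewrite !lt_min d0 rb0.
have hr3 x : nv x < r3 -> [/\ nv x < d, nv x < rb & nv x < re].
  by rewrite !lt_min => /and3P[].
have inv x : nv x < r1 -> F (g (rot_head c x)) = F (g x).
  by move=> /hr1[_ hx _]; exact: hinv.
have generic z : nv z < r3 -> co (h z) != 0 -> F (h (rot_head c z)) = F (h z).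
  move=> hz x0; have [zd zb ze] := hr3 z hz; set x := h z in x0 *.
  have xr1 : nv x < r1 by exact: hd.
  have gx : g x = z by exact: ghK.
  pose xs i := upd x (c ^+ i * co x).
  have hxs i : nv (xs i) < r1 /\ F (g (xs i)) = F z.
    by rewrite -gx; exact: (rot_invariant_power i hc inv xr1).
  have gxs_inj i j : g (xs i) = g (xs j) -> c ^+ i = c ^+ j.
    move=> /(congr1 h); have [hi _ _] := hr1 _ (hxs i).1.
    have [hj _ _] := hr1 _ (hxs j).1.
    have := hgK _ hi; have := hgK _ hj; rewrite /= => -> ->.
    by move=> /(congr1 (fun v : V => co v)); rewrite !hd_upd => /(mulIf x0).
  have gxsE i : exists u, g (xs i) = upd z u /\ u ^+ k = co z ^+ k.
    have := (hxs i).2; rewrite !std_foldE => hF.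
    exists (co (g (xs i))); split.
      apply/rowP => j; have := congr1 (fun v : V => v ord0 j) hF.
      by rewrite !mxE; case: eqP => // ->.
    by have := congr1 (fun v : V => co v) hF; rewrite !hd_upd.
  (* Otherwise the fibre through z would be a single point, while the first two orbit points have
     distinct images. *)
  have z0 : co z != 0.
    apply/eqP => z0.
    have gz i : g (xs i) = upd z 0.
      have [u [-> ]] := gxsE i; rewrite z0 expr0n eqn0Ngt k0 /= => /eqP.
      by rewrite expf_eq0 k0 /= => /eqP ->.
    have /eqP := gxs_inj 0%N 1%N (etrans (gz _) (esym (gz _))).
    by rewrite (eq_prim_root_expr hc) !modn_small.
  have /choice[s hs] (i : 'I_k) : exists j : 'I_k, g (xs i) = upd z (c ^+ j * co z).
    have [u [-> hu]] := gxsE i; have [j jk ->] := prim_root_power hc hu.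
    by exists (Ordinal jk).
  have s_inj : injective s.
    move=> i j sij; apply/val_inj.
    have /gxs_inj/eqP : g (xs i) = g (xs j) by rewrite !hs sij.
    by rewrite (eq_prim_root_expr hc) !modn_small // => /eqP.
  (* The index 1 stands for the rotated point c z; an injective self-map of a finite set reaches
     it. *)
  have [i si] : exists i, s i = Ordinal k2.
    by exists (invF s_inj (Ordinal k2)); rewrite f_invF.
  have -> : rot_head c z = g (xs i) by rewrite hs si expr1.
  have [hi _ _] := hr1 _ (hxs i).1; have := hgK _ hi; rewrite /= => ->.
  rewrite !std_foldE hd_upd upd_upd exprMn exprAC (prim_expr_order hc) expr1n mul1r //.
exists r3 => // z hz; have [z0|] := eqVneq (co (h z)) 0; last exact: generic.
have [zd zb ze] := hr3 z hz; set x := h z in z0 *.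
have xr1 : nv x < r1 by exact: hd.
have [_ _ xd] := hr1 _ xr1.
have gx : g x = z by exact: ghK.
have [A /frechet_vcont contg] := hdg x xd.
have [A' /frechet_vcont conth] : exists A, frechet h (rot_head c z) A.
  by apply: hdh; have [] := hr3 _ (nv_rot_lt c1 hz).
have Fcont w : vcont F w by have [B /frechet_vcont] := std_fold_diff k w.
(* Precomposing with g allows the approximating points to be taken near x, with first coordinate a
   small nonzero u, where the generic case applies. *)
suff : (F \o h \o rot_head c \o g) x = F x by rewrite /= gx.
apply: vcont_unique => //.
  apply: vcont_comp => //; rewrite gx; apply: vcont_comp; first exact: rot_vcont.
  exact: vcont_comp.
move=> e e0.
have [|d1 d10 hd1] := contg (r3 - nv z); first by rewrite subr_gt0.
pose t := Num.min (e / 2) (Num.min (d1 / 2) ((r1 - nv x) / 2)).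
have t0 : 0 < t by rewrite !lt_min !divr_gt0 // subr_gt0.
have [t1 t2 t3] : [/\ t <= e / 2, t <= d1 / 2 & t <= (r1 - nv x) / 2].
  by have := lexx t; rewrite {2}/t !le_min => /and3P.
pose u := (t%:C)%C : C; have mu : md u = t by rewrite md_real gtr0_norm.
have u0 : u != 0 by rewrite -md_gt0 mu.
have dx : nv (upd x u - x) = t.
  by rewrite -[X in _ - X]upd_id updB subrr z0 subr0 nv_upd0.
exists (upd x u); first by rewrite dx; lra.
have hxu : nv (upd x u) < r1.
  by have := sub_nv_le (upd x u) x; rewrite dx; lra.
have [xua _ _] := hr1 _ hxu.
have hgu : h (g (upd x u)) = upd x u by exact: hgK.
rewrite /= generic ?hgu //; last by rewrite hd_upd.
have := hd1 (upd x u); rewrite dx gx => h1.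
have := sub_nv_le (g (upd x u)) z; have : t < d1 by lra.
by move=> /h1; lra.
Qed.

Lemma fold_lift : germ_eq (F \o g \o rot_head c) (F \o g) ->
  exists2 l, biholo_germ l & germ_eq (F \o g) (l \o F).
Proof.
move=> hinv; have k0 : (0 < k)%N by apply: leq_trans k2.
have [hg hh hgK ghK] := gh; have hF := @std_fold_holo k k0.
have [r r0 hr] := std_fold_rot_inverse hinv.
have /germ_eqE[r' r0' hr'] := hinv.
have [l hl El] := fold_descent hc (holo_germ_comp hg hF) r0' hr'.
have [l' hl' El'] := fold_descent hc (holo_germ_comp hh hF) r0 hr.
exists l => //; exists l'; split => //.
- apply: (@std_fold_epi k) => //.
  have e1 := germ_eq_compl l' (germ_eq_sym El).
  have e2 := germ_eq_compr hg (germ_eq_sym El').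
  have e3 := germ_eq_compl F hgK.
  exact: germ_eq_trans e1 (germ_eq_trans e2 e3).
- apply: (@std_fold_epi k) => //.
  have e1 := germ_eq_compl l (germ_eq_sym El').
  have e2 := germ_eq_compr hh (germ_eq_sym El).
  have e3 := germ_eq_compl F ghK.
  exact: germ_eq_trans e1 (germ_eq_trans e2 e3).
Qed.

End Lift.

(** With p = l o F o h', apply [fold_lift] to h' composed with the inverse of T: invariance of p
    under M becomes invariance under the rotation, because T conjugates M into it. Solving for F o T
    leaves p followed by the inverses of l and of the lifted factor. *)
Lemma fold_linear_normal_form k c p (M T : 'M[C]_m.+1) : is_fold k p ->
  k.-primitive_root c -> T \in unitmx ->
  (forall x, (x *m M) *m T = rot_head c (x *m T)) ->
  germ_eq (p \o mulmxr M) p ->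
  exists2 l, biholo_germ l & germ_eq (fun x => std_fold k (x *m T)) (l \o p).
Proof.
move=> [k2 [l [h [h' [[l' ll'] hh' hp]]]]] hc uT hMT hpM.
have [hl hl' l'l _] := ll'.
have k0 : (0 < k)%N by apply: leq_trans k2.
have iT := germ_inverse_sym (germ_inverse_mulmxr uT).
have hF := @std_fold_holo k k0; have hh'' := germ_inverse_sym hh'.
have gi := germ_inverse_comp iT hh''.
have [hT' hT _ _] := iT; have [hh _ _ _] := hh''.
have Fh' : germ_eq (std_fold k \o h') (l' \o p).
  have e1 := germ_eq_compl l' hp.
  have e2 := germ_eq_compr (holo_germ_comp hh hF) l'l.
  exact: germ_eq_sym (germ_eq_trans e1 e2).
have rotE : mulmxr (invmx T) \o rot_head c = mulmxr M \o mulmxr (invmx T) :> (V -> V).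
  apply/funext => x /=; apply: (canLR (mulmxK uT)).
  by rewrite hMT mulmxKV.
have [|L bL EL] := fold_lift k2 hc gi.
  rewrite -[X in germ_eq X _]/((std_fold k \o h') \o (mulmxr (invmx T) \o rot_head c)) rotE.
  have hMT' := holo_germ_comp hT' (holo_germ_mulmxr M).
  apply: germ_eq_trans (germ_eq_compr hMT' Fh') _.
  apply: germ_eq_trans (germ_eq_sym (germ_eq_compr hT' Fh')).
  exact: germ_eq_compr hT' (germ_eq_compl l' hpM).
have [L' LL'] := bL; have [_ hL' L'L _] := LL'.
exists (L' \o l').
  apply: biholo_germ_comp; last by exists L; exact: germ_inverse_sym.
  by exists l; exact: germ_inverse_sym.
have TK : mulmxr (invmx T) \o mulmxr T = id :> (V -> V).
  by apply/funext => x /=; rewrite mulmxK.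
have e1 := germ_eq_compr (holo_germ_comp hT hF) L'L.
have e2 := germ_eq_compl L' (germ_eq_compr hT EL).
apply: germ_eq_trans (germ_eq_sym e1) _.
apply: germ_eq_trans (germ_eq_sym e2) _.
rewrite -[X in germ_eq X _]/(L' \o (std_fold k \o h') \o (mulmxr (invmx T) \o mulmxr T)) TK.
exact: germ_eq_compl L' Fh'.
Qed.


End Fold.

(** * Linear reflections and adapted coordinates *)

Section TangentGeneric.
Variables (K : numFieldType) (n : nat).
Local Notation V := 'rV[K]_n.

Lemma is_derive_approx (y : K^o -> V) (v : V) : is_derive (0 : K^o) (1 : K^o) y v ->
  forall e : K, 0 < e -> exists2 d : K, 0 < d & forall t : K, `|t| < d ->
    `|y t - y 0 - t *: v| <= e * `|t|.
Proof.
move=> [dy <-] e e0; have /derivable_nbhsP/eqaddoP/(_ e e0) := dy.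
move=> /near_norm[d d0 hd]; exists d => // t ht.
have := hd t; rewrite subr0 => /(_ ht).
rewrite -[X in `|X| <= _ -> _]/(y (t *: (1 : K^o) + 0) - (y 0 + t *: derive y 0 1)).
by rewrite addr0 opprD addrA [t *: _]mulr1.
Qed.

Lemma tangent_approx (S : set V) v : tangent S v -> exists y : K -> V,
  [/\ y 0 = 0,
      exists2 d : K, 0 < d & forall t : K, `|t| < d -> S (y t)
    & forall e : K, 0 < e -> exists2 d : K, 0 < d & forall t : K, `|t| < d ->
        `|y t - t *: v| <= e * `|t|].
Proof.
move=> [y [y0 _ /near_norm[d d0 hS] hd]]; exists y; split => //.
  by exists d => // t ht; apply: hS; rewrite subr0.
by move=> e e0; have [d' d0' h] := is_derive_approx hd e0; exists d' => // t /h; rewrite y0 subr0.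
Qed.

Lemma submanifold_germE (S : set V) c : submanifold_germ c S -> exists h g : V -> V,
  germ_inverse h g /\ exists2 d : K, 0 < d & forall x, `|x| < d ->
      (S x <-> forall i : 'I_n, (i < c)%N -> h x ord0 i = 0).
Proof.
move=> [_ [h [g hg] /near_norm[d d0 hS]]]; exists h, g; split => //.
by exists d => // x hx; apply: hS; rewrite subr0.
Qed.

End TangentGeneric.

Section Reflection.
Variables (R : realType) (m : nat).
Local Notation C := R[i].
Local Notation V := 'rV[C]_m.+1.
Implicit Types (x v w : V).

(** The expression is homogeneous in t, so being o(t) along positive reals forces it to vanish. *)
Lemma mulmx_small n (B : 'M[C]_(m.+1, n)) v :
  (forall e : R, 0 < e -> exists2 d : R, 0 < d & forall t : R, 0 < t < d ->
     nv ((((t%:C)%C) *: v) *m B) <= e * t) -> v *m B = 0.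
Proof.
move=> h; apply/eqP; rewrite -nv_eq0 eq_le nv_ge0 andbT.
apply/ler_addgt0Pr => e e0; rewrite add0r.
have [d d0 hd] := h e e0; have d20 : 0 < d / 2 by exact: divr_gt0.
have := hd (d / 2); rewrite d20 ltr_pdivrMr // ltr_pMr // ltr1n => /(_ isT).
by rewrite -scalemxAl nvZ md_real gtr0_norm // mulrC ler_pM2r.
Qed.

Lemma frechet_at0 (f : V -> V) : holo_germ f ->
  exists A : 'M[C]_m.+1, forall e : R, 0 < e -> exists2 d : R, 0 < d &
    forall w, nv w < d -> nv (f w - w *m A) <= e * nv w.
Proof.
move=> /holo_germE[f0 [r r0 h]]; have [|A hA] := h 0; first by rewrite nv0.
exists A => e /hA[d d0 hd]; exists d => // w hw.
by have := hd w; rewrite f0 !subr0; exact.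
Qed.

(** The chain rule for h (g w) = w makes w - w G H both linear and o(w), hence zero. *)
Lemma germ_inverse_derivative (h g : V -> V) : germ_inverse h g ->
  exists2 G : 'M[C]_m.+1, G \in unitmx & forall e : R, 0 < e -> exists2 d : R, 0 < d &
    forall w, nv w < d -> nv (g w - w *m G) <= e * nv w.
Proof.
move=> [hh hg _ /germ_eqE[r r0 hgK]].
have [H hH] := frechet_at0 hh; have [G hG] := frechet_at0 hg.
exists G => //.
suff GH : G *m H = 1%:M by have [] := mulmx1_unit GH.
apply/row_matrixP => i; rewrite !rowE.
set v := delta_mx _ _; apply/eqP; rewrite -subr_eq0 -opprB oppr_eq0 mulmx1.
suff : v *m (1%:M - G *m H) = 0 by rewrite mulmxBr mulmx1 => ->.
apply: mulmx_small => e e0.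
have [KG KG0 hKG] := mulmx_bound G; have [KH KH0 hKH] := mulmx_bound H.
have q0 : 0 < nv v + 1 by rewrite ltr_wpDl ?nv_ge0.
pose k := e / ((KG + 1 + KH) * (nv v + 1)).
have Q0 : 0 < (KG + 1 + KH) * (nv v + 1) by rewrite mulr_gt0 // !addr_gt0.
have k0 : 0 < k by exact: divr_gt0.
have [d1 d10 hd1] := hH _ k0; have [d2 d20 hd2] := hG _ k0.
have [d2' d20' hd2'] := hG _ ltr01.
have [d3 d30 hd3] := holo_germ_small hg d10.
pose d := Num.min r (Num.min d2 (Num.min d2' d3)).
have d0 : 0 < d by rewrite !lt_min r0 d20 d20'.
exists (d / (nv v + 1)) => [|t /andP[t0]]; first exact: divr_gt0.
rewrite ltr_pdivlMr // => ht.
set w := _ *: v.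
have wE : nv w = t * nv v by rewrite nvZ md_real gtr0_norm.
have hw : nv w < d by rewrite wE; lra.
move: hw; rewrite !lt_min => /and4P[w1 w2 w3 w4].
have e1 := hd1 _ (hd3 _ w4); have e2 := hd2 _ w2; have e3 := hd2' _ w3.
have hgw : h (g w) = w by exact: hgK.
rewrite hgw in e1.
have -> : w *m (1%:M - G *m H) = (w - g w *m H) + (g w - w *m G) *m H.
  by rewrite mulmxBr mulmx1 mulmxBl mulmxA addrA subrK.
have gw : nv (g w) <= (KG + 1) * nv w.
  rewrite -[g w](subrK (w *m G)) (le_trans (nvD _ _)) //.
  by have := hKG w; lra.
apply: le_trans (nvD _ _) _.
have e4 := hKH (g w - w *m G).
have e5 : KH * nv (g w - w *m G) <= KH * (k * nv w) by rewrite ler_pM2l.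
have e6 : k * nv (g w) <= k * ((KG + 1) * nv w) by rewrite ler_pM2l.
have e7 : e * t = k * ((KG + 1 + KH) * (nv v + 1)) * t.
  by rewrite /k divfK // gt_eqF.
have e8 : k * ((KG + 1 + KH) * (nv v + 1)) * t = (k * (KG + 1 + KH)) * nv w + k * (KG + 1 + KH) * t.
  by rewrite wE; ring.
have Z0 : 0 < KG + 1 + KH by rewrite addr_gt0 // addr_gt0.
have e9 : 0 <= k * (KG + 1 + KH) * t by rewrite ltW // mulr_gt0 // mulr_gt0.
lra.
Qed.

(* Along the tangent hyperplane of Fix a, a - 1 vanishes, hence has rank one. *)
Lemma reflection_rank_one (a : {linear V -> V}) : submanifold_germ 1 (Fix a) ->
  exists (phi : 'cV[C]_m.+1) (u : V), lin1_mx a = 1%:M + phi *m u.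
Proof.
move=> /submanifold_germE[h [g [hg [d /real_of_pos[r r0 ->] hFix]]]].
have [G uG hG] := germ_inverse_derivative hg.
have [hh hgg _ /germ_eqE[rb rb0 ghK]] := hg.
set A := lin1_mx a.
have aE x : a x = x *m A by rewrite mul_rV_lin1.
have [K K0 hK] := mulmx_bound (A - 1%:M).
have key v : v ord0 ord0 = 0 -> v *m (G *m (A - 1%:M)) = 0.
  move=> v0; apply: mulmx_small => e e0.
  have q0 : 0 < K * (nv v + 1) by rewrite mulr_gt0 // ltr_wpDl ?nv_ge0.
  have k0 : 0 < e / (K * (nv v + 1)) by exact: divr_gt0.
  have [d1 d10 hd1] := hG _ k0; have [d2 d20 hd2] := holo_germ_small hgg r0.
  have p0 : 0 < nv v + 1 by rewrite ltr_wpDl ?nv_ge0.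
  pose D := Num.min d1 (Num.min d2 rb).
  have D0 : 0 < D by rewrite !lt_min d10 d20.
  exists (D / (nv v + 1)) => [|t /andP[t0]]; first exact: divr_gt0.
  rewrite ltr_pdivlMr // => ht.
  set w := _ *: v.
  have wE : nv w = t * nv v by rewrite nvZ md_real gtr0_norm.
  have hw : nv w < D by rewrite wE; lra.
  move: hw; rewrite !lt_min => /and3P[w1 w2 w3].
  have fixg : g w *m (A - 1%:M) = 0.
    have hgw : h (g w) = w by exact: ghK.
    have := hFix (g w); rewrite norm_ltE => /(_ (hd2 _ w2)) [_].
    rewrite hgw => hf; have : Fix a (g w).
      apply: hf => i i0; have -> : i = ord0.
        by apply/val_inj; move: i0; rewrite ltnS leqn0 => /eqP.
      by rewrite mxE v0 mulr0.
    by rewrite /Fix /= aE mulmxBr mulmx1 => ->; rewrite subrr.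
  have -> : w *m (G *m (A - 1%:M)) = - ((g w - w *m G) *m (A - 1%:M)).
    by rewrite mulmxBl fixg sub0r opprK mulmxA.
  rewrite nvN; apply: le_trans (hK _) _.
  apply: le_trans (ler_wpM2l (ltW K0) (hd1 _ w1)) _.
  have -> : K * (e / (K * (nv v + 1)) * nv w) = e * t * (nv v / (nv v + 1)).
    by rewrite wE; field; rewrite !gt_eqF.
  rewrite ler_piMr // ?mulr_ge0 ?(ltW e0) ?(ltW t0) //.
  by rewrite ler_pdivrMr // mul1r lerDl.
(* By [key] only the first row of G (A - 1) survives, so this matrix is the first unit column times
   that row. *)
exists (invmx G *m delta_mx ord0 ord0), (row ord0 (G *m (A - 1%:M))).
rewrite -mulmxA; set B := G *m _.
have -> : (delta_mx ord0 ord0 : 'cV[C]_m.+1) *m row ord0 B = B.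
  apply/row_matrixP => i; rewrite row_mul; have [->|i0] := eqVneq i ord0.
    rewrite [row ord0 (delta_mx _ _)](_ : _ = 1%:M) ?mul1mx //.
    by apply/rowP => j; rewrite !ord1 !mxE.
  rewrite [row i (delta_mx _ _)](_ : _ = 0) ?mul0mx; last first.
    by apply/rowP => j; rewrite !mxE (negbTE i0).
  by rewrite rowE key // !mxE [ord0 == i]eq_sym (negbTE i0).
by rewrite /B mulKmx // addrC subrK.
Qed.

Lemma rank_one_power (phi : 'cV[C]_m.+1) (u : V) (l : C) j x :
  u *m phi = (l - 1)%:M ->
  iter j (mulmxr (1%:M + phi *m u)) x = x + (\sum_(i < j) l ^+ i) *: (x *m phi *m u).
Proof.
move=> hu; elim: j => [|j IH]; first by rewrite /= big_ord0 scale0r addr0.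
set p := x *m phi *m u.
have hp : p *m (1%:M + phi *m u) = l *: p.
  rewrite mulmxDr mulmx1 /p mulmxA -(mulmxA (x *m phi)) hu mul_mx_scalar -scalemxAl.
  by rewrite -[X in X + _]scale1r -scalerDl addrC subrK.
rewrite iterS IH /= mulmxDl -scalemxAl hp mulmxDr mulmx1 mulmxA -/p.
rewrite big_ord_recl expr0 scalerDl scale1r addrA; congr (_ + _).
by rewrite scalerA mulr_suml; congr (_ *: _); apply: eq_bigr => i _; rewrite exprSr.
Qed.

(** An eigenvector for l is a multiple of u, which gives the pairing. Iterates add a geometric sum
    times phi u, so a^j is the identity germ exactly when l^j = 1; hence the order of a is that of
    l. *)
Lemma reflection_matrix (a : {linear V -> V}) k (l : C) :
  reflection a k -> eigenvalue_map a l -> l <> 1 ->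
  exists (phi : 'cV[C]_m.+1) (u : V),
    [/\ lin1_mx a = 1%:M + phi *m u, u *m phi = (l - 1)%:M & k.-primitive_root l].
Proof.
move=> [_ k2 [k0 ak nak] /reflection_rank_one[phi [u hA]]] /eigenvalueP[v].
rewrite hA mulmxDr mulmx1 => hv v0 /eqP l1.
have l10 : l - 1 != 0 by rewrite subr_eq0.
exists phi, u.
have e1 : v *m phi *m u = (l - 1) *: v.
  by rewrite scalerBl scale1r -hv addrC addKr mulmxA.
have vphi : v *m phi != 0.
  apply: contraNneq v0 => h; move: e1; rewrite h mul0mx => /esym/eqP.
  by rewrite scaler_eq0 (negbTE l10).
have hu : u *m phi = (l - 1)%:M.
  have : v *m phi *m (u *m phi) = (l - 1) *: (v *m phi) by rewrite mulmxA e1 -scalemxAl.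
  move: vphi; rewrite [v *m phi]mx11_scalar [u *m phi]mx11_scalar.
  set p := (v *m phi) _ _; set q := (u *m phi) _ _ => vphi.
  rewrite mul_scalar_mx !scale_scalar_mx => /(congr1 (fun B : 'M[C]_1 => B ord0 ord0)).
  rewrite !mxE !mulr1n mulrC => /mulIf -> //.
  by apply: contraNneq vphi => ->; rewrite raddf0.
have u0 : u != 0.
  apply: contraNneq l10 => u0; move: hu; rewrite u0 mul0mx.
  by move=> /(congr1 (fun B : 'M[C]_1 => B ord0 ord0)); rewrite !mxE mulr1n => <-.
have aE : (a : V -> V) = mulmxr (1%:M + phi *m u).
  by apply/funext => x /=; rewrite -hA mul_rV_lin1.
have it j x : iter j a x = x + (\sum_(i < j) l ^+ i) *: (x *m phi *m u).
  by rewrite aE (rank_one_power j x hu).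
have sumE j : l ^+ j - 1 = (l - 1) * \sum_(i < j) l ^+ i by exact: subrX1.
have id_iff j : germ_eq (iter j a) id <-> l ^+ j = 1.
  split=> [/germ_eqE[r r0 h]|lj].
    (* A germ identity can be tested only near 0, hence on a small multiple of u. *)
    have e0 : 0 < r / (nv u + 1) / 2 by rewrite !divr_gt0 // ltr_wpDl ?nv_ge0.
    set e := r / (nv u + 1) / 2 in e0.
    have eu : nv ((e%:C)%C *: u) < r.
      rewrite nvZ md_real gtr0_norm // /e.
      have p0 : 0 < nv u + 1 by rewrite ltr_wpDl ?nv_ge0.
      rewrite mulrAC ltr_pdivrMr // mulrAC ltr_pdivrMr //.
      have := nv_ge0 u; nra.
    have := h _ eu; rewrite it /= => /eqP; rewrite -subr_eq0 addrAC subrr add0r.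
    rewrite -!scalemxAl hu mul_scalar_mx !scalerA scaler_eq0 (negbTE u0) orbF.
    have en0 : (e%:C)%C != 0 :> C by rewrite -md_gt0 md_real gtr0_norm.
    rewrite !mulf_eq0 (negbTE l10) (negbTE en0) !orbF => /eqP s0.
    by apply/eqP; rewrite -subr_eq0 sumE s0 mulr0.
  apply/germ_eqE; exists 1 => // x _; rewrite it.
  have := sumE j; rewrite lj subrr => /esym/eqP; rewrite mulf_eq0 (negbTE l10) /= => /eqP ->.
  by rewrite scale0r addr0.
split => //.
have lk : l ^+ k = 1 by apply/id_iff.
have [j jl jk] := prim_order_exists k0 lk.
have [jk'|] := ltnP j k; last first.
  by move=> kj; have -> : k = j by apply/eqP; rewrite eqn_leq kj dvdn_leq.
have j0 := prim_order_gt0 jl.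
by case: (nak j); rewrite ?j0 //; apply/id_iff; exact: prim_expr_order.
Qed.

Lemma tangent_Fix (a : {linear V -> V}) (phi : 'cV[C]_m.+1) (u v : V) :
  lin1_mx a = 1%:M + phi *m u -> u != 0 -> tangent (Fix a) v -> v *m phi = 0.
Proof.
move=> hA u0 /tangent_approx[y [y0 [d /real_of_pos[r r0 ->] hF] hy]].
have yphi t : Fix a (y t) -> y t *m phi = 0.
  rewrite /Fix /= -[a _]mul_rV_lin1 hA mulmxDr mulmx1 => /eqP.
  rewrite -subr_eq0 addrAC subrr add0r mulmxA [_ *m phi]mx11_scalar mul_scalar_mx.
  by rewrite scaler_eq0 (negbTE u0) orbF => /eqP ->; rewrite raddf0.
have [K K0 hK] := mulmx_bound phi.
apply: mulmx_small => e e0.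
have ee : 0 < ((e / K)%:C)%C :> C by rewrite ltcR divr_gt0.
have [d' /real_of_pos[r' r0' ->] h] := hy _ ee.
exists (Num.min r r') => [|t /andP[t0]]; first by rewrite lt_min r0.
rewrite lt_min => /andP[tr tr'].
have tE : `|(t%:C)%C : C| = (t%:C)%C by rewrite mdE md_real gtr0_norm.
have := hF (t%:C)%C; rewrite tE ltcR => /(_ tr) /yphi yt.
have := h (t%:C)%C; rewrite tE ltcR => /(_ tr').
rewrite nvE -rmorphM lecR => h1.
rewrite -[_ *: v](subKr (y (t%:C)%C)) mulmxBl yt sub0r nvN.
apply: le_trans (hK _) _; apply: le_trans (ler_wpM2l (ltW K0) h1) _.
by rewrite mulrA [K * _]mulrC divfK // gt_eqF.
Qed.

End Reflection.

(** * Linear coordinates with prescribed functionals and vectors *)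

Section Frames.
Variables (K : fieldType) (m : nat).
Local Notation n := (2 + m)%N.
Implicit Types (Phi : 'M[K]_(n, 2)) (X : 'M[K]_n).

(** [E] extracts the first two coordinates, so [X *m E = Phi] makes the columns of [Phi] the first
    two coordinate functionals of the frame [X]. *)
Local Notation E := (col_mx 1%:M 0 : 'M[K]_(n, 2)).

Lemma mulmx_E p (A : 'M[K]_(p, n)) : A *m E = lsubmx A.
Proof. by rewrite -{1}(hsubmxK A) mul_row_col mulmx1 mulmx0 addr0. Qed.

Lemma unitmx_block_upper p q (B : 'M[K]_(p, q)) (D : 'M[K]_q) : D \in unitmx ->
  block_mx 1%:M B 0 D \in unitmx.
Proof. by move=> uD; rewrite unitmxE det_ublock det1 mul1r -unitmxE. Qed.

(** In the rank normal form of [Phi] the middle factor is [E]; the 2 x 2 right factor is moved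
    across it as a diagonal block. *)
Lemma extend_to_unitmx Phi : \rank Phi = 2 -> exists2 X, X \in unitmx & X *m E = Phi.
Proof.
move=> rPhi; exists (col_ebase Phi *m block_mx (row_ebase Phi) 0 0 1%:M).
  rewrite unitmx_mul col_ebase_unit unitmxE det_ublock det1 mulr1 -unitmxE.
  exact: row_ebase_unit.
rewrite -mulmxA mul_block_col !mulmx1 !mulmx0 !addr0 -[RHS]mulmx_ebase rPhi.
rewrite -mulmxA; congr (_ *m _).
have -> : pid_mx 2 = col_mx 1%:M 0 :> 'M[K]_(n, 2).
  apply/matrixP => i j; rewrite !mxE; case: splitP => i' ii'; rewrite !mxE ii'.
    by rewrite andbT.
  by rewrite andbF.
by rewrite mul_col_mx mul1mx mul0mx.
Qed.

(** The rows of U already have the required first two coordinates. A unipotent Y corrects the others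
    by adding a linear function of the first two, which exists since [lsubmx T] has a right inverse;
    vectors killed by [Phi] are unaffected. *)
Lemma frame_exists r Phi X0 (U T : 'M[K]_(r, n)) : X0 \in unitmx -> X0 *m E = Phi ->
  U *m Phi = lsubmx T -> row_free (lsubmx T) ->
  exists X, [/\ X \in unitmx, X *m E = Phi, U *m X = T
    & forall w : 'rV_n, w *m Phi = 0 -> w *m X = w *m X0].
Proof.
move=> uX0 hX0 hU /row_freeP[Z hZ].
pose U' := U *m X0.
have lU' : lsubmx U' = lsubmx T by rewrite -(mulmx_E U') /U' -mulmxA hX0.
pose Y : 'M[K]_n := block_mx 1%:M (Z *m (rsubmx T - rsubmx U')) 0 1%:M.
have EY : Y *m E = E by rewrite mul_block_col !mulmx1 !mulmx0 !addr0.
exists (X0 *m Y); split.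
- by rewrite unitmx_mul uX0 unitmx_block_upper // unitmx1.
- by rewrite -mulmxA EY.
- rewrite mulmxA -/U' -{1}(hsubmxK U') lU' mul_row_block mulmx1 mulmx0 addr0.
  by rewrite mulmx1 mulmxA hZ mul1mx subrK hsubmxK.
- move=> w hw; rewrite mulmxA; set w' := w *m X0.
  have lw : lsubmx w' = 0 by rewrite -(mulmx_E w') /w' -mulmxA hX0.
  by rewrite -(hsubmxK w') lw mul_row_block !mul0mx mulmx1 mulmx0 !add0r.
Qed.

Lemma unitmx_transitive q (a b : 'rV[K]_q) : a != 0 -> b != 0 ->
  exists2 Y, Y \in unitmx & a *m Y = b.
Proof.
have nf (v : 'rV[K]_q) : v != 0 -> exists s (Y : 'M[K]_q),
    [/\ s != 0, Y \in unitmx & v = s *: (pid_mx 1 *m Y)].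
  move=> v0; exists (col_ebase v ord0 ord0), (row_ebase v); split.
  - have := col_ebase_unit v; rewrite {1}[col_ebase v]mx11_scalar unitmxE det_scalar1.
    by rewrite unitfE.
  - exact: row_ebase_unit.
  - have := mulmx_ebase v; rewrite rank_rV v0 [col_ebase v]mx11_scalar mul_scalar_mx.
    by move=> h; rewrite mxE eqxx mulr1n scalemxAl; exact: (esym h).
move=> /nf[s [Y [s0 uY ->]]] /nf[t [Z [t0 uZ ->]]].
exists ((t / s) *: (invmx Y *m Z)).
  rewrite -mul_scalar_mx !unitmx_mul unitmx_inv uY uZ !andbT.
  by rewrite unitmxE det_scalar unitrX // unitfE mulf_neq0 // invr_eq0.
by rewrite -scalemxAr -scalemxAl -mulmxA mulKVmx // scalerA divfK.
Qed.

(** First v is moved to t' by an invertible map of the last m coordinates. Adjusting u by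
    [frame_exists] then leaves v in place, as v is killed by [Phi]. *)
Lemma frame_exists_skew Phi (u v t t' : 'rV[K]_n) :
  \rank Phi = 2 -> u *m Phi = lsubmx t -> lsubmx t != 0 ->
  v != 0 -> v *m Phi = 0 -> lsubmx t' = 0 -> t' != 0 ->
  exists X, [/\ X \in unitmx, X *m E = Phi, u *m X = t & v *m X = t'].
Proof.
move=> /extend_to_unitmx[X0 uX0 hX0] hu t0 v0 hv lt' t'0.
have lv : lsubmx (v *m X0) = 0 by rewrite -mulmx_E -mulmxA hX0.
have rv : rsubmx (v *m X0) != 0.
  apply: contraNneq v0 => h; rewrite -[v](mulmxK uX0) -(hsubmxK (v *m X0)) lv h.
  by rewrite row_mx0 mul0mx.
have rt' : rsubmx t' != 0.
  by apply: contraNneq t'0 => h; rewrite -(hsubmxK t') lt' h row_mx0.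
have [Y uY hY] := unitmx_transitive rv rt'.
pose X1 := X0 *m block_mx 1%:M 0 0 Y.
have uX1 : X1 \in unitmx by rewrite unitmx_mul uX0 unitmx_block_upper.
have hX1 : X1 *m E = Phi by rewrite -mulmxA mul_block_col !mulmx1 !mulmx0 !addr0.
have [|X [uX hX hUX hw]] := frame_exists uX1 hX1 hu.
  by rewrite /row_free rank_rV t0.
exists X; split => //; rewrite hw // mulmxA -(hsubmxK (v *m X0)) lv mul_row_block.
by rewrite !mul0mx mulmx0 !add0r hY -{1}lt' hsubmxK.
Qed.

End Frames.

Section CoordinateFrames.
Variables (K : fieldType) (m : nat).
Local Notation V := 'rV[K]_m.+2.
Implicit Types (x u w : V) (phi psi : 'cV[K]_m.+2).

Local Notation i0 := (ord0 : 'I_m.+2).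
Local Notation i1 := (Ordinal (isT : 1 < m.+2)%N : 'I_m.+2).
Local Notation pair u phi := ((u *m phi) ord0 ord0).

Definition row_of_seq (s : seq K) : V := \row_i nth 0 s i.

Definition two_columns phi psi : 'M[K]_(2 + m, 2) :=
  \matrix_(i, j) (if j == ord0 then phi i ord0 else psi i ord0).

Lemma mul_two_columns x phi psi (j : 'I_2) : ((x : 'rV_(2 + m)) *m two_columns phi psi) ord0 j =
  if j == ord0 then pair x phi else pair x psi.
Proof. by rewrite mxE; case: ifP => j0; rewrite mxE; apply: eq_bigr => i _; rewrite mxE j0. Qed.

Lemma frame_pullback (X : 'M[K]_(2 + m)) phi psi :
  X *m col_mx 1%:M 0 = two_columns phi psi -> forall x : V,
  ((x : 'rV_(2 + m)) *m X) ord0 i0 = pair x phi /\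
  ((x : 'rV_(2 + m)) *m X) ord0 i1 = pair x psi.
Proof.
move=> hX x; have h (j : 'I_2) : ((x : 'rV_(2 + m)) *m X) ord0 (lshift m j) =
    if j == ord0 then pair x phi else pair x psi.
  by rewrite -mul_two_columns -hX mulmxA mulmx_E [RHS]mxE.
split.
  have <- : lshift m (ord0 : 'I_2) = i0 by apply: val_inj.
  by rewrite h.
have <- : lshift m (Ordinal (isT : (1 < 2)%N)) = i1 by apply: val_inj.
by rewrite h.
Qed.

Lemma lsubmx_row_of_seq u phi psi (s : seq K) :
  nth 0 s 0 = pair u phi -> nth 0 s 1 = pair u psi ->
  (u : 'rV_(2 + m)) *m two_columns phi psi = lsubmx (row_of_seq s : 'rV_(2 + m)).
Proof.
move=> h0 h1; apply/rowP => j; rewrite mul_two_columns [RHS]mxE [RHS]mxE /=.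
by case: j => [[|[|j]] hj] //=; rewrite ?h0 ?h1.
Qed.

Lemma row_lsubmx r p q (A : 'M[K]_(r, p + q)) i : row i (lsubmx A) = lsubmx (row i A).
Proof. by apply/rowP => j; rewrite !mxE. Qed.

Section Independent.
Variables (phi psi : 'cV[K]_m.+2).
Hypothesis indep : exists x y : V,
  [/\ pair x phi = 0, pair x psi != 0, pair y psi = 0 & pair y phi != 0].

Lemma rank_two_columns : \rank (two_columns phi psi) = 2.
Proof.
have [x [y [x1 x2 y1 y2]]] := indep.
apply/eqP/row_fullP.
exists (\matrix_(i < 2) (if i == ord0 then (pair y phi)^-1 *: (y : 'rV_(2 + m))
                        else (pair x psi)^-1 *: (x : 'rV_(2 + m)))).
apply/row_matrixP => i; rewrite row_mul rowK; apply/rowP => j.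
case: i => [[|[|i]] hi] //=; rewrite -scalemxAl [LHS]mxE mul_two_columns [RHS]mxE [RHS]mxE;
  by case: j => [[|[|j]] hj] //=; rewrite ?x1 ?y1 ?mulr0 ?mulVf.
Qed.

(* In the coordinates x *m X, the functionals phi and psi are the first two
   coordinate functions. *)
Definition adapted_frame (X : 'M[K]_m.+2) := X \in unitmx /\ forall x,
  (x *m X) ord0 i0 = pair x phi /\ (x *m X) ord0 i1 = pair x psi.

(** The first two coordinates of u and v form an invertible 2 x 2 matrix, so all further coordinates
    of both vectors can be made zero at once. *)
Lemma regular_frame u v : pair u phi * pair v psi != pair u psi * pair v phi ->
  exists X, [/\ adapted_frame X, u *m X = row_of_seq [:: pair u phi; pair u psi]
    & v *m X = row_of_seq [:: pair v phi; pair v psi]].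
Proof.
move=> det0.
have [X0 uX0 hX0] := extend_to_unitmx rank_two_columns.
pose Tu : 'rV_(2 + m) := row_of_seq [:: pair u phi; pair u psi].
pose Tv : 'rV_(2 + m) := row_of_seq [:: pair v phi; pair v psi].
have eu : (u : 'rV_(2 + m)) *m two_columns phi psi = lsubmx Tu.
  exact: lsubmx_row_of_seq.
have ev : (v : 'rV_(2 + m)) *m two_columns phi psi = lsubmx Tv.
  exact: lsubmx_row_of_seq.
pose U : 'M[K]_(2, 2 + m) := \matrix_(i < 2) (if i == ord0 then (u : 'rV_(2 + m)) else v).
pose T : 'M[K]_(2, 2 + m) := \matrix_(i < 2) (if i == ord0 then Tu else Tv).
have UT : U *m two_columns phi psi = lsubmx T.
  by apply/row_matrixP => i; rewrite row_mul row_lsubmx !rowK; case: ifP.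
have [|X [uX hX hUX _]] := frame_exists uX0 hX0 UT.
  rewrite -UT; apply: inj_row_free => w; rewrite mulmx_sum_row big_ord_recl big_ord1.
  set a := w _ _; set b := w _ _; rewrite !row_mul !rowK /= => hw.
  have hE j := congr1 (fun M : 'rV_2 => M ord0 j) hw.
  have entry (p q : 'rV[K]_2) j : (a *: p + b *: q) ord0 j = a * p ord0 j + b * q ord0 j.
    by rewrite !mxE.
  have := hE ord0; have := hE (Ordinal (isT : (1 < 2)%N)).
  rewrite !entry !mul_two_columns ![(0 : 'rV_2) _ _]mxE /= => h1 h0.
  (* Row freeness by Cramer's rule: D times either coefficient of the linear relation is zero. *)
  have Dn : pair u phi * pair v psi - pair u psi * pair v phi != 0 by rewrite subr_eq0.
  set D := (X in X != 0) in Dn.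
  have ha : a = 0.
    apply/eqP; have : a * D = 0.
      have -> : a * D = (a * pair u phi + b * pair v phi) * pair v psi
        - (a * pair u psi + b * pair v psi) * pair v phi by rewrite /D; ring.
      by rewrite h0 h1 !mul0r subrr.
    by move/eqP; rewrite mulf_eq0 (negbTE Dn) orbF.
  have hb : b = 0.
    apply/eqP; have : b * D = 0.
      have -> : b * D = (a * pair u psi + b * pair v psi) * pair u phi
        - (a * pair u phi + b * pair v phi) * pair u psi by rewrite /D; ring.
      by rewrite h0 h1 !mul0r subrr.
    by move/eqP; rewrite mulf_eq0 (negbTE Dn) orbF.
  apply/rowP => j; rewrite [RHS]mxE; case: j => [[|[|j]] hj] //.
    by rewrite -ha /a; congr (w _ _); apply: val_inj.
  by rewrite -hb /b; congr (w _ _); apply: val_inj.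
have hr i : row i U *m X = row i T by rewrite -row_mul hUX.
have := hr ord0; have := hr (Ordinal (isT : (1 < 2)%N)); rewrite !rowK /= => hv hu.
exists X; split => //.
by split => //; exact: frame_pullback.
Qed.

Lemma parallel_frame u : pair u phi != 0 ->
  exists2 X, adapted_frame X & u *m X = row_of_seq [:: pair u phi; pair u psi].
Proof.
move=> u0; have [X0 uX0 hX0] := extend_to_unitmx rank_two_columns.
pose Tu : 'rV_(2 + m) := row_of_seq [:: pair u phi; pair u psi].
have eu : (u : 'rV_(2 + m)) *m two_columns phi psi = lsubmx Tu.
  exact: lsubmx_row_of_seq.
have [|X [uX hX hUX _]] := frame_exists uX0 hX0 eu.
  rewrite /row_free rank_rV -eu eqb1; apply: contraNneq u0 => h.
  have := congr1 (fun M : 'rV_2 => M ord0 ord0) h.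
  by rewrite mul_two_columns [in RHS]mxE /= => ->.
by exists X => //; split => //; exact: frame_pullback.
Qed.

Lemma skew_frame u w e : (0 < m)%N -> e != 0 -> pair u phi != 0 -> w != 0 ->
  pair w phi = 0 -> pair w psi = 0 ->
  exists X, [/\ adapted_frame X, u *m X = row_of_seq [:: pair u phi; pair u psi]
    & w *m X = row_of_seq [:: 0; 0; e]].
Proof.
move=> m0 e0 u0 w0 w1 w2.
pose Tu : 'rV_(2 + m) := row_of_seq [:: pair u phi; pair u psi].
have eu : (u : 'rV_(2 + m)) *m two_columns phi psi = lsubmx Tu.
  exact: lsubmx_row_of_seq.
have [||||X [uX hX hu hw]] := @frame_exists_skew _ _ _ (u : 'rV_(2 + m)) (w : 'rV_(2 + m)) Tu
   (row_of_seq [:: 0; 0; e] : 'rV_(2 + m)) rank_two_columns eu _ w0.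
- rewrite -eu; apply: contraNneq u0 => h.
  have := congr1 (fun M : 'rV_2 => M ord0 ord0) h.
  by rewrite mul_two_columns [in RHS]mxE /= => ->.
- by apply/rowP => j; rewrite mul_two_columns [RHS]mxE w1 w2 if_same.
- by apply/rowP => -[[|[|j]] hj]; rewrite !mxE.
- apply: contraNneq e0 => /(congr1 (fun M : 'rV_(2 + m) => M ord0 (rshift 2 (Ordinal m0)))).
  by rewrite !mxE => h; apply/eqP; exact: h.
by exists X; split => //; split => //; exact: frame_pullback.
Qed.

End Independent.
End CoordinateFrames.

(** * Normal forms from adapted coordinates *)

Section NormalForms.
Variables (R : realType) (m : nat).
Local Notation C := R[i].
Local Notation V := 'rV[C]_m.+2.
Implicit Types (x y u : V) (phi : 'cV[C]_m.+2).

Local Notation i0 := (ord0 : 'I_m.+2).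
Local Notation i1 := (Ordinal (isT : 1 < m.+2)%N : 'I_m.+2).
Local Notation pair u phi := ((u *m phi) ord0 ord0).
Local Notation row_of_seq s := (@row_of_seq _ m s).

Lemma crdE y (i : 'I_m.+2) : crd y i = y ord0 i.
Proof. by rewrite /crd valK. Qed.

Lemma crd1E y : crd y 1 = y ord0 i1.
Proof. exact: (crdE y i1). Qed.

Lemma crd0E y : crd y 0 = y ord0 i0.
Proof. exact: (crdE y i0). Qed.

(** Together with [normal_right] this covers all target diagrams, the missing terms being zero
    coefficients. Each map is a fold in one coordinate after a shear along that coordinate. *)
Definition normal_left (c : C) k x : V :=
  with_head x [:: crd x 0 ^+ k; c * crd x 0 + crd x 1].

Definition normal_right (d e : C) k x : V :=
  with_head x [:: crd x 0 + d * crd x 1; crd x 1 ^+ k; e * crd x 1 + crd x 2].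

Lemma ord_cases (i : 'I_m.+2) : [\/ i = i0, i = i1, i = 2 :> nat | (2 < i)%N].
Proof.
case: i => [[|[|[|i]]] hi].
- by constructor 1; exact: val_inj.
- by constructor 2; exact: val_inj.
- by constructor 3.
- by constructor 4.
Qed.

Definition shear (a : 'I_m.+2) (r : V) : 'M[C]_m.+2 := 1%:M + delta_mx a ord0 *m r.

Lemma mul_shear y a (r : V) : y *m shear a r = y + y ord0 a *: r.
Proof.
rewrite mulmxDr mulmx1 mulmxA; congr (_ + _).
by rewrite [y *m _]mx11_scalar mul_scalar_mx -colE mxE.
Qed.

Lemma shear_unit a (r : V) : r ord0 a = 0 -> shear a r \in unitmx.
Proof.
move=> ra; suff h : shear a r *m shear a (- r) = 1%:M by have [] := mulmx1_unit h.
have rd : r *m delta_mx a ord0 = 0 :> 'M[C]_1.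
  by rewrite [LHS]mx11_scalar -colE mxE ra raddf0.
rewrite /shear mulmxN; set D := _ *m r.
have DD : D *m D = 0 by rewrite /D -mulmxA (mulmxA r) rd mul0mx mulmx0.
by rewrite mulmxDl mul1mx mulmxBr mulmx1 DD subr0 subrK.
Qed.

Lemma mul_rank_one x phi u : x *m (1%:M + phi *m u) = x + pair x phi *: u.
Proof. by rewrite mulmxDr mulmx1 mulmxA [x *m phi in LHS]mx11_scalar mul_scalar_mx. Qed.

(** Such a reflection is diagonal in any coordinates whose first functional is a multiple of phi and
    which send u to the first axis. *)
Lemma rotate_rank_one (phi : 'cV[C]_m.+2) u (s l q : C) (T : 'M[C]_m.+2) x :
  (forall y, (y *m T) ord0 i0 = s * pair y phi) -> pair u phi = l - 1 ->
  u *m T = row_of_seq [:: q] ->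
  x *m (1%:M + phi *m u) *m T = rot_head l (x *m T).
Proof.
move=> hT hu uT; rewrite mul_rank_one mulmxDl -scalemxAl uT.
apply/rowP => i; rewrite /rot_head [RHS]mxE [LHS]mxE; case: eqP => [->|i_n0].
  have := hT u; rewrite uT hu hT !mxE /= => ->; ring.
rewrite !mxE nth_default ?mulr0 ?addr0 //=.
by case: i i_n0 => [[|i] hi] // h; case: h; exact: val_inj.
Qed.

Section Assembly.
Variables (k1 k2 : nat) (p1 p2 : V -> V) (phi1 phi2 : 'cV[C]_m.+2) (u1 u2 : V).
Variables (l1 l2 : C).
Hypotheses (f1 : is_fold k1 p1) (f2 : is_fold k2 p2).
Hypotheses (r1 : k1.-primitive_root l1) (r2 : k2.-primitive_root l2).
Hypotheses (h1 : pair u1 phi1 = l1 - 1) (h2 : pair u2 phi2 = l2 - 1).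
Hypotheses (a1 : germ_eq (p1 \o mulmxr (1%:M + phi1 *m u1)) p1).
Hypotheses (a2 : germ_eq (p2 \o mulmxr (1%:M + phi2 *m u2)) p2).

(** The shear y + y_0 (0, c) sends (p, - c p) to p times the first axis, and the shear for
    [normal_right] sends (- d q, q, - e q) to q times the second axis. These are exactly the
    conditions for [rotate_rank_one]; the common frame X becomes the source change of the
    equivalence. *)
Lemma normal_forms (c d e s t p q : C) (X : 'M[C]_m.+2) :
  adapted_frame (s *: phi1) (t *: phi2) X ->
  u1 *m X = row_of_seq [:: p; - c * p] ->
  u2 *m X = row_of_seq [:: - d * q; q; - e * q] ->
  equivalent_diagrams p1 p2 (normal_left c k1) (normal_right d e k2).
Proof.
move=> [uX hX] hu1 hu2.
have hX0 y : (y *m X) ord0 i0 = s * pair y phi1.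
  by rewrite (hX y).1 -scalemxAr mxE.
have hX1 y : (y *m X) ord0 i1 = t * pair y phi2.
  by rewrite (hX y).2 -scalemxAr mxE.
pose w1 := row_of_seq [:: 0; c]; pose w2 := row_of_seq [:: d; 0; e].
pose T1 := X *m shear i0 w1.
(* The standard fold acts on coordinate 0, so coordinates 0 and 1 are exchanged before it and
   exchanged back in the target by [P]. *)
pose T2 := X *m shear i1 w2 *m tperm_mx i0 i1.
have uT1 : T1 \in unitmx by rewrite unitmx_mul uX shear_unit // mxE.
have uT2 : T2 \in unitmx.
  by rewrite !unitmx_mul uX unitmx_perm shear_unit // mxE.
have permE y i : (y *m tperm_mx i0 i1) ord0 i = y ord0 (tperm i0 i1 i).
  by rewrite -xcolE mxE.
have rot1 x : x *m (1%:M + phi1 *m u1) *m T1 = rot_head l1 (x *m T1).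
  apply: (@rotate_rank_one _ _ s _ p) => //.
    by move=> y; rewrite mulmxA mul_shear mxE [X in _ + X]mxE [w1 _ _]mxE mulr0 addr0.
  rewrite mulmxA mul_shear hu1; apply/rowP => i; rewrite !mxE /=.
  have [->|->|->|hi] := ord_cases i; rewrite /=; try ring.
  have hi1 : (1 < i)%N := ltnW hi; have hi0 : (0 < i)%N := ltnW hi1.
  by rewrite !nth_default // mulr0 addr0.
have rot2 x : x *m (1%:M + phi2 *m u2) *m T2 = rot_head l2 (x *m T2).
  apply: (@rotate_rank_one _ _ t _ q) => //.
    move=> y; rewrite !mulmxA permE tpermL mul_shear mxE [X in _ + X]mxE [w2 _ _]mxE.
    by rewrite mulr0 addr0.
  rewrite !mulmxA mul_shear hu2; apply/rowP => i; rewrite permE !mxE /=.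
  have [->|->|hi|hi] := ord_cases i.
  - by rewrite tpermL /=; ring.
  - by rewrite tpermR /=; ring.
  - rewrite tpermD; last 2 first.
    + by apply/eqP => ii; move: hi; rewrite -ii.
    + by apply/eqP => ii; move: hi; rewrite -ii.
    by rewrite hi /=; ring.
  - rewrite tpermD; last 2 first.
    + by apply/eqP => ii; move: hi; rewrite -ii.
    + by apply/eqP => ii; move: hi; rewrite -ii.
    have hi1 : (1 < i)%N := ltnW hi; have hi0 : (0 < i)%N := ltnW hi1.
    by rewrite !nth_default // mulr0 addr0.
have [L1 bL1 E1] := fold_linear_normal_form f1 r1 uT1 rot1 a1.
have [L2 bL2 E2] := fold_linear_normal_form f2 r2 uT2 rot2 a2.
have gX := germ_inverse_mulmxr uX.
have hX' : holo_germ (mulmxr (invmx X) : V -> V) by case: gX.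
pose P := @tperm_mx C m.+2 i0 i1.
have bP : biholo_germ (mulmxr P : V -> V).
  by exists (mulmxr (invmx P)); apply: germ_inverse_mulmxr; exact: unitmx_perm.
have N1 x : normal_left c k1 (x *m X) = std_fold k1 (x *m T1).
  rewrite std_foldE mulmxA mul_shear; set y := x *m X.
  apply/rowP => i; rewrite /normal_left crd0E crd1E !mxE /=.
  have [->|->|hi|hi] := ord_cases i; rewrite /=.
  - by rewrite mulr0 addr0.
  - by ring.
  - have n0 : i != i0 by apply/eqP => ii; move: hi; rewrite ii.
    by rewrite (negbTE n0) hi /= mulr0 addr0.
  - have hi1 : (1 < i)%N := ltnW hi; have hi0 : (0 < i)%N := ltnW hi1.
    have n0 : i != i0 by apply/eqP => ii; move: hi; rewrite ii.
    by rewrite (negbTE n0) !nth_default // mulr0 addr0.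
have N2 x : normal_right d e k2 (x *m X) = mulmxr P (std_fold k2 (x *m T2)).
  rewrite std_foldE !mulmxA mul_shear; set y := x *m X.
  apply/rowP => i; rewrite /= permE /normal_right crd0E crd1E [LHS]mxE [RHS]mxE permE.
  have [->|->|hi|hi] := ord_cases i.
  - by rewrite tpermL /= permE tpermR !mxE /=; ring.
  - by rewrite tpermR /= tpermL !mxE /= mulr0 addr0.
  - have n0 : i0 != i by apply/eqP => ii; move: hi; rewrite -ii.
    have n1 : i1 != i by apply/eqP => ii; move: hi; rewrite -ii.
    have c2 : crd y 2 = y ord0 i by rewrite -crdE hi.
    rewrite tpermD // eq_sym (negbTE n0) permE tpermD // c2 !mxE hi /=.
    ring.
  - have n0 : i0 != i by apply/eqP => ii; move: hi; rewrite -ii.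
    have n1 : i1 != i by apply/eqP => ii; move: hi; rewrite -ii.
    rewrite tpermD // eq_sym (negbTE n0) permE tpermD // !mxE.
    by rewrite !nth_default //= mulr0 addr0.
exists L1, (mulmxr P \o L2), (mulmxr X), (mulmxr (invmx X)); split => //.
- exact: biholo_germ_comp bL2 bP.
- have -> : normal_left c k1 = (fun x => std_fold k1 (x *m T1)) \o mulmxr (invmx X).
    by apply/funext => x /=; rewrite -N1 mulmxKV.
  exact: germ_eq_compr hX' E1.
- have -> : normal_right d e k2 =
      mulmxr P \o ((fun x => std_fold k2 (x *m T2)) \o mulmxr (invmx X)).
    by apply/funext => x; rewrite /comp -N2 /= mulmxKV.
  exact: germ_eq_compl (germ_eq_compr hX' E2).
Qed.


Lemma row_of_seq_rcons0 (a b : C) : row_of_seq [:: a; b] = row_of_seq [:: a; b; 0].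
Proof.
by apply/rowP => i; rewrite !mxE; case: (nat_of_ord i) => [|[|[|j]]] //=; rewrite nth_nil.
Qed.

Lemma pair_scale u phi (s : C) : pair u (s *: phi) = s * pair u phi.
Proof. by rewrite -scalemxAr mxE. Qed.

Lemma pair_sub u v phi (k : C) : pair (u - k *: v) phi = pair u phi - k * pair v phi.
Proof.
rewrite mulmxBl -scalemxAl mxE; congr (_ + _).
by rewrite mxE; congr (- _); rewrite mxE.
Qed.

Hypothesis indep : exists x y : V,
  [/\ pair x phi1 = 0, pair x phi2 != 0, pair y phi2 = 0 & pair y phi1 != 0].

Lemma indep_scale (s t : C) : s != 0 -> t != 0 -> exists x y : V,
  [/\ pair x (s *: phi1) = 0, pair x (t *: phi2) != 0,
      pair y (t *: phi2) = 0 & pair y (s *: phi1) != 0].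
Proof.
move=> s0 t0; have [x [y [e1 e2 e3 e4]]] := indep; exists x, y.
by rewrite !pair_scale e1 e3 !mulr0 !mulf_neq0.
Qed.

Local Notation alpha := (pair u1 phi2).
Local Notation beta := (pair u2 phi1).

(** The equations are the conditions of [normal_forms] for p = s (l1 - 1) and q = t (l2 - 1); s and
    t are the free scalings of the two functionals. *)
Lemma regular_normal_forms (c d s t : C) : s != 0 -> t != 0 ->
  (l1 - 1) * (l2 - 1) != alpha * beta ->
  t * alpha = - c * (s * (l1 - 1)) -> s * beta = - d * (t * (l2 - 1)) ->
  equivalent_diagrams p1 p2 (normal_left c k1) (normal_right d 0 k2).
Proof.
move=> s0 t0 det0 hc hd.
have [|X [hX]] := @regular_frame _ _ _ _ (indep_scale s0 t0) u1 u2.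
  rewrite !pair_scale h1 h2 mulrACA [X in _ != X]mulrACA [t * s]mulrC.
  by rewrite (inj_eq (mulfI (mulf_neq0 s0 t0))).
rewrite !pair_scale h1 h2 hc hd => hu1; rewrite row_of_seq_rcons0 => hu2.
by apply: (normal_forms hX hu1); rewrite hu2 oppr0 mul0r.
Qed.

(** The pairing matrix is singular, so only u1 can be placed freely; u2 follows as its multiple. The
    scalings are 1 and beta. *)
Lemma parallel_normal_forms (kappa : C) : u2 = kappa *: u1 -> l1 != 1 -> l2 != 1 ->
  beta != 0 -> (l1 - 1) * (l2 - 1) = alpha * beta ->
  equivalent_diagrams p1 p2 (normal_left (1 - l2) k1) (normal_right (1 / (1 - l2)) 0 k2).
Proof.
move=> uE l1n l2n b0 det0.
have l1s : l1 - 1 != 0 by rewrite subr_eq0.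
have l2s : 1 - l2 != 0 by rewrite subr_eq0 eq_sym.
have [|X hX] := parallel_frame (indep_scale (oner_neq0 C) b0) (u := u1).
  by rewrite pair_scale mul1r h1.
rewrite !pair_scale h1 (mul1r (l1 - 1)) => hu1.
have e1 : beta * alpha = - (1 - l2) * (l1 - 1) by rewrite mulrC -det0; ring.
rewrite e1 in hu1.
apply: (normal_forms (p := l1 - 1) (q := - (1 - l2) * (kappa * (l1 - 1))) hX hu1).
rewrite [X in X *m _]uE -scalemxAl hu1; apply/rowP => i; rewrite !mxE.
case: (nat_of_ord i) => [|[|[|j]]] /=.
- by field.
- by ring.
- by rewrite oppr0 mul0r mulr0.
- by rewrite !nth_nil mulr0.
Qed.

Lemma skew_normal_forms : (0 < m)%N -> l1 != 1 -> l2 != 1 -> beta != 0 ->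
  (l1 - 1) * (l2 - 1) = alpha * beta -> (forall kappa, u2 <> kappa *: u1) ->
  equivalent_diagrams p1 p2 (normal_left (1 - l2) k1)
    (normal_right (1 / (1 - l2)) (1 / (1 - l2)) k2).
Proof.
move=> m0 l1n l2n b0 det0 nuE.
have l1s : l1 - 1 != 0 by rewrite subr_eq0.
have l2s : 1 - l2 != 0 by rewrite subr_eq0 eq_sym.
(* Chosen so that phi1 kills w; singularity of the pairing matrix makes phi2 kill it too. Thus w
   lives in the coordinates beyond the first two. *)
pose kappa := beta / (l1 - 1); pose w := u2 - kappa *: u1.
have w0 : w != 0 by rewrite subr_eq0; apply/eqP.
have w1 : pair w phi1 = 0 by rewrite pair_sub h1 /kappa divfK // subrr.
have w2 : pair w phi2 = 0.
  rewrite pair_sub h2; apply: (mulfI l1s); rewrite mulr0 mulrBr det0 /kappa.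
  by field.
(* The third coordinate of w is set to beta, which is - e q for q = beta (l2 - 1) and e = 1 / (1 -
   l2). *)
have [|||X [hX hu1 hw]] := skew_frame (indep_scale (oner_neq0 C) b0) m0 b0 _ w0 (u := u1).
- by rewrite pair_scale mul1r h1.
- by rewrite pair_scale w1 mulr0.
- by rewrite pair_scale w2 mulr0.
move: hu1; rewrite !pair_scale h1 (mul1r (l1 - 1)) => hu1.
have e1 : beta * alpha = - (1 - l2) * (l1 - 1) by rewrite mulrC -det0; ring.
rewrite e1 in hu1.
apply: (normal_forms (p := l1 - 1) (q := beta * (l2 - 1)) hX hu1).
have -> : u2 *m X = w *m X + kappa *: (u1 *m X) by rewrite scalemxAl -mulmxDl /w subrK.
rewrite hu1 hw; have [b bE] : exists b, b = beta by eexists.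
rewrite /kappa -bE; apply/rowP => i; rewrite !mxE.
case: (nat_of_ord i) => [|[|[|j]]] /=.
- by field; rewrite l1s l2s.
- by field.
- by rewrite mulr0 addr0; field.
- by rewrite !nth_nil mulr0 addr0.
Qed.


End Assembly.
End NormalForms.

Lemma generated_commute (K : numFieldType) n (a1 a2 f g : 'rV[K]_n -> 'rV[K]_n) :
  f \o a1 = a1 \o f -> f \o a2 = a2 \o f -> generated a1 a2 g -> f \o g = g \o f.
Proof.
move=> h1 h2; elim=> // {g}[g g' _ IH _ IH'|g g' _ IH gg' g'g].
  by rewrite compA IH -compA IH' compA.
apply/funext => x /=; apply: (can_inj gg').
have := congr1 (fun u => u (g' x)) IH; rewrite /= g'g => ->.
by rewrite gg'.
Qed.

Lemma generated_abelianE (K : numFieldType) n (a1 a2 : 'rV[K]_n -> 'rV[K]_n) :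
  generated_abelian a1 a2 <-> a1 \o a2 = a2 \o a1.
Proof.
split=> [h|h f g hf hg]; first by apply: h; constructor.
apply: (@generated_commute _ _ a1 a2) => //.
- by apply/esym; apply: (@generated_commute _ _ a1 a2) hf.
- by apply/esym; apply: (@generated_commute _ _ a1 a2) hf.
Qed.

(** * Invariants of a pair of linear reflections *)

Section RankOnePairs.
Variables (R : realType) (m : nat).
Local Notation C := R[i].
Local Notation V := 'rV[C]_m.+2.
Local Notation pair u phi := ((u *m phi) ord0 ord0).
Variables (a1 a2 : {linear V -> V}) (phi1 phi2 : 'cV[C]_m.+2) (u1 u2 : V) (l1 l2 : C).
Hypotheses (A1 : lin1_mx a1 = 1%:M + phi1 *m u1) (A2 : lin1_mx a2 = 1%:M + phi2 *m u2).
Hypotheses (h1 : pair u1 phi1 = l1 - 1) (h2 : pair u2 phi2 = l2 - 1).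
Hypotheses (l1n : l1 != 1) (l2n : l2 != 1).

Lemma rank_one_apply (a : {linear V -> V}) (phi : 'cV[C]_m.+2) (u x : V) :
  lin1_mx a = 1%:M + phi *m u -> a x = x + pair x phi *: u.
Proof. by move=> hA; rewrite -mul_rV_lin1 hA mul_rank_one. Qed.

Lemma eigenvector_neq0 (phi : 'cV[C]_m.+2) (u : V) (l : C) :
  pair u phi = l - 1 -> l != 1 -> u != 0.
Proof.
by move=> h; apply: contraNneq => u0; rewrite -subr_eq0 -h u0 mul0mx mxE.
Qed.

(** Decompose u2 along the two tangent spaces: the part tangent to Fix a1 is killed by phi1 but
    keeps the nonzero pairing of u2 with phi2. Decomposing u1 gives the other vector. *)
Lemma transversal_indep : transversal_reflections a1 a2 -> exists x y : V,
  [/\ pair x phi1 = 0, pair x phi2 != 0, pair y phi2 = 0 & pair y phi1 != 0].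
Proof.
move=> htr; have u10 := eigenvector_neq0 h1 l1n; have u20 := eigenvector_neq0 h2 l2n.
have [v1 [v2 [t1 t2 e]]] := htr u2; have [w1 [w2 [s1 s2 e']]] := htr u1.
have tF1 := tangent_Fix A1 u10; have tF2 := tangent_Fix A2 u20.
exists v1, w2; split.
- by rewrite tF1 // mxE.
- by move: h2; rewrite e mulmxDl (tF2 _ t2) addr0 => ->; rewrite subr_eq0.
- by rewrite tF2 // mxE.
- by move: h1; rewrite e' mulmxDl (tF1 _ s1) add0r => ->; rewrite subr_eq0.
Qed.

Lemma abelian_pairings : transversal_reflections a1 a2 ->
  generated_abelian a1 a2 <-> pair u1 phi2 = 0 /\ pair u2 phi1 = 0.
Proof.
move=> htr; rewrite generated_abelianE.
have e1 x := rank_one_apply x A1; have e2 x := rank_one_apply x A2.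
have pD (x : V) (c : C) (u : V) (phi : 'cV[C]_m.+2) : pair (x + c *: u) phi = pair x phi + c * pair u phi.
  by rewrite mulmxDl -scalemxAl mxE; congr (_ + _); rewrite mxE.
split=> [h|[z1 z2]].
  have [x [y [x1 x2 y1 y2]]] := transversal_indep htr.
  have u10 := eigenvector_neq0 h1 l1n; have u20 := eigenvector_neq0 h2 l2n.
  (* The commutator relation applied to w; evaluating it at the two independent vectors isolates
     each pairing. *)
  have hE (w : V) : pair w phi2 * pair u2 phi1 *: u1 = pair w phi1 * pair u1 phi2 *: u2.
    have := congr1 (fun f : V -> V => f w) h; rewrite /= !e1 !e2 !pD !scalerDl => /eqP.
    rewrite -subr_eq0 => /eqP hw; apply/eqP; rewrite -subr_eq0 -hw.
    apply/eqP/rowP => i; rewrite !mxE; ring.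
  split.
    have := hE y; rewrite y1 mul0r scale0r => /esym/eqP.
    by rewrite scaler_eq0 (negbTE u20) orbF mulf_eq0 (negbTE y2) => /eqP.
  have := hE x; rewrite x1 mul0r scale0r => /eqP.
  by rewrite scaler_eq0 (negbTE u10) orbF mulf_eq0 (negbTE x2) => /eqP.
apply/funext => x; rewrite /= !e1 !e2 !pD z1 z2 !mulr0 !addr0 -!addrA.
by congr (_ + _); rewrite addrC.
Qed.

Lemma tr_map_comp : tr_map (a1 \o a2) =
  m.+2%:R + (l1 - 1) + (l2 - 1) + pair u1 phi2 * pair u2 phi1.
Proof.
have -> : tr_map (a1 \o a2) = \tr (lin1_mx a2 *m lin1_mx a1).
  congr (\tr _); apply/row_matrixP => i; rewrite row_mul.
  apply/rowP => j; rewrite mul_rV_lin1 mxE [lin1_mx _ _ _]mxE /=; congr ((a1 _) _ _).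
  by rewrite rowE mul_rV_lin1.
have T3 : \tr (phi2 *m u2 *m (phi1 *m u1)) = pair u2 phi1 * pair u1 phi2.
  rewrite -mulmxA mxtrace_mulC trace_mx11 mulmxA -(mulmxA (u2 *m phi1)).
  by rewrite {1}[u2 *m phi1]mx11_scalar mul_scalar_mx mxE.
rewrite A1 A2 mulmxDl mul1mx mulmxDr mulmx1 !mxtraceD mxtrace1 T3.
by rewrite (mxtrace_mulC phi1) (mxtrace_mulC phi2) !trace_mx11 h1 h2; ring.
Qed.

Lemma eigenspace_rank_one (a : {linear V -> V}) (phi : 'cV[C]_m.+2) (u : V) (l : C) (v : V) :
  lin1_mx a = 1%:M + phi *m u -> pair u phi = l - 1 -> l != 1 ->
  eigenspace_map a l v <-> exists c, v = c *: u.
Proof.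
move=> hA hu ln; have ls : l - 1 != 0 by rewrite subr_eq0.
rewrite /eigenspace_map /=; split=> [/eigenspaceP|[c ->]].
  rewrite hA mul_rank_one => hv; exists (pair v phi / (l - 1)).
  apply: (scalerI ls); rewrite scalerA mulrC divfK // scalerBl scale1r -hv.
  by rewrite addrC addKr.
apply/eigenspaceP; rewrite hA mul_rank_one -scalemxAl mxE hu scalerA -scalerA scalerA.
by rewrite -scalerDl; congr (_ *: _); ring.
Qed.

Lemma eigenspace_sub_Fix : eigenspace_map a2 l2 `<=` Fix a1 <-> pair u2 phi1 = 0.
Proof.
have u10 := eigenvector_neq0 h1 l1n.
split=> [h|z v /(eigenspace_rank_one _ A2 h2 l2n)[c ->]].
  have : Fix a1 u2 by apply/h/(eigenspace_rank_one _ A2 h2 l2n); exists 1; rewrite scale1r.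
  rewrite /Fix /= (rank_one_apply _ A1) => /eqP.
  by rewrite -subr_eq0 addrAC subrr add0r scaler_eq0 (negbTE u10) orbF => /eqP.
by rewrite /Fix /= (rank_one_apply _ A1) -scalemxAl mxE z mulr0 scale0r addr0.
Qed.

Lemma eigenspace_eqP : eigenspace_map a1 l1 = eigenspace_map a2 l2 <->
  exists c, u2 = c *: u1.
Proof.
have u20 := eigenvector_neq0 h2 l2n.
split=> [h|[c uE]].
  apply/(eigenspace_rank_one _ A1 h1 l1n); rewrite h.
  by apply/(eigenspace_rank_one _ A2 h2 l2n); exists 1; rewrite scale1r.
have c0 : c != 0 by apply: contraNneq u20 => c0; rewrite uE c0 scale0r.
apply/seteqP; split => v /=.
  move=> /(eigenspace_rank_one _ A1 h1 l1n)[d ->].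
  by apply/(eigenspace_rank_one _ A2 h2 l2n); exists (d / c); rewrite uE scalerA divfK.
move=> /(eigenspace_rank_one _ A2 h2 l2n)[d ->].
by apply/(eigenspace_rank_one _ A1 h1 l1n); exists (d * c); rewrite uE scalerA.
Qed.

End RankOnePairs.

Lemma normal_left0 (R : realType) m k (x : 'rV[R[i]]_m.+2) :
  with_head x [:: crd x 0 ^+ k] = normal_left 0 k x.
Proof.
apply/rowP => i; rewrite /normal_left mul0r add0r crd1E !mxE.
by have [->|->|->|hi] := ord_cases i; rewrite //= !nth_default // ltnW // ltnW.
Qed.

Lemma normal_right0 (R : realType) m (d : R[i]) k (x : 'rV[R[i]]_m.+2) :
  with_head x [:: crd x 0 + d * crd x 1; crd x 1 ^+ k] = normal_right d 0 k x.
Proof.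
apply/rowP => i; rewrite /normal_right mul0r add0r !mxE.
have [->|->|hi|hi] := ord_cases i; rewrite //=; first by rewrite hi /= -crdE hi.
by rewrite !nth_default // ltnW.
Qed.

Unset Implicit Arguments.
Set Strict Implicit.

Theorem theorem4p13 (R : realType) (n : nat) (hn : (2 <= n)%N)
  (k1 k2 : nat) (p1 p2 : 'rV[R[i]]_n -> 'rV[R[i]]_n)
  (a1 a2 : {linear 'rV[R[i]]_n -> 'rV[R[i]]_n}) (l1 l2 : R[i])
  (hp : divergent_diagram k1 k2 p1 p2)
  (ha1 : reflection a1 k1) (ha2 : reflection a2 k2)
  (htr : transversal_reflections a1 a2)
  (hpa : associated p1 p2 a1 a2)
  (hl1 : eigenvalue_map a1 l1) (hl1' : l1 <> 1)
  (hl2 : eigenvalue_map a2 l2) (hl2' : l2 <> 1) :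
  (* (i) *)
  (generated_abelian a1 a2 ->
     equivalent_diagrams p1 p2
       (fun x => with_head x [:: crd x 0 ^+ k1])
       (fun x => with_head x [:: crd x 0; crd x 1 ^+ k2]))
  /\
  (* (ii) *)
  (~ generated_abelian a1 a2 ->
   tr_map (a1 \o a2) <> l1 * l2 + (n%:R - 1) ->
     (eigenspace_map a2 l2 `<=` Fix a1 ->
        equivalent_diagrams p1 p2
          (fun x => with_head x
             [:: crd x 0 ^+ k1; 1 / (1 - l1) * crd x 0 + crd x 1])
          (fun x => with_head x [:: crd x 0; crd x 1 ^+ k2]))
     /\
     (~ (eigenspace_map a2 l2 `<=` Fix a1) ->
        equivalent_diagrams p1 p2
          (fun x => with_head x
             [:: crd x 0 ^+ k1;
                 (tr_map (a1 \o a2) - l1 - l2 + (2 - n%:R)) / (1 - l1) * crd x 0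
                 + crd x 1])
          (fun x => with_head x
             [:: crd x 0 + 1 / (1 - l2) * crd x 1; crd x 1 ^+ k2])))
  /\
  (* (iii) *)
  ((3 <= n)%N ->
   ~ generated_abelian a1 a2 ->
   tr_map (a1 \o a2) = l1 * l2 + (n%:R - 1) ->
     (eigenspace_map a1 l1 = eigenspace_map a2 l2 ->
        equivalent_diagrams p1 p2
          (fun x => with_head x
             [:: crd x 0 ^+ k1; (1 - l2) * crd x 0 + crd x 1])
          (fun x => with_head x
             [:: crd x 0 + 1 / (1 - l2) * crd x 1; crd x 1 ^+ k2]))
     /\
     (eigenspace_map a1 l1 <> eigenspace_map a2 l2 ->
        equivalent_diagrams p1 p2
          (fun x => with_head x
             [:: crd x 0 ^+ k1; (1 - l2) * crd x 0 + crd x 1])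
          (fun x => with_head x
             [:: crd x 0 + 1 / (1 - l2) * crd x 1; crd x 1 ^+ k2;
                 1 / (1 - l2) * crd x 1 + crd x 2]))).
Proof.
destruct n as [|[|m]]; [discriminate hn|discriminate hn|].
move: hp hpa => [f1 f2] [ap1 ap2].
have [phi1 [u1 [A1 hu1 r1]]] := reflection_matrix ha1 hl1 hl1'.
have [phi2 [u2 [A2 hu2 r2]]] := reflection_matrix ha2 hl2 hl2'.
have h1 : (u1 *m phi1) ord0 ord0 = l1 - 1 by rewrite hu1 mxE.
have h2 : (u2 *m phi2) ord0 ord0 = l2 - 1 by rewrite hu2 mxE.
have l1n : l1 != 1 by apply/eqP.
have l2n : l2 != 1 by apply/eqP.
have l1s : 1 - l1 != 0 by rewrite subr_eq0 eq_sym.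
have l2s : 1 - l2 != 0 by rewrite subr_eq0 eq_sym.
have indep := transversal_indep A1 A2 h1 h2 l1n l2n htr.
have aM (a : {linear 'rV[R[i]]_m.+2 -> 'rV[R[i]]_m.+2}) : mulmxr (lin1_mx a) = a :> (_ -> _).
  by apply/funext => x /=; rewrite mul_rV_lin1.
rewrite -(aM a1) A1 in ap1; rewrite -(aM a2) A2 in ap2.
have reg := regular_normal_forms f1 f2 r1 r2 h1 h2 ap1 ap2 indep.
have par := parallel_normal_forms f1 f2 r1 r2 h1 h2 ap1 ap2 indep.
have skew := skew_normal_forms f1 f2 r1 r2 h1 h2 ap1 ap2 indep.
have trE := tr_map_comp A1 A2 h1 h2.
have abE := abelian_pairings A1 A2 h1 h2 l1n l2n htr.
have subE := eigenspace_sub_Fix A1 A2 h1 h2 l1n l2n.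
have eqE := eigenspace_eqP A1 A2 h1 h2 l1n l2n.
set alpha := (u1 *m phi2) ord0 ord0 in reg par skew trE abE subE.
set beta := (u2 *m phi1) ord0 ord0 in reg par skew trE abE subE.
have N1 k : (fun x : 'rV[R[i]]_m.+2 => with_head x [:: crd x 0 ^+ k]) = normal_left 0 k.
  by apply/funext => x; exact: normal_left0.
have N2 (d : R[i]) k : (fun x : 'rV[R[i]]_m.+2 =>
    with_head x [:: crd x 0 + d * crd x 1; crd x 1 ^+ k]) = normal_right d 0 k.
  by apply/funext => x; exact: normal_right0.
have N20 k : (fun x : 'rV[R[i]]_m.+2 =>
    with_head x [:: crd x 0; crd x 1 ^+ k]) = normal_right 0 0 k.
  by rewrite -N2; apply/funext => x; rewrite mul0r addr0.
have trP : (tr_map (a1 \o a2) = l1 * l2 + (m.+2%:R - 1)) <->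
    ((l1 - 1) * (l2 - 1) = alpha * beta).
  rewrite trE; split=> h.
    have -> : alpha * beta = (m.+2%:R + (l1 - 1) + (l2 - 1) + alpha * beta)
      - (m.+2%:R + (l1 - 1) + (l2 - 1)) by ring.
    by rewrite h; ring.
  by rewrite -h; ring.
split; [|split].
- move=> /abE[z1 z2]; rewrite N1 N20; apply: (reg 0 0 1 1); rewrite ?oner_neq0 //.
  + by rewrite z1 mul0r mulf_neq0 // subr_eq0.
  + by rewrite z1 oppr0 mul0r mulr0.
  + by rewrite z2 oppr0 mul0r mulr0.
- move=> nab ntr.
  have det0 : (l1 - 1) * (l2 - 1) != alpha * beta.
    by apply/eqP => h; apply: ntr; apply/trP.
  split.
    move=> /subE z; have a0 : alpha != 0 by apply/eqP => z'; apply: nab; apply/abE.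
    (* With beta = 0 and alpha nonzero, scaling phi1 by alpha makes c = 1 / (1 - l1). *)
    rewrite N20; apply: (reg _ 0 alpha 1); rewrite ?oner_neq0 //.
      by rewrite mul1r; field.
    by rewrite z oppr0 mul0r mulr0.
  move=> nsub; have b0 : beta != 0 by apply/eqP => z; apply: nsub; apply/subE.
  (* Scaling phi2 by beta makes d = 1 / (1 - l2) and c = alpha beta / (1 - l1), whose numerator is
     the trace expression. *)
  rewrite N2; apply: (reg _ _ 1 beta); rewrite ?oner_neq0 //.
    by rewrite trE; field.
  by field.
- move=> hm nab /trP det0.
  have b0 : beta != 0.
    apply/eqP => z; move: det0; rewrite z mulr0 => /eqP.
    by rewrite mulf_eq0 !subr_eq0 (negbTE l1n) (negbTE l2n).
  split.
    move=> /eqE[c uE]; rewrite N2; exact: (par c).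
  have m0 : (0 < m)%N by move: hm; rewrite !ltnS.
  move=> neq; apply: (skew m0 l1n l2n b0 det0) => c uE.
  by apply: neq; apply/eqE; exists c.
Qed.
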